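(* For any $\eta_0 \in L^1((1,\infty),\mathbb{R})$ with $\|\eta_0\|_1 \le 1$, the system consisting of the integral equation $$\eta(\tau) = S_\tau \eta_0 + \int_0^\tau \beta(s)\, S_{\tau-s} T_1 \mathbb{Q}[\eta(s)]\,ds, \qquad \tau \ge 0,$$ and the trace relation $$\beta(\tau) = e^{\tau-\tau_0}\,\eta(\tau_0,e^{\tau-\tau_0}) \qquad\text{for } 0 \le \tau-\tau_0 \le \log 2,\ \tau_0\ge 0,$$ has a unique global solution $\eta \in C^0([0,\infty),L^1)$, and this solution satisfies $\|\eta(\tau)\|_1 \le 1$ for all $\tau \ge 0$. In addition: 1) if $\eta_0 \in \mathbb{P}$, then $\eta(\tau) \in \mathbb{P}$ for all $\tau \ge 0$; 2) if $\eta_0 \in L^p_\gamma$ for some $p \in [1,\infty)$ and some $\gamma > 1-1/p$, then $\eta \in C^0([0,\infty),L^p_\gamma)$.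
   Context: Fix an integer $N\ge 1$ and real numbers $p_1,\dots,p_N\ge 0$ with $p_1+\dots+p_N=1$. For $\rho\in L^1(\mathbb{R})$ set $\mathbb{Q}[\rho]=\sum_{j=1}^N p_j\,\rho^{*j}$, where $\rho^{*j}=\rho*\dots*\rho$ ($j$ factors, convolution on $\mathbb{R}$). Functions defined on $(1,\infty)$ (or $[1,\infty)$) are extended to $\mathbb{R}$ by $0$ on $(-\infty,1)$. $L^1=L^1((1,\infty),\mathbb{R})$ with norm $\|\cdot\|_1$. $\mathbb{P}=\{\eta\in L^1((1,\infty),\mathbb{R}_+) : \int_1^\infty \eta(y)\,dy=1\}$, where $\mathbb{R}_+=[0,\infty)$. For $p\in[1,\infty)$, $\gamma\ge0$: $L^p_\gamma=\{w\in L^1_{\rm loc}([1,\infty),\mathbb{R}) : \|w\|_{p,\gamma}<\infty\}$ with $\|w\|_{p,\gamma}=\left(\int_1^\infty (y^\gamma|w(y)|)^p\,dy\right)^{1/p}$. $(S_\tau\eta)(y)=e^\tau\eta(e^\tau y)$ for $y\ge1$ and $0$ for $y<1$ ($\tau \ge 0$). $(T_1\eta)(y)=\eta(y-1)$ for $y\ge2$ and $0$ for $y<2$. A solution is a function $\eta\in C^0([0,\infty),L^1)$, written $\eta(\tau,y)=\eta(\tau)(y)$, together with a trace $\beta\in L^1_{\rm loc}([0,\infty),\mathbb{R})$, such that the integral equation holds for all $\tau\ge0$ and, for every $\tau_0\ge0$, the trace relation holds for almost all $\tau\in[\tau_0,\tau_0+\log 2]$. *)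

(* Defs.v *)
From mathcomp Require Import all_boot all_order all_algebra.
From mathcomp Require Import all_classical all_reals all_analysis.

Set Implicit Arguments.
Unset Strict Implicit.
Unset Printing Implicit Defensive.
Import Order.TTheory GRing.Theory Num.Theory.
Import numFieldNormedType.Exports.

Local Open Scope classical_set_scope.
Local Open Scope ring_scope.

(** Elements of L^1((1,oo)) and of L^p_gamma are represented by functions
    [w : R -> R], of which only the values on (1,oo), up to Lebesgue-null sets,
    are meaningful; an element of C^0([0,oo), X) is represented by a family
    [eta : R -> R -> R], of which only the members [eta tau], 0 <= tau, are
    meaningful. *)

Definition inL1 (R : realType) (w : R -> R) : Prop :=
  (@lebesgue_measure R).-integrable `]1, +oo[ (EFin \o w).

Definition norm1 (R : realType) (w : R -> R) : \bar R :=
  (\int[@lebesgue_measure R]_(y in `]1%R, +oo[) (`|w y|%R)%:E)%E.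

Definition ae_eq1 (R : realType) (v w : R -> R) : Prop :=
  {ae @lebesgue_measure R, forall y, 1 < y -> v y = w y}.

Definition inL1loc (R : realType) (D : set R) (w : R -> R) : Prop :=
  forall K : set R, compact K -> K `<=` D ->
    (@lebesgue_measure R).-integrable K (EFin \o w).

Definition inP (R : realType) (w : R -> R) : Prop :=
  [/\ inL1 w,
      {ae @lebesgue_measure R, forall y, 1 < y -> 0 <= w y} &
      (\int[@lebesgue_measure R]_(y in `]1%R, +oo[) (w y)%:E = 1)%E].

Definition normLp (R : realType) (r gamma : R) (w : R -> R) : \bar R :=
  ((\int[@lebesgue_measure R]_(y in `]1%R, +oo[)
      (((y `^ gamma * `|w y|) `^ r)%R)%:E) `^ r^-1)%E.

Definition inLp (R : realType) (r gamma : R) (w : R -> R) : Prop :=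
  inL1loc `[1, +oo[ w /\ (normLp r gamma w < +oo)%E.

(** eta belongs to C^0([0,oo), X), for X the space of the [w] such that [inX w],
    normed by [nrm]. *)
Definition inC0 (R : realType) (inX : (R -> R) -> Prop)
    (nrm : (R -> R) -> \bar R) (eta : R -> R -> R) : Prop :=
  (forall tau, 0 <= tau -> inX (eta tau)) /\
  (forall tau, 0 <= tau ->
     nrm (eta t \- eta tau) @[t --> within `[0, +oo[ (nbhs tau)] --> 0%E).

(** Convolution on the whole line; the junk value of the integral where it does
    not converge only matters on a null set when f and g are integrable. *)
Definition convolution (R : realType) (f g : R -> R) : R -> R :=
  fun y => Rintegral (@lebesgue_measure R) setT (fun x => f x * g (y - x)).

(** f^{*j}, meaningful for 1 <= j *)
Definition conv_pow (R : realType) (f : R -> R) (j : nat) : R -> R :=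
  iter j.-1 (convolution f) f.

Definition Q (R : realType) (N : nat) (p : nat -> R) (rho : R -> R) : R -> R :=
  fun y => \sum_(1 <= j < N.+1) p j * conv_pow rho j y.

Definition ext0 (R : realType) (w : R -> R) : R -> R :=
  fun y => if 1 < y then w y else 0.

Definition S_ (R : realType) (tau : R) (w : R -> R) : R -> R :=
  fun y => if 1 <= y then expR tau * w (expR tau * y) else 0.

Definition T1 (R : realType) (w : R -> R) : R -> R :=
  fun y => if 2 <= y then w (y - 1) else 0.

(** Bochner integral in L^1((1,oo)): [bochner A F g] says that
    F : A -> L^1((1,oo)) is Bochner integrable over A with integral g.  The
    n-th approximating simple function is
    t |-> \sum_(i < m n) 1_(E n i)(t) v n i. *)
Definition step (R : realType) (m : nat) (E : nat -> set R)
    (v : nat -> R -> R) (t : R) : R -> R :=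
  fun y => \sum_(i < m) \1_(E i) t * v i y.

Definition step_integral (R : realType) (m : nat) (E : nat -> set R)
    (v : nat -> R -> R) : R -> R :=
  fun y => \sum_(i < m) fine (@lebesgue_measure R (E i)) * v i y.

Definition bochner (R : realType) (A : set R) (F : R -> R -> R) (g : R -> R)
    : Prop :=
  inL1 g /\
  exists (m : nat -> nat) (E : nat -> nat -> set R) (v : nat -> nat -> R -> R),
    [/\ forall n i, (i < m n)%N ->
          [/\ measurable (E n i), E n i `<=` A,
              (@lebesgue_measure R (E n i) < +oo)%E & inL1 (v n i)],
        {ae @lebesgue_measure R, forall t, A t -> inL1 (F t) /\
          norm1 (F t \- step (m n) (E n) (v n) t) @[n --> \oo] --> 0%E},
        (\int[@lebesgue_measure R]_(t in A)
          norm1 (F t \- step (m n) (E n) (v n) t)%R)%E @[n --> \oo] --> 0%E &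
        norm1 (g \- step_integral (m n) (E n) (v n)) @[n --> \oo] --> 0%E].

Definition integral_equation (R : realType) (N : nat) (p : nat -> R)
    (eta0 : R -> R) (eta : R -> R -> R) (beta : R -> R) : Prop :=
  forall tau, 0 <= tau -> exists2 g : R -> R,
    bochner `[0, tau]
      (fun s y => beta s * S_ (tau - s) (T1 (Q N p (ext0 (eta s)))) y) g &
    ae_eq1 (eta tau) (S_ tau eta0 \+ g).

Definition trace_relation (R : realType) (eta : R -> R -> R) (beta : R -> R)
    : Prop :=
  forall tau0, 0 <= tau0 ->
    {ae @lebesgue_measure R, forall tau, 0 <= tau - tau0 <= ln 2 ->
      beta tau = expR (tau - tau0) * eta tau0 (expR (tau - tau0))}.

Definition is_solution (R : realType) (N : nat) (p : nat -> R)
    (eta0 : R -> R) (eta : R -> R -> R) (beta : R -> R) : Prop :=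
  [/\ inC0 (@inL1 R) (@norm1 R) eta,
      inL1loc `[0, +oo[ beta,
      integral_equation N p eta0 eta beta &
      trace_relation eta beta].

(* Main.v *)
(** In the variable [x = e^tau y] the semigroup [S_tau] becomes the identity: for
    [f(tau, x) = e^(-tau) eta(tau, e^(-tau) x)] and [beta(s) = e^s f(s, e^s)] the
    integral equation reads
      [f(tau, x) = f0(x) + \int_0^tau beta(s) Q[f(s) 1_(e^s, oo)](x - e^s) ds].
    The right-hand side at [x < c + 1] only involves [f(s, y)] with [y < c].  Hence
    the Picard iterates are stationary at [x] after about [x] steps, which gives
    existence pointwise without any estimate, and uniqueness follows by the same
    induction on [c].

    Integrating over [x] the analogous equation for a majorant of [|f|], and
    splitting the left-hand side at [x = e^tau], one gets
    [B + F <= 1 + \int_0^tau |beta| q(F)], where [B = \int_0^tau |beta|],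
    [F = \int_(e^tau)^oo |f|] and [q(F) = \sum_j p_j F^j]; so [F <= 1] propagates
    along the iteration.  For a probability density this is an equality, hence
    [d = 1 - F] satisfies [d <= N \int_0^tau beta d] and vanishes by Gronwall.

    Jensen's inequality bounds the weighted [L^p] norm of [Q u] by that of [u] when
    [|u|_1 <= 1], so Gronwall bounds the norm of [f(tau)], and then the increments of
    [f] by those of [\int |beta|]; together with the strong continuity of
    dilations this gives the continuity of [eta]. *)

(* The obstacle is that the iteration gives no bound on the trace: the masses of successive
   majorants satisfy [B_(n+1) + F_(n+1) <= 1 + B_n], whence only [B_n <= n]. This is harmless for
   [F], because [B_n <= B_(n+1)] and the finite [B_n] cancels. The limit [B] is bounded by a
   different mechanism: a source emitted at time [s] lives on [x > 2 e^s], so [f(., x)] is frozen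
   once [x <= 2 e^tau]. During a time window of length [log 2] the trace thus reads off mass that
   already lay beyond [e^tau], at most 1 per window. The same freezing is the trace relation.

   The majorant takes values in [[0, +oo]], so Tonelli and monotone convergence apply before
   anything is known to be finite; stationarity of the iterates makes [f] and its majorant defined
   everywhere and jointly measurable.

   A competing solution offers no joint measurability, only a family of classes. Uniqueness
   therefore compares Bochner integrals through their simple approximations, below a given level and
   up to null sets. *)
Require Import Defs.
From mathcomp Require Import all_boot all_order all_algebra.
From mathcomp Require Import all_classical all_reals all_analysis.
From mathcomp Require Import measurable_realfun ring lra.
Set Implicit Arguments.
Unset Strict Implicit.
Unset Printing Implicit Defensive.
Import Order.TTheory GRing.Theory Num.Theory.
Import numFieldNormedType.Exports.
Local Open Scope classical_set_scope.
Local Open Scope ring_scope.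

(** * Changes of variables *)

Section change_of_variables.
Context {R : realType}.
Local Notation mu := (@lebesgue_measure R).
Local Open Scope ereal_scope.
Implicit Types h : R -> \bar R.

Let pushf (phi : measurableTypeR R -> measurableTypeR R)
    (mphi : measurable_fun setT phi) :
    {measure set (measurableTypeR R) -> \bar R} :=
  measure_function_pushforward__canonical__measure_function_Measure mu mphi.

(** Lebesgue measure is determined by its values on half-open intervals, and there its push-forward
    by a translation agrees with it. *)
Lemma ge0_integral_shift h (c : R) : measurable_fun [set: R] h ->
  (forall x, 0 <= h x) -> \int[mu]_x h (x - c)%R = \int[mu]_x h x.
Proof.
move=> mh h0; pose phi := fun x : measurableTypeR R => (x - c)%R : measurableTypeR R.
have mphi : measurable_fun setT phi by exact: measurable_funB.
transitivity (\int[pushforward mu phi]_x h x).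
  by rewrite ge0_integral_pushforward.
apply: eq_measure_integral => A mA _.
apply/esym; suff H : forall X, ocitv X -> mu X = pushf mphi X.
  exact: (lebesgue_measure_unique H).
move=> _ [[a b]] _ <-; rewrite /= /pushforward.
have -> : phi @^-1` `]a, b]%classic = `](a + c)%R, (b + c)%R]%classic.
  by apply/seteqP; split=> x /=; rewrite !in_itv/= ltrBrDr lerBlDr.
rewrite !lebesgue_measure_itv/= !lte_fin ltrD2r; case: ifP => // _.
by rewrite -!EFinB; congr (_%:E)%E; lra.
Qed.

Lemma ge0_integral_opp h : measurable_fun [set: R] h ->
  (forall x, 0 <= h x) -> \int[mu]_x h (- x)%R = \int[mu]_x h x.
Proof.
move=> mh h0; pose phi := fun x : measurableTypeR R => (- x)%R : measurableTypeR R.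
have mphi : measurable_fun setT phi by exact: oppr_measurable.
transitivity (\int[pushforward mu phi]_x h x).
  by rewrite ge0_integral_pushforward.
by apply: eq_measure_integral => A mA _; exact: lebesgue_measureN.
Qed.

Lemma ge0_integral_reflect h (c : R) : measurable_fun [set: R] h ->
  (forall x, 0 <= h x) -> \int[mu]_x h (c - x)%R = \int[mu]_x h x.
Proof.
move=> mh h0; rewrite -(ge0_integral_opp mh h0).
have mhN : measurable_fun [set: R] (fun x => h (- x)%R).
  by apply: (measurableT_comp mh); exact: oppr_measurable.
rewrite -(ge0_integral_shift c mhN)//.
by apply: eq_integral => x _; rewrite opprB.
Qed.

(** Same scheme as for translations, applied to [a] times the push-forward by the dilation. *)
Lemma ge0_integral_scale h (a : R) : (0 < a)%R -> measurable_fun [set: R] h ->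
  (forall x, 0 <= h x) -> \int[mu]_x (a%:E * h (a * x)%R) = \int[mu]_x h x.
Proof.
move=> a0 mh h0; pose phi := fun x : measurableTypeR R => (a * x)%R : measurableTypeR R.
have mphi : measurable_fun setT phi by exact: measurable_funM.
rewrite ge0_integralZl//; last 2 first.
- by apply: (measurableT_comp mh).
- by rewrite lee_fin ltW.
transitivity (a%:E * \int[pushforward mu phi]_x h x).
  by rewrite ge0_integral_pushforward.
pose k : {nonneg R} := NngNum (ltW a0).
have <- := @ge0_integral_mscale _ _ R (pushf mphi) setT measurableT k h mh (fun x _ => h0 x).
apply: eq_measure_integral => A mA _.
apply/esym; suff H : forall X, ocitv X -> mu X = mscale k (pushf mphi) X.
  exact: (lebesgue_measure_unique H).
move=> _ [[u v]] _ <-; rewrite /= /mscale /= /pushforward.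
have -> : phi @^-1` `]u, v]%classic = `](u / a)%R, (v / a)%R]%classic.
  by apply/seteqP; split=> x /=; rewrite !in_itv/= ltr_pdivrMr// ler_pdivlMr// mulrC.
rewrite !lebesgue_measure_itv/= !lte_fin ltr_pM2r ?invr_gt0//.
case: ifP => _; last by rewrite mule0.
rewrite -!EFinB -EFinM; congr (_%:E)%E.
by field; rewrite gt_eqF.
Qed.

End change_of_variables.

(** * The substitution [x = e^s] *)

Section exponential_substitution.
Context {R : realType}.
Local Notation mu := (@lebesgue_measure R).
Local Open Scope ereal_scope.

Lemma integral_expR_itv (u v : R) : (u <= v)%R ->
  \int[mu]_(s in `]u, v]) (expR s)%:E = (expR v - expR u)%:E.
Proof.
rewrite le_eqVlt => /predU1P[->|uv].
  by rewrite set_itvoc0 integral_set0 subrr.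
rewrite integral_itv_obnd_cbnd; last first.
  by apply/measurable_EFinP; apply: measurable_funTS; exact: measurable_expR.
rewrite (@continuous_FTC2 _ expR expR)//.
- by apply: continuous_subspaceT => x; exact: continuous_expR.
- split.
  + by move=> x _; exact: derivable_expR.
  + by apply: cvg_at_right_filter; exact: continuous_expR.
  + by apply: cvg_at_left_filter; exact: continuous_expR.
- by move=> x _; rewrite derive1E; apply: derive_val.
Qed.

(* [R * R] is mapped to [R] so that the push-forward of the area under the graph
   of the exponential has density [expR s] in the variable [s > 0]. *)
Let hyp (q : measurableTypeR R * measurableTypeR R) : measurableTypeR R :=
  if (0 < q.1)%R && (0 < q.2 <= expR q.1)%R then expR q.1 else 0%R.

Let mcond : measurable_fun setT
  (fun q : measurableTypeR R * measurableTypeR R =>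
    (0 < q.1)%R && (0 < q.2 <= expR q.1)%R).
Proof.
apply: measurable_and.
  by apply: measurable_fun_ltr => //; exact: measurable_fst.
apply: measurable_and.
  by apply: measurable_fun_ltr => //; exact: measurable_snd.
apply: measurable_fun_ler; first exact: measurable_snd.
by apply: (measurableT_comp (@measurable_expR R)); exact: measurable_fst.
Qed.

Let mhyp : measurable_fun setT hyp.
Proof.
apply: (measurable_fun_ifT mcond) => //.
by apply: (measurableT_comp (@measurable_expR R)); exact: measurable_fst.
Qed.

Let hyp_gt1 : hyp @^-1` `]1%R, +oo[%classic =
  [set q | (0 < q.1)%R && (0 < q.2 <= expR q.1)%R].
Proof.
apply/seteqP; split => -[s r] /=; rewrite in_itv/= andbT /hyp /=.
  by case: ifPn => //; rewrite ltr10.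
by move=> H; rewrite H expR_gt1; case/andP : H.
Qed.

(** Tonelli by vertical sections: above [s > 0] the section is []0, e^s]], whose length supplies the
    Jacobian. *)
Let integral_hyp (k : R -> \bar R) : measurable_fun [set: R] k ->
  (forall x, 0 <= k x) ->
  \int[mu \x mu]_(q in hyp @^-1` `]1%R, +oo[) k (hyp q) =
  \int[mu]_(s in `]0%R, +oo[) ((expR s)%:E * k (expR s)).
Proof.
move=> mk k0.
rewrite integral_mkcond [RHS]integral_mkcond.
set f := _ \_ _.
have mH : measurable (hyp @^-1` `]1%R, +oo[).
  by rewrite -(setTI (_ @^-1` _)); exact: mhyp.
have mf : measurable_fun setT f.
  apply/(measurable_restrictT _ _).1 => //.
  by apply: measurable_funTS; exact: (measurableT_comp mk mhyp).
rewrite fubini_tonelli1//; last by apply: erestrict_ge0.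
apply: eq_integral => s _; rewrite /fubini_F/= patchE mem_setE in_itv/= andbT.
rewrite /f /=.
transitivity (\int[mu]_r (if (0 < s)%R then
   k (expR s) * (\1_(`]0%R, expR s]) r)%:E else 0)).
  apply: eq_integral => r _; rewrite patchE hyp_gt1.
  have -> : ((s, r) \in [set q | (0 < q.1) && (0 < q.2 <= expR q.1)])%R =
      (0 < s)%R && (0 < r <= expR s)%R by exact: asboolb.
  rewrite indicE mem_setE in_itv/= /hyp /=; case: (0 < s)%R => //=.
  by case: (0 < r <= expR s)%R; rewrite ?mule1 ?mule0.
case: ifPn => s0; last exact: integral0.
rewrite ge0_integralZl//.

- rewrite integral_indic// setIT/= lebesgue_measure_itv/= lte_fin expR_gt0.
  by rewrite sube0 muleC.
- by apply/measurable_EFinP; exact: measurable_indic.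
Qed.

(** The area under the exponential is evaluated twice: by vertical sections, which gives the
    left-hand side, and through its push-forward by [hyp], which is Lebesgue measure above 1. *)
Lemma ge0_integral_expR (h : R -> \bar R) : measurable_fun [set: R] h ->
  (forall x, 0 <= h x) ->
  \int[mu]_(s in `]0%R, +oo[) ((expR s)%:E * h (expR s)) =
  \int[mu]_(x in `]1%R, +oo[) h x.
Proof.
move=> mh h0; rewrite -integral_hyp//.
pose N : {measure set (measurableTypeR R) -> \bar R} :=
  measure_function_pushforward__canonical__measure_function_Measure
    (mu \x mu) mhyp.
rewrite -(@ge0_integral_pushforward _ _ _ _ _ _ mhyp)//; last first.
  exact: measurable_funTS.
have mD : measurable (`]1%R, +oo[ : set (measurableTypeR R)) by [].
have mD' : measurable (`]-oo, 1%R] : set (measurableTypeR R)) by [].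
(* The restriction of [N] discards the infinite mass that [hyp] puts at 0. Lebesgue measure below 1
   is added so that uniqueness can be invoked on the whole line. *)
pose M := measure_add (mrestr N mD) (mrestr mu mD').
suff H : forall X, ocitv X -> mu X = M X.
  have E A : measurable A -> mu A = M A by move=> mA; exact: lebesgue_measure_unique.
  apply/esym/eq_measure_integral => A mA AD.
  have EA : mu A = N (A `&` `]1%R, +oo[) + mu (A `&` `]-oo, 1%R]).
    by rewrite (E _ mA) /M measure_addE.
  rewrite (setIidl AD) (_ : A `&` `]-oo, 1%R] = set0) in EA; last first.
    apply/seteqP; split=> x //= -[/AD/=]; rewrite !in_itv/= andbT => x1.
    by rewrite leNgt x1.
  by rewrite measure0 adde0 in EA.
move=> _ [[a b]] _ <-; rewrite /M measure_addE.
rewrite -[X in _ = X]/(N (`]a, b]%classic `&` `]1%R, +oo[) + mu (`]a, b]%classic `&` `]-oo, 1%R])).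
have [ab|ba] := ltP a b; last first.
  by rewrite set_itv_ge ?bnd_simp -?leNgt// !set0I !measure0 adde0.
have -> : `]a, b]%classic `&` `]-oo, 1%R] = `]a, Num.min b 1%R]%classic.
  by apply/seteqP; split=> x /=; rewrite !in_itv/= le_min; [case=> /andP[-> ->] ->|
    case/and3P => -> -> ->].
have -> : `]a, b]%classic `&` `]1%R, +oo[ = `](Num.max a 1%R), b]%classic.
  by apply/seteqP; split=> x /=; rewrite !in_itv/= gt_max andbT; [case=> /andP[-> ->] ->|
    case/andP=> /andP[-> ->] ->].
set a' := Num.max a 1%R; have a'1 : (1 <= a')%R by rewrite le_max lexx orbT.
have NE : N `]a', b]%classic = if (a' < b)%R then (b - a')%:E else 0.
  case: ifPn => [a'b|]; last first.
    by rewrite -leNgt => ba'; rewrite set_itv_ge ?bnd_simp -?leNgt// measure0.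
  have b0 : (0 < b)%R by rewrite (lt_trans _ a'b)// (lt_le_trans _ a'1).
  have a'0 : (0 < a')%R by rewrite (lt_le_trans _ a'1).
  have mI : measurable (`]a', b]%classic : set R) by [].
  have mP : measurable (hyp @^-1` `]a', b]%classic).
    by rewrite -(setTI (_ @^-1` _)); exact: mhyp.
  transitivity (\int[mu \x mu]_q (\1_(hyp @^-1` `]a', b]%classic) q)%:E).
    by rewrite integral_indic// setIT.
  have : \int[mu \x mu]_(q in hyp @^-1` `]1%R, +oo[)
      (\1_(`]a', b]%classic : set R) (hyp q))%:E = (b - a')%:E.
    apply: etrans (@integral_hyp (fun x => (\1_(`]a', b]%classic : set R) x)%:E) _ _) _.
    - by apply/measurable_EFinP; exact: measurable_indic.
    - by move=> x; rewrite lee_fin.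
    (* The mass of []a', b]] is the integral of [expR] over []ln a', ln b]]. *)
    rewrite -[in RHS](lnK a'0) -[in RHS](lnK b0) -integral_expR_itv; last first.
      by rewrite ler_ln// ltW.
    rewrite integral_mkcond [RHS]integral_mkcond; apply: eq_integral => s _.
    rewrite !patchE !mem_setE !in_itv/= andbT indicE mem_setE in_itv/=.
    rewrite -(ltr_expR (ln a')) -(ler_expR s (ln b)) !lnK//.
    case: (ltP a' (expR s)) => /= [a's|a's]; last by rewrite mule0 if_same.
    have s0 : (0 < s)%R by rewrite -expR_gt1 (le_lt_trans a'1).
    by rewrite s0; case: ifP; rewrite ?mule1 ?mule0.
  move=> <-; rewrite [RHS]integral_mkcond; apply: eq_integral => q _.
  have memE (A : set R) : (q \in hyp @^-1` A) = (hyp q \in A).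
    by apply/idP/idP; rewrite !inE.
  rewrite patchE !indicE !memE !mem_setE !in_itv/= andbT.
  case: ifPn => //; rewrite -leNgt => h1.
  suff -> : (a' < hyp q)%R = false by [].
  by apply/negbTE; rewrite -leNgt (le_trans h1).
rewrite NE !lebesgue_measure_itv/= !lte_fin lt_min ab/=.
rewrite /a' gt_max ab/=.
case: (ltP a 1%R) => a1.
  case: (ltP 1%R b) => b1.
    by rewrite -!EFinB -EFinD; congr (_%:E); lra.
  by rewrite add0e.
by rewrite (le_lt_trans a1 ab) adde0.
Qed.
End exponential_substitution.

(** * Integrals depending on a parameter, monotonicity, and real-valued integrals *)

Section integration.
Context {R : realType}.
Local Notation mu := (@lebesgue_measure R).
Local Open Scope ereal_scope.

Lemma measurable_fun_comp2 d1 d2 d3 d4 (T : measurableType d1) (T1 : measurableType d2)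
    (T2 : measurableType d3) (T3 : measurableType d4) (f : T1 -> T2 -> T3)
    (g1 : T -> T1) (g2 : T -> T2) :
  measurable_fun setT (fun q : T1 * T2 => f q.1 q.2) ->
  measurable_fun setT g1 -> measurable_fun setT g2 ->
  measurable_fun setT (fun t => f (g1 t) (g2 t)).
Proof.
move=> mf m1 m2.
by apply: (measurableT_comp mf (g := fun t => (g1 t, g2 t))); exact: measurable_fun_pair.
Qed.

Lemma measurable_ge0_integral d (T : measurableType d) (f : T -> R -> \bar R) :
  measurable_fun setT (fun q : T * R => f q.1 q.2) -> (forall t x, 0 <= f t x) ->
  measurable_fun setT (fun t => \int[mu]_x f t x).
Proof.
move=> mf f0.
exact: (@measurable_fun_fubini_tonelli_F _ _ _ _ _ mu (fun q : T * R => f q.1 q.2)).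
Qed.

Lemma tonelli (f : R -> R -> \bar R) :
  measurable_fun setT (fun q : R * R => f q.1 q.2) -> (forall t x, 0 <= f t x) ->
  \int[mu]_t \int[mu]_x f t x = \int[mu]_x \int[mu]_t f t x.
Proof.
move=> mf f0.
by apply: (@fubini_tonelli _ _ _ _ _ mu mu (fun q : R * R => f q.1 q.2)).
Qed.

(** Tonelli makes the integrals of the positive and negative parts measurable in the parameter;
    [fine] of their difference stays measurable, including at parameters where the integral
    diverges. *)
Lemma measurable_Rintegral d (T : measurableType d) (f : T -> R -> R) :
  measurable_fun setT (fun q : T * R => f q.1 q.2) ->
  measurable_fun setT (fun t => \int[mu]_x f t x)%R.
Proof.
move=> mf; rewrite /Rintegral; apply: measurableT_comp => //.
under eq_fun do rewrite integralE.
apply: emeasurable_funB.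
- apply: (@measurable_ge0_integral _ _ (fun t => (EFin \o f t)^\+)) => //.
  rewrite (_ : (fun _ => _) = (fun q : T * R => (f q.1 q.2)%:E)^\+).
    by apply: measurable_funepos; exact/measurable_EFinP.
  by apply/funext => q; rewrite !funeposE.
- apply: (@measurable_ge0_integral _ _ (fun t => (EFin \o f t)^\-)) => //.
  rewrite (_ : (fun _ => _) = (fun q : T * R => (f q.1 q.2)%:E)^\-).
    by apply: measurable_funeneg; exact/measurable_EFinP.
  by apply/funext => q; rewrite !funenegE.
Qed.

(** The integral of a nonnegative function is a supremum over the simple functions below it, hence
    monotone even for non-measurable integrands. Such integrands occur in [bochner], where
    [t |-> norm1 (F t - step t)] may fail to be measurable. *)
Lemma ge0_le_integral_nomeas d (T : measurableType d)
    (m : {measure set T -> \bar R}) (D : set T) (f g : T -> \bar R) :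
  (forall x, D x -> 0 <= f x) -> (forall x, D x -> f x <= g x) ->
  \int[m]_(x in D) f x <= \int[m]_(x in D) g x.
Proof.
move=> f0 fg; have g0 x : D x -> 0 <= g x.
  by move=> Dx; exact: le_trans (f0 _ Dx) (fg _ Dx).
rewrite !ge0_integralE//; apply: le_ereal_sup => _ [h hf <-].
exists h => // x; apply: le_trans (hf x) _.
by rewrite !patchE; case: ifPn => // /set_mem; exact: fg.
Qed.

Lemma ge0_le_integralT (f g : R -> \bar R) :
  (forall x, 0 <= f x) -> (forall x, f x <= g x) ->
  \int[mu]_x f x <= \int[mu]_x g x.
Proof. by move=> f0 fg; apply: ge0_le_integral_nomeas. Qed.

Lemma abse_fine_le (x : \bar R) : (`|fine x|)%:E <= `|x|.
Proof. by case: x => [r| |] //=; rewrite ?normr0 leey. Qed.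

Lemma normr_Rintegral_le (D : set R) (f : R -> R) : measurable D -> measurable_fun D f ->
  (`|\int[mu]_(x in D) f x|%R)%:E <= \int[mu]_(x in D) (`|f x|%R)%:E.
Proof.
move=> mD mf; apply: le_trans (abse_fine_le _) _.
by apply: le_abse_integral => //; exact/measurable_EFinP.
Qed.

Lemma ge0_integral_fine (D : set R) (h : R -> \bar R) : measurable D ->
  measurable_fun D h ->
  (forall x, D x -> 0 <= h x) -> \int[mu]_(x in D) h x < +oo ->
  \int[mu]_(x in D) (fine (h x))%:E = \int[mu]_(x in D) h x.
Proof.
move=> mD mh h0 hoo.
have ih : mu.-integrable D h.
  apply/integrableP; split => //.
  suff -> : \int[mu]_(x in D) `|h x| = \int[mu]_(x in D) h x by [].
  by apply: eq_integral => x /set_mem Dx; rewrite gee0_abs// h0.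
apply: ge0_ae_eq_integral => //.
- by apply/measurable_EFinP; apply: measurableT_comp.
- by move=> x Dx; rewrite lee_fin fine_ge0// h0.
have := @integrable_ae _ _ _ mu D mD h ih; apply: filterS => x H Dx.
by rewrite fineK// H.
Qed.

Lemma integrable_ge0 (D : set R) (f : R -> R) : measurable D -> measurable_fun D f ->
  \int[mu]_(x in D) (`|f x|%R)%:E < +oo -> mu.-integrable D (EFin \o f).
Proof.
by move=> mD mf foo; apply/integrableP; split => //; exact/measurable_EFinP.
Qed.

(** Both parts of [f] scale separately. If one of their integrals is infinite, [fine] returns 0 on
    both sides, so the identity also covers the junk values of [convolution]. *)
Lemma Rintegral_scale (f : R -> R) (a : R) : (0 < a)%R -> measurable_fun [set: R] f ->
  (a * \int[mu]_x f (a * x) = \int[mu]_x f x)%R.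
Proof.
move=> a0 mf.
have mfa : measurable_fun [set: R] (fun x => f (a * x)%R).
  by apply: (measurableT_comp mf); exact: measurable_funM.
have E (g : \bar R -> \bar R) : (forall x, 0 <= g x) -> measurable_fun setT g ->
    \int[mu]_x g (f x)%:E = a%:E * \int[mu]_x g (f (a * x)%R)%:E.
  move=> g0 mg; have mgf : measurable_fun [set: R] (fun x => g (f x)%:E).
    by apply: (measurableT_comp mg); exact/measurable_EFinP.
  rewrite -(ge0_integral_scale a0 mgf)// ge0_integralZl//.
  - by apply: (measurableT_comp mg); exact/measurable_EFinP.
  - by rewrite lee_fin ltW.
rewrite /Rintegral integralE [in RHS]integralE.
have Ep : \int[mu]_x (fun x => (f x)%:E)^\+ x =
    a%:E * \int[mu]_x (fun x => (f (a * x)%R)%:E)^\+ x.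
  under eq_integral do rewrite funeposE; under [in RHS]eq_integral do rewrite funeposE.
  by apply: (E (maxe^~ 0)); [move=> x; rewrite le_max lexx orbT | exact: measurable_maxe].
have En : \int[mu]_x (fun x => (f x)%:E)^\- x =
    a%:E * \int[mu]_x (fun x => (f (a * x)%R)%:E)^\- x.
  under eq_integral do rewrite funenegE; under [in RHS]eq_integral do rewrite funenegE.
  apply: (E (fun y => maxe (- y) 0)); first by move=> x; rewrite le_max lexx orbT.
  by apply: measurable_maxe => //; exact: measurable_oppe.
rewrite Ep En.
have : 0 <= \int[mu]_x (fun x => (f (a * x)%R)%:E)^\+ x by exact: integral_ge0.
have : 0 <= \int[mu]_x (fun x => (f (a * x)%R)%:E)^\- x by exact: integral_ge0.
case: (\int[mu]_x _) => [r| |]// _; case: (\int[mu]_x _) => [s| |]// _ /=.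
- by rewrite mulrBr.
- by rewrite gt0_muley// mulr0.
- by rewrite gt0_muley// mulr0.
- by rewrite gt0_muley// mulr0.
Qed.

Lemma RintegralZl_gt0 (f : R -> R) (a : R) : (0 < a)%R -> measurable_fun [set: R] f ->
  (\int[mu]_x (a * f x) = a * \int[mu]_x f x)%R.
Proof.
move=> a0 mf; rewrite /Rintegral integralE [in RHS]integralE.
have mfE : measurable_fun [set: R] (EFin \o f) by exact/measurable_EFinP.
have Ep : \int[mu]_x (fun x => (a * f x)%:E)^\+ x = a%:E * \int[mu]_x (fun x => (f x)%:E)^\+ x.
  under eq_integral do rewrite (ge0_funeposM (EFin \o f) (ltW a0)).
  rewrite ge0_integralZl//; first exact: measurable_funepos.
  by rewrite lee_fin ltW.
have En : \int[mu]_x (fun x => (a * f x)%:E)^\- x = a%:E * \int[mu]_x (fun x => (f x)%:E)^\- x.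
  under eq_integral do rewrite (ge0_funenegM (EFin \o f) (ltW a0)).
  rewrite ge0_integralZl//; first exact: measurable_funeneg.
  by rewrite lee_fin ltW.
rewrite Ep En.
have : 0 <= \int[mu]_x (fun x => (f x)%:E)^\+ x by exact: integral_ge0.
have : 0 <= \int[mu]_x (fun x => (f x)%:E)^\- x by exact: integral_ge0.
case: (\int[mu]_x _) => [r| |]// _; case: (\int[mu]_x _) => [s| |]// _ /=.
- by rewrite mulrBr.
- by rewrite gt0_muley// mulr0.
- by rewrite gt0_muley// mulr0.
- by rewrite gt0_muley// mulr0.
Qed.

Lemma Rintegral_eq0 (f : R -> R) : (forall x, f x = 0%R) -> (\int[mu]_x f x = 0)%R.
Proof.
by move=> f0; rewrite /Rintegral integral0_eq// => x _; rewrite f0.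
Qed.

End integration.

(** * Convexity inequalities *)

Section jensen.
Context {R : realType}.
Local Notation mu := (@lebesgue_measure R).

Lemma powRD_le (a b r : R) : 0 <= a -> 0 <= b -> 0 <= r ->
  (a + b) `^ r <= 2 `^ r * (a `^ r + b `^ r).
Proof.
move=> a0 b0 r0; wlog ab : a b a0 b0 / a <= b.
  move=> H; have [ab|/ltW ba] := leP a b; first exact: H.
  by rewrite addrC (addrC (a `^ r)); exact: H.
apply: (@le_trans _ _ ((2 * b) `^ r)).
  by apply: ge0_ler_powR => //; rewrite ?nnegrE ?addr_ge0 ?mulr_ge0//; lra.
rewrite powRM// ler_wpM2l ?powR_ge0// lerDr powR_ge0//.
Qed.

(** The graph of [h ^ r] lies above its tangent at [a]: this is Young's inequality for [h] and
    [a ^ (r - 1)] with exponents [r] and [r / (r - 1)]. The case [r = 1], which has no conjugate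
    exponent, is treated apart. *)
Lemma powR_tangent_le (a h r : R) : 0 <= a -> 0 <= h -> 1 <= r ->
  r * a `^ (r - 1) * h <= h `^ r + (r - 1) * a `^ r.
Proof.
move=> a0 h0; rewrite le_eqVlt => /predU1P[<-|r1].
  by rewrite subrr powRr0 mul1r mul1r powRr1// mul0r addr0.
have r0 : 0 < r by lra.
have q0 : 0 < r / (r - 1) by rewrite divr_gt0//; lra.
have := @conjugate_powR _ h (a `^ (r - 1)) r (r / (r - 1)) h0 (powR_ge0 _ _) r0 q0.
have -> : r^-1 + (r / (r - 1))^-1 = 1 by field; rewrite !gt_eqF//; lra.
move=> /(_ erefl); rewrite -powRrM (_ : (r - 1) * (r / (r - 1)) = r); last first.
  by field; rewrite gt_eqF//; lra.
rewrite -(ler_pM2l r0) => H.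
rewrite -mulrA (mulrC _ h); apply: le_trans H _.
rewrite le_eqVlt; apply/orP; left; apply/eqP.
by field; rewrite !gt_eqF//; lra.
Qed.

Local Open Scope ereal_scope.

Lemma poweRD_le (A B : \bar R) (r : R) : 0 <= A -> 0 <= B -> (0 < r)%R ->
  (A + B) `^ r <= (2 `^ r)%:E * (A `^ r + B `^ r).
Proof.
move=> A0 B0 r0; have r2 : (0 < 2 `^ r :> R)%R by exact: powR_gt0.
have rn : r != 0%R by rewrite gt_eqF.
case: A A0 => [a| |]//=; case: B B0 => [b| |]//= b0 a0.
- by rewrite -EFinD -EFinM lee_fin powRD_le// ltW.
- by rewrite (negbTE rn) addey// gt0_muley// leey.
- by rewrite (negbTE rn) addye// gt0_muley// leey.
- by rewrite (negbTE rn) addye// gt0_muley// leey.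
Qed.

(** The tangent inequality at a free point [a] is integrated against [w], then [a] is taken to be
    the first moment divided by [W]. The mass of [w] enters only through the term
    [(r - 1) a ^ r >= 0], so an upper bound [W] suffices. *)
Lemma jensen_weighted (h w : R -> R) (W r : R) : (0 < W)%R -> (1 <= r)%R ->
  measurable_fun [set: R] h -> measurable_fun [set: R] w ->
  (forall x, 0 <= h x)%R -> (forall x, 0 <= w x)%R ->
  \int[mu]_x (w x)%:E <= W%:E ->
  (\int[mu]_x (h x * w x)%:E) `^ r <=
  (W `^ (r - 1))%:E * \int[mu]_x (h x `^ r * w x)%:E.
Proof.
move=> W0 r1 mh mw h0 w0 wW.
have r0 : (0 < r)%R by lra.
have mhr : measurable_fun [set: R] (fun x => h x `^ r)%R.
  by apply: (measurableT_comp (measurable_powR r)).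
have W10 : (0 < W `^ (r - 1))%R by exact: powR_gt0.
have I0 : 0 <= \int[mu]_x (h x `^ r * w x)%:E.
  by apply: integral_ge0 => x _; rewrite lee_fin mulr_ge0// powR_ge0.
have M0 : 0 <= \int[mu]_x (h x * w x)%:E.
  by apply: integral_ge0 => x _; rewrite lee_fin mulr_ge0.
have key (a : R) : (0 <= a)%R ->
    (r * a `^ (r - 1))%:E * \int[mu]_x (h x * w x)%:E <=
    \int[mu]_x (h x `^ r * w x)%:E + ((r - 1) * a `^ r * W)%:E.
  move=> a0; have c0 : (0 <= r * a `^ (r - 1))%R by rewrite mulr_ge0 ?powR_ge0// ltW.
  have d0 : (0 <= (r - 1) * a `^ r)%R by rewrite mulr_ge0 ?powR_ge0//; lra.
  rewrite -ge0_integralZl//; last 2 first.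
  - by apply/measurable_EFinP; exact: measurable_funM.
  - by move=> x _; rewrite lee_fin mulr_ge0.
  apply: (@le_trans _ _ (\int[mu]_x ((h x `^ r * w x)%:E + ((r - 1) * a `^ r)%:E * (w x)%:E))).
    apply: ge0_le_integralT => x.
      by rewrite -EFinM lee_fin mulr_ge0// mulr_ge0.
    rewrite -!EFinM -EFinD lee_fin mulrA -mulrDl ler_wpM2r//.
    exact: powR_tangent_le.
  rewrite ge0_integralD//; first last.
  - by apply/measurable_EFinP; apply: measurable_funM => //; exact: measurable_funM.
  - by move=> x _; rewrite -EFinM lee_fin mulr_ge0.
  - by apply/measurable_EFinP; exact: measurable_funM.
  - by move=> x _; rewrite lee_fin mulr_ge0 ?powR_ge0.
  rewrite leeD2l// ge0_integralZl//; first last.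
  - by move=> x _; rewrite lee_fin.
  - by apply/measurable_EFinP.
  by rewrite [leRHS]EFinM lee_wpmul2l.
have [I|] := ltP (\int[mu]_x (h x `^ r * w x)%:E) +oo; last first.
  by rewrite leye_eq => /eqP ->; rewrite gt0_muley// leey.
have [M|] := ltP (\int[mu]_x (h x * w x)%:E) +oo; last first.
  (* The tangent at 1 shows that an infinite first moment forces an infinite [r]-th moment. *)
  rewrite leye_eq => /eqP Moo; have := key 1%R ler01.
  by rewrite Moo powR1 mulr1 gt0_muley// leye_eq => /eqP; move: I I0;
     case: (\int[mu]_x (h x `^ r * w x)%:E).
move: M0 I0 key M I; case: (\int[mu]_x _) => [m| |]//; case: (\int[mu]_x _) => [i| |]//.
rewrite !lee_fin => m0 i0 key _ _.
have a0 : (0 <= m / W)%R by rewrite divr_ge0// ltW.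
have := key _ a0; rewrite -EFinM -EFinD lee_fin.
have -> : (r * (m / W) `^ (r - 1) * m = r * (m / W) `^ r * W)%R.
  rewrite -(@mulr_powRB1 _ (m / W) r)//; field; lra.
move=> H; have {H} : ((m / W) `^ r * W <= i)%R by lra.
rewrite powRM ?invr_ge0//; last exact: ltW.
rewrite -(@powR_inv1 _ W) -?powRrM; last exact: ltW.
move=> H; have : (W `^ (r - 1) * (m `^ r * W `^ (-1 * r) * W) <= W `^ (r - 1) * i)%R.
  by rewrite ler_wpM2l// ltW.
apply: le_trans; rewrite le_eqVlt; apply/orP; left; apply/eqP.
rewrite mulN1r powRN.
have -> : (W `^ r = W * W `^ (r - 1))%R by rewrite mulr_powRB1// ltW.
by field; rewrite !gt_eqF.
Qed.

End jensen.

(** * Convolution *)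

Section convolution.
Context {R : realType}.
Local Notation mu := (@lebesgue_measure R).
Local Open Scope ereal_scope.
Implicit Types u v : R -> R.

Definition L1norm (w : R -> R) : \bar R := \int[mu]_x (`|w x|%R)%:E.

(* The [r]-th power of the weighted norm, on the whole line. *)
Definition wnorm (r gamma : R) (w : R -> R) : \bar R :=
  \int[mu]_x (((`|x| `^ gamma * `|w x|) `^ r)%R)%:E.

Lemma L1norm_ge0 w : 0 <= L1norm w.
Proof. by apply: integral_ge0 => x _; rewrite lee_fin. Qed.

Lemma wnorm_ge0 (r gamma : R) w : 0 <= wnorm r gamma w.
Proof. by apply: integral_ge0 => x _; rewrite lee_fin powR_ge0. Qed.

Lemma measurable_reflect d (T : measurableType d) (f : R -> T) (z : R) :
  measurable_fun [set: R] f -> measurable_fun [set: R] (fun x : R => f (z - x)%R).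
Proof. by move=> mf; apply: (measurableT_comp mf); exact: measurable_funB. Qed.

Lemma measurable_wfun (r gamma : R) (w : R -> R) : measurable_fun [set: R] w ->
  measurable_fun [set: R] (fun x => (`|x| `^ gamma * `|w x|) `^ r)%R.
Proof.
move=> mw; apply: (measurableT_comp (measurable_powR r)); apply: measurable_funM.
- by apply: (measurableT_comp (measurable_powR gamma)); exact: normr_measurable.
- by apply: measurableT_comp.
Qed.

Lemma aeS (P P' : R -> Prop) : (forall x, P x -> P' x) ->
  {ae mu, forall x, P x} -> {ae mu, forall x, P' x}.
Proof. by move=> PP' [N [mN N0 PN]]; exists N; split => // x /= H; apply: PN => /PP'/H. Qed.

Lemma aeI (P P' : R -> Prop) : {ae mu, forall x, P x} -> {ae mu, forall x, P' x} ->
  {ae mu, forall x, P x /\ P' x}.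
Proof.
move=> [N [mN N0 PN]] [N' [mN' N'0 PN']]; exists (N `|` N'); split.
- exact: measurableU.
- by apply/negligibleP; [exact: measurableU|apply: negligibleU; apply/negligibleP].
- move=> x /= /not_andP[H|H]; [left; exact: PN|right; exact: PN'].
Qed.

Lemma tonelli_convolution (f g : R -> \bar R) :
  measurable_fun [set: R] f -> measurable_fun [set: R] g ->
  (forall x, 0 <= f x) -> (forall x, 0 <= g x) ->
  \int[mu]_z \int[mu]_x (f x * g (z - x)%R) = \int[mu]_x f x * \int[mu]_x g x.
Proof.
move=> mf mg f0 g0.
rewrite (tonelli (f := fun z x => f x * g (z - x)%R)); first last.
- by move=> z x; rewrite mule_ge0.
- apply: emeasurable_funM; first exact: (measurableT_comp mf).
  by apply: (measurableT_comp mg); exact: measurable_funB.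
under eq_integral => x _.
  rewrite ge0_integralZl//; last first.
    by apply: (measurableT_comp mg); exact: measurable_funB.
  rewrite ge0_integral_shift//; over.
by rewrite ge0_integralZr// integral_ge0.
Qed.

Lemma measurable_convolution2 d (T : measurableType d) (u v : T -> R -> R) :
  measurable_fun setT (fun q : T * R => u q.1 q.2) ->
  measurable_fun setT (fun q : T * R => v q.1 q.2) ->
  measurable_fun setT (fun q : T * R => convolution (u q.1) (v q.1) q.2).
Proof.
move=> mu_ mv; rewrite /convolution.
apply: (@measurable_Rintegral _ _ (T * R)%type
  (fun q x => u q.1 x * v q.1 (q.2 - x))%R).
apply: measurable_funM.
- apply: (@measurable_fun_comp2 _ _ _ _ _ _ _ _ u
    (fun q : T * R * R => q.1.1) (fun q : T * R * R => q.2)) => //.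
    by apply: measurableT_comp.
  exact: measurable_snd.
- apply: (@measurable_fun_comp2 _ _ _ _ _ _ _ _ v (fun q : T * R * R => q.1.1)
    (fun q : T * R * R => q.1.2 - q.2)%R) => //.
    by apply: measurableT_comp.
  apply: measurable_funB; last exact: measurable_snd.
  by apply: measurableT_comp; [exact: measurable_snd|exact: measurable_fst].
Qed.

Lemma measurable_convolution u v : measurable_fun [set: R] u ->
  measurable_fun [set: R] v -> measurable_fun [set: R] (convolution u v).
Proof.
move=> mu_ mv.
have H : measurable_fun setT (fun q : R * R => convolution u v q.2).
  by apply: (@measurable_convolution2 _ R (fun=> u) (fun=> v));
    apply: measurableT_comp.
exact: (measurableT_comp H (g := fun x => (x, x)) (measurable_fun_pair _ _)).
Qed.

Lemma normr_convolution_le u v z : measurable_fun [set: R] u ->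
  measurable_fun [set: R] v ->
  (`|convolution u v z|%R)%:E <= \int[mu]_x (`|u x| * `|v (z - x)|)%:E.
Proof.
move=> mu_ mv; apply: le_trans (normr_Rintegral_le _ _) _ => //.
  by apply: measurable_funM => //; exact: measurable_reflect.
by under eq_integral do rewrite normrM.
Qed.

Lemma tonelli_convolution_norm u v : measurable_fun [set: R] u ->
  measurable_fun [set: R] v ->
  \int[mu]_z \int[mu]_x (`|u x| * `|v (z - x)|)%:E = L1norm u * L1norm v.
Proof.
move=> mu_ mv.
rewrite /L1norm -(tonelli_convolution (f := fun x => (`|u x|)%:E) (g := fun x => (`|v x|)%:E))//.
- by apply/measurable_EFinP; exact: measurableT_comp.
- by apply/measurable_EFinP; exact: measurableT_comp.
Qed.

Lemma measurable_convolution_norm u v : measurable_fun [set: R] u ->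
  measurable_fun [set: R] v ->
  measurable_fun [set: R] (fun z => \int[mu]_x (`|u x| * `|v (z - x)|)%:E).
Proof.
move=> mu_ mv; apply: measurable_ge0_integral => [|t x]; last by rewrite lee_fin mulr_ge0.
apply/measurable_EFinP; apply: measurable_funM.
  by apply: measurableT_comp => //; exact: (measurableT_comp mu_).
apply: measurableT_comp => //; apply: (measurableT_comp mv).
exact: measurable_funB.
Qed.

Lemma L1norm_convolution u v : measurable_fun [set: R] u ->
  measurable_fun [set: R] v -> L1norm (convolution u v) <= L1norm u * L1norm v.
Proof.
move=> mu_ mv; rewrite -tonelli_convolution_norm//.
by apply: ge0_le_integralT => z; rewrite ?lee_fin//; exact: normr_convolution_le.
Qed.

Lemma ae_convolution_lty u v : measurable_fun [set: R] u ->
  measurable_fun [set: R] v -> L1norm u < +oo -> L1norm v < +oo ->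
  {ae mu, forall z, \int[mu]_x (`|u x| * `|v (z - x)|)%:E < +oo}.
Proof.
move=> mu_ mv uoo voo.
have I0 z : 0 <= \int[mu]_x (`|u x| * `|v (z - x)|)%:E.
  by apply: integral_ge0 => x _; rewrite lee_fin mulr_ge0.
have i : mu.-integrable setT (fun z => \int[mu]_x (`|u x| * `|v (z - x)|)%:E).
  apply/integrableP; split; first exact: measurable_convolution_norm.
  under eq_integral do rewrite gee0_abs//.
  by rewrite tonelli_convolution_norm// lte_mul_pinfty// ?L1norm_ge0// ge0_fin_numE// L1norm_ge0.
have := @integrable_ae _ _ _ mu setT measurableT _ i; apply: filterS => z H.
by have := H I; rewrite ge0_fin_numE.
Qed.

Lemma convolution_integrable u v z : measurable_fun [set: R] u ->
  measurable_fun [set: R] v -> \int[mu]_x (`|u x| * `|v (z - x)|)%:E < +oo ->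
  mu.-integrable setT (fun x => (u x * v (z - x))%:E).
Proof.
move=> mu_ mv H; apply: integrable_ge0 => //.
  by apply: measurable_funM => //; exact: measurable_reflect.
by under eq_integral do rewrite normrM.
Qed.

(** Bilinearity: [u * v - u' * v' = (u - u') * v + u' * (v - v')]. Merging the two integrals
    requires both to converge, which Tonelli gives for almost every [z]. *)
Lemma L1norm_convolutionB u v u' v' : measurable_fun [set: R] u ->
  measurable_fun [set: R] v -> measurable_fun [set: R] u' ->
  measurable_fun [set: R] v' ->
  L1norm u < +oo -> L1norm v < +oo -> L1norm u' < +oo -> L1norm v' < +oo ->
  L1norm (fun z => convolution u v z - convolution u' v' z)%R <=
  L1norm (u \- u')%R * L1norm v + L1norm u' * L1norm (v \- v')%R.
Proof.
move=> mu_ mv mu' mv' uoo voo u'oo v'oo.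
have muu : measurable_fun [set: R] (u \- u')%R by exact: measurable_funB.
have mvv : measurable_fun [set: R] (v \- v')%R by exact: measurable_funB.
have I0 (a b : R -> R) z : 0 <= \int[mu]_x (`|a x| * `|b (z - x)|)%:E.
  by apply: integral_ge0 => x _; rewrite lee_fin mulr_ge0.
rewrite -!tonelli_convolution_norm// -ge0_integralD//; last 2 first.
- exact: measurable_convolution_norm.
- exact: measurable_convolution_norm.
apply: ae_ge0_le_integral => //.
- by apply/measurable_EFinP; apply: measurableT_comp => //; apply: measurable_funB;
    exact: measurable_convolution.
- by move=> z _; rewrite adde_ge0.
- by apply: emeasurable_funD; exact: measurable_convolution_norm.
have := aeI (ae_convolution_lty mu' mv' u'oo v'oo) (ae_convolution_lty mu_ mv uoo voo).
apply: aeS => z [u'v' uv] _.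
rewrite /convolution -RintegralB//; last 2 first.
- exact: convolution_integrable.
- exact: convolution_integrable.
apply: le_trans (normr_Rintegral_le _ _) _ => //.
  by apply: measurable_funB; apply: measurable_funM => //; exact: measurable_reflect.
have mn (a b : R -> R) : measurable_fun [set: R] a -> measurable_fun [set: R] b ->
    measurable_fun [set: R] (fun x => (`|a x| * `|b (z - x)|)%:E).
  move=> ma mb; apply/measurable_EFinP; apply: measurable_funM.
    exact: measurableT_comp.
  by apply: measurableT_comp => //; exact: measurable_reflect.
rewrite -ge0_integralD//; first last.
- exact: mn.
- exact: mn.
apply: ge0_le_integralT => x; first by rewrite lee_fin.
rewrite -EFinD lee_fin -!normrM.
rewrite (_ : _ - _ = (u x - u' x) * v (z - x) + u' x * (v (z - x) - v' (z - x)))%R.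
  exact: ler_normD.
by ring.
Qed.

Lemma ge0_integral_convolution u v : measurable_fun [set: R] u ->
  measurable_fun [set: R] v -> (forall x, 0 <= u x)%R -> (forall x, 0 <= v x)%R ->
  L1norm u < +oo -> L1norm v < +oo ->
  L1norm (convolution u v) = L1norm u * L1norm v.
Proof.
move=> mu_ mv u0 v0 uoo voo; rewrite -tonelli_convolution_norm//.
rewrite -[RHS]ge0_integral_fine//.
- apply: eq_integral => z _; congr (_%:E).
  rewrite ger0_norm; last by apply: Rintegral_ge0 => x _; rewrite mulr_ge0.
  by congr fine; apply: eq_integral => x _; rewrite !ger0_norm.
- exact: measurable_convolution_norm.
- by move=> z _; apply: integral_ge0 => x _; rewrite lee_fin mulr_ge0.
- by rewrite tonelli_convolution_norm// lte_mul_pinfty// ?L1norm_ge0// ge0_fin_numE// L1norm_ge0.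
Qed.

Lemma wnorm_le (r gamma : R) u v : (0 <= r)%R -> (forall x, `|u x| <= `|v x|)%R ->
  wnorm r gamma u <= wnorm r gamma v.
Proof.
move=> r0 uv; apply: ge0_le_integralT => x; rewrite lee_fin ?powR_ge0//.
apply: ge0_ler_powR => //; rewrite ?nnegrE ?mulr_ge0 ?powR_ge0//.
by rewrite ler_wpM2l// powR_ge0.
Qed.

Lemma wnormZ (r gamma c : R) u : (0 <= c)%R -> measurable_fun [set: R] u ->
  wnorm r gamma (fun x => c * u x)%R = (c `^ r)%:E * wnorm r gamma u.
Proof.
move=> c0 mu_; rewrite /wnorm -ge0_integralZl//.
- apply: eq_integral => x _; rewrite -EFinM -powRM// ?mulr_ge0 ?powR_ge0//.
  by rewrite normrM ger0_norm// mulrCA.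
- by apply/measurable_EFinP; exact: measurable_wfun.
- by rewrite lee_fin powR_ge0.
Qed.

Lemma wnormD (r gamma : R) u v : (0 <= r)%R -> measurable_fun [set: R] u ->
  measurable_fun [set: R] v ->
  wnorm r gamma (fun x => u x + v x)%R <=
  (2 `^ r)%:E * (wnorm r gamma u + wnorm r gamma v).
Proof.
move=> r0 mu_ mv; have mU := measurable_wfun r gamma mu_; have mV := measurable_wfun r gamma mv.
have p0 (w : R -> R) x : (0 <= (`|x| `^ gamma * `|w x|) `^ r)%R by exact: powR_ge0.
rewrite /wnorm -ge0_integralD//; first last.
- by apply/measurable_EFinP.
- by apply/measurable_EFinP.
rewrite -ge0_integralZl//; first last.
- by move=> x _; rewrite adde_ge0// lee_fin.
- by apply: emeasurable_funD; apply/measurable_EFinP.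
apply: ge0_le_integralT => x; rewrite ?lee_fin//.
apply: le_trans; last first.
  by apply: powRD_le => //; rewrite mulr_ge0 ?powR_ge0.
apply: ge0_ler_powR => //; rewrite ?nnegrE ?addr_ge0 ?mulr_ge0 ?powR_ge0//.
by rewrite -mulrDr ler_wpM2l ?powR_ge0// ler_normD.
Qed.

(** From [|z|^gamma <= 2^gamma (|x|^gamma + |z - x|^gamma)], the weight is carried by [u] or by [v].
    Each of the two terms is an average against the other factor, of mass at most 1: Jensen moves
    the power [r] inside, and Tonelli integrates in [z]. *)
Lemma wnorm_convolution (r gamma : R) u v : (1 <= r)%R -> (0 <= gamma)%R ->
  measurable_fun [set: R] u -> measurable_fun [set: R] v ->
  L1norm u <= 1 -> L1norm v <= 1 ->
  wnorm r gamma (convolution u v) <=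
  ((2 `^ gamma) `^ r * 2 `^ r)%:E * (wnorm r gamma u + wnorm r gamma v).
Proof.
move=> r1 g0 mu_ mv u1 v1.
have r0 : (0 < r)%R by lra.
pose wu x := (`|x| `^ gamma * `|u x|)%R.
pose wv x := (`|x| `^ gamma * `|v x|)%R.
have wu0 x : (0 <= wu x)%R by rewrite mulr_ge0 ?powR_ge0.
have wv0 x : (0 <= wv x)%R by rewrite mulr_ge0 ?powR_ge0.
have mabs (w : R -> R) : measurable_fun [set: R] w -> measurable_fun [set: R] (fun x => `|w x|)%R.
  by move=> mw; exact: measurableT_comp.
have mw0 (w : R -> R) : measurable_fun [set: R] w ->
    measurable_fun [set: R] (fun x => `|x| `^ gamma * `|w x|)%R.
  move=> mw; apply: measurable_funM => //; last exact: mabs.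
  by apply: (measurableT_comp (measurable_powR gamma)).
have mwu : measurable_fun [set: R] wu by exact: mw0.
have mwv : measurable_fun [set: R] wv by exact: mw0.
have mpow (w : R -> R) : measurable_fun [set: R] w -> measurable_fun [set: R] (fun x => w x `^ r)%R.
  by move=> mw; exact: (measurableT_comp (measurable_powR r)).
pose A z := \int[mu]_x (wu x * `|v (z - x)|)%:E.
pose B z := \int[mu]_x (wv (z - x) * `|u x|)%:E.
pose A' z := \int[mu]_x (wu x `^ r * `|v (z - x)|)%:E.
pose B' z := \int[mu]_x (wv (z - x) `^ r * `|u x|)%:E.
have A0 z : 0 <= A z by apply: integral_ge0 => x _; rewrite lee_fin mulr_ge0.
have B0 z : 0 <= B z by apply: integral_ge0 => x _; rewrite lee_fin mulr_ge0.
have A'0 z : 0 <= A' z by apply: integral_ge0 => x _; rewrite lee_fin mulr_ge0// powR_ge0.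
have B'0 z : 0 <= B' z by apply: integral_ge0 => x _; rewrite lee_fin mulr_ge0// powR_ge0.
have J (h w : R -> R) : measurable_fun [set: R] h -> measurable_fun [set: R] w ->
    (forall x, 0 <= h x)%R -> (forall x, 0 <= w x)%R -> \int[mu]_x (w x)%:E <= 1 ->
    (\int[mu]_x (h x * w x)%:E) `^ r <= \int[mu]_x (h x `^ r * w x)%:E.
  move=> mh mw h0 w0 w1.
  by have := jensen_weighted ltr01 r1 mh mw h0 w0 w1; rewrite powR1 mul1e.
have AA' z : A z `^ r <= A' z.
  apply: J => //; first by apply: mabs; exact: measurable_reflect.
  by rewrite (ge0_integral_reflect (h := fun x => (`|v x|)%:E))//; by apply/measurable_EFinP; exact: mabs.
have BB' z : B z `^ r <= B' z.
  apply: (J (fun x => wv (z - x)%R)) => //; first exact: measurable_reflect.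
  exact: mabs.
have iA' : \int[mu]_z A' z <= wnorm r gamma u.
  have -> : \int[mu]_z A' z = wnorm r gamma u * L1norm v.
    apply: (tonelli_convolution (f := fun x => (wu x `^ r)%:E) (g := fun x => (`|v x|)%:E)) => //.
    - by apply/measurable_EFinP; exact: mpow.
    - by apply/measurable_EFinP; exact: mabs.
    - by move=> x; rewrite lee_fin powR_ge0.
  by rewrite -[leRHS]mule1 lee_wpmul2l// wnorm_ge0.
have iB' : \int[mu]_z B' z <= wnorm r gamma v.
  have -> : \int[mu]_z B' z = L1norm u * wnorm r gamma v.
    rewrite /B'; under eq_integral do under eq_integral do rewrite mulrC.
    apply: (tonelli_convolution (g := fun x => (wv x `^ r)%:E) (f := fun x => (`|u x|)%:E)) => //.
    - by apply/measurable_EFinP; exact: mabs.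
    - by apply/measurable_EFinP; exact: mpow.
    - by move=> x; rewrite lee_fin powR_ge0.
  by apply: le_trans (lee_wpmul2r (wnorm_ge0 _ _ _) u1) _; rewrite mul1e.
have mjoint (a b : R -> R) : measurable_fun [set: R] a -> measurable_fun [set: R] b ->
    measurable_fun setT (fun q : R * R => (a q.2 * b (q.1 - q.2))%:E).
  move=> ma mb; apply/measurable_EFinP; apply: measurable_funM.
    exact: (measurableT_comp ma).
  by apply: (measurableT_comp mb); exact: measurable_funB.
have mA' : measurable_fun [set: R] A'.
  have H := mjoint _ _ (mpow _ mwu) (mabs _ mv).
  suff P z x : 0 <= (wu x `^ r * `|v (z - x)|)%:E by exact: (measurable_ge0_integral H P).
  by rewrite lee_fin mulr_ge0// powR_ge0.
have mB' : measurable_fun [set: R] B'.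
  rewrite /B'; under eq_fun do under eq_integral do rewrite mulrC.
  have H := mjoint _ _ (mabs _ mu_) (mpow _ mwv).
  suff P z x : 0 <= (`|u x| * wv (z - x) `^ r)%:E by exact: (measurable_ge0_integral H P).
  by rewrite lee_fin mulr_ge0// powR_ge0.
apply: (@le_trans _ _ (((2 `^ gamma) `^ r * 2 `^ r)%:E * \int[mu]_z (A' z + B' z))); last first.
  rewrite ge0_integralD//.
  apply: lee_wpmul2l; first by rewrite lee_fin mulr_ge0 ?powR_ge0.
  exact: leeD.
rewrite -ge0_integralZl//; first last.
- by move=> z _; rewrite adde_ge0.
- exact: emeasurable_funD.
apply: ge0_le_integralT => z; first by rewrite lee_fin powR_ge0.
apply: (@le_trans _ _ (((2 `^ gamma)%:E * (A z + B z)) `^ r)); last first.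
  rewrite poweRM; [|by rewrite lee_fin powR_ge0|by rewrite adde_ge0].
  rewrite [X in _ <= X * _]EFinM -muleA.
  rewrite lee_wpmul2l ?lee_fin ?powR_ge0//.
  apply: le_trans (poweRD_le (A0 z) (B0 z) r0) _.
  by rewrite lee_wpmul2l ?lee_fin ?powR_ge0// leeD.
rewrite -poweR_EFin; apply: gt0_ler_poweR.
- exact: ltW.
- by rewrite in_itv/= leey andbT lee_fin mulr_ge0 ?powR_ge0.
- by rewrite in_itv/= leey andbT; apply: mule_ge0; [rewrite lee_fin powR_ge0|exact: adde_ge0].
rewrite EFinM.
apply: (@le_trans _ _ ((`|z| `^ gamma)%:E * \int[mu]_x (`|u x| * `|v (z - x)|)%:E)).
  by rewrite lee_wpmul2l ?lee_fin ?powR_ge0//; exact: normr_convolution_le.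
have mv' := measurable_reflect z mv; have mwv' := measurable_reflect z mwv.
have mM (a b : R -> R) : measurable_fun [set: R] a -> measurable_fun [set: R] b ->
    measurable_fun [set: R] (fun x => (a x * `|b x|)%:E).
  by move=> ma mb; apply/measurable_EFinP; apply: measurable_funM => //; exact: mabs.
have mAz := mM _ _ mwu mv'; have mBz := mM _ _ mwv' mu_.
have A0z x : 0 <= (wu x * `|v (z - x)|)%:E by rewrite lee_fin mulr_ge0.
have B0z x : 0 <= (wv (z - x) * `|u x|)%:E by rewrite lee_fin mulr_ge0.
rewrite -ge0_integralZl//; last exact: (mM _ _ (mabs _ mu_) mv').
rewrite -ge0_integralD// -ge0_integralZl//; first last.
- by move=> x _; rewrite adde_ge0.
- exact: emeasurable_funD.
apply: ge0_le_integralT => x; first by rewrite -EFinM lee_fin !mulr_ge0 ?powR_ge0.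
rewrite -EFinM -EFinD -EFinM lee_fin /wu /wv.
rewrite [leRHS](_ : _ = (2 `^ gamma * (`|x| `^ gamma + `|z - x| `^ gamma)) * (`|u x| * `|v (z - x)|))%R; last by ring.
rewrite ler_wpM2r ?mulr_ge0//.
apply: le_trans (powRD_le _ _ _) => //.
apply: ge0_ler_powR => //; rewrite ?nnegrE ?addr_ge0//.
by rewrite (_ : `|z| = `|x + (z - x)|)%R ?ler_normD//; congr (`|_|)%R; ring.
Qed.

End convolution.

(** * Convolution powers *)

Section conv_pow.
Context {R : realType}.
Local Notation mu := (@lebesgue_measure R).
Implicit Types u v : R -> R.

Lemma conv_powS u j : conv_pow u j.+2 = convolution u (conv_pow u j.+1).
Proof. by []. Qed.

Lemma measurable_conv_pow2 d (T : measurableType d) (u : T -> R -> R) j :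
  measurable_fun setT (fun q : T * R => u q.1 q.2) ->
  measurable_fun setT (fun q : T * R => conv_pow (u q.1) j.+1 q.2).
Proof.
move=> m_u; elim: j => [//|j IH]; under eq_fun do rewrite conv_powS.
exact: (@measurable_convolution2 _ _ T u (fun t => conv_pow (u t) j.+1) m_u IH).
Qed.

Lemma measurable_conv_pow u j : measurable_fun [set: R] u ->
  measurable_fun [set: R] (conv_pow u j.+1).
Proof.
move=> m_u; elim: j => [//|j IH]; rewrite conv_powS.
exact: measurable_convolution.
Qed.

Lemma conv_pow_ge0 u j z : (forall x, 0 <= u x) -> 0 <= conv_pow u j.+1 z.
Proof.
move=> u0; elim: j z => [//|j IH] z; rewrite conv_powS.
by apply: Rintegral_ge0 => x _; rewrite mulr_ge0.
Qed.

Lemma conv_pow_eq0 u j (m : R) z : 0 < m -> (forall x, x <= m -> u x = 0) ->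
  z <= m -> conv_pow u j.+1 z = 0.
Proof.
move=> m0 um; elim: j z => [|j IH] z zm; first exact: um.
rewrite conv_powS; apply: Rintegral_eq0 => x.
 have [xm|xm] := leP x m; first by rewrite um ?mul0r.
by rewrite IH ?mulr0//; lra.
Qed.

(** With supports in the positive half-line, the convolution at [z] only involves [0 < x < z], where
    both arguments [x] and [z - x] are below [z]. *)
Lemma conv_pow_local u v j (c : R) : (forall x : R, x <= 0 -> u x = 0) ->
  (forall x : R, x <= 0 -> v x = 0) -> (forall x, x < c -> u x = v x) ->
  (forall x, x <= 0 -> conv_pow u j.+1 x = 0) /\
  (forall z, z < c -> conv_pow u j.+1 z = conv_pow v j.+1 z).
Proof.
move=> u0 v0 uv.
have E0 (w : R -> R) : (forall x, x <= 0 -> w x = 0) ->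
    forall k z, z <= 0 -> conv_pow w k.+1 z = 0.
  move=> w0; elim=> [|k IH] z z0; first exact: w0.
  rewrite conv_powS; apply: Rintegral_eq0 => x.
  have [x0|x0] := leP x 0; first by rewrite w0 ?mul0r.
  by rewrite IH ?mulr0//; lra.
split; first by move=> x x0; rewrite E0.
elim: j => [|j IH] z zc; first exact: uv.
rewrite !conv_powS; apply: eq_Rintegral => x _.
have [x0|x0] := leP x 0; first by rewrite u0// v0// !mul0r.
have [zx|xz] := leP z x; first by rewrite !E0 ?mulr0//; lra.
by rewrite uv ?IH//; lra.
Qed.

Lemma conv_pow_scale u j (a z : R) : 0 < a -> measurable_fun [set: R] u ->
  conv_pow (fun x => a * u (a * x)) j.+1 z = a * conv_pow u j.+1 (a * z).
Proof.
move=> a0 m_u; elim: j z => [//|j IH] z; rewrite !conv_powS /convolution.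
have mw := measurable_conv_pow j m_u.
have mf : measurable_fun [set: R] (fun x => u x * conv_pow u j.+1 (a * z - x)).
  by apply: measurable_funM => //; exact: measurable_reflect.
have mfa : measurable_fun [set: R] (fun x => u (a * x) * conv_pow u j.+1 (a * z - a * x)).
  by apply: (measurableT_comp mf); exact: measurable_funM.
rewrite -(Rintegral_scale a0 mf) -!RintegralZl_gt0//; last exact: measurable_funM.
by apply: eq_Rintegral => x _; rewrite IH mulrBr; ring.
Qed.

Local Open Scope ereal_scope.

Lemma L1norm_conv_pow u j : measurable_fun [set: R] u -> L1norm u <= 1 ->
  L1norm (conv_pow u j.+1) <= 1.
Proof.
move=> m_u u1; elim: j => [//|j IH]; rewrite conv_powS.
apply: le_trans (L1norm_convolution m_u (measurable_conv_pow j m_u)) _.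
by rewrite -[leRHS]mule1; apply: lee_pmul => //; exact: L1norm_ge0.
Qed.

(** Telescoping: one factor is replaced at a time, and the remaining ones have norm at most 1. *)
Lemma L1norm_conv_powB u v j : measurable_fun [set: R] u ->
  measurable_fun [set: R] v -> L1norm u <= 1 -> L1norm v <= 1 ->
  L1norm (conv_pow u j.+1 \- conv_pow v j.+1)%R <= j.+1%:R%:E * L1norm (u \- v)%R.
Proof.
move=> m_u mv u1 v1; elim: j => [|j IH]; first by rewrite mul1e.
have lty (w : R -> R) : L1norm w <= 1 -> L1norm w < +oo.
  by move=> w1; apply: le_lt_trans w1 _; rewrite ltry.
rewrite !conv_powS.
have mcp (w : R -> R) : measurable_fun [set: R] w -> measurable_fun [set: R] (conv_pow w j.+1).
  exact: measurable_conv_pow.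
apply: le_trans (L1norm_convolutionB m_u (mcp _ m_u) mv (mcp _ mv) _ _ _ _) _.
- exact: lty.
- by apply: lty; exact: L1norm_conv_pow.
- exact: lty.
- by apply: lty; exact: L1norm_conv_pow.
have -> : j.+2%:R = (1 + j.+1%:R)%R :> R by rewrite mulrS.
have -> : (1 + j.+1%:R)%:E * L1norm (u \- v)%R =
    L1norm (u \- v)%R + j.+1%:R%:E * L1norm (u \- v)%R.
  by rewrite EFinD ge0_muleDl ?lee_fin// mul1e.
apply: leeD.
  rewrite -[leRHS]mule1; apply: lee_wpmul2l; first exact: L1norm_ge0.
  exact: L1norm_conv_pow.
apply: le_trans IH; rewrite -[leRHS]mul1e.
by apply: lee_wpmul2r => //; exact: L1norm_ge0.
Qed.

Lemma wnorm_conv_pow (r gamma : R) j : (1 <= r)%R -> (0 <= gamma)%R ->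
  exists2 C : R, (0 <= C)%R & forall u, measurable_fun [set: R] u ->
    L1norm u <= 1 -> wnorm r gamma (conv_pow u j.+1) <= C%:E * wnorm r gamma u.
Proof.
move=> r1 g0; elim: j => [|j [C C0 IH]].
  by exists 1%R => // u _ _; rewrite mul1e.
pose K : R := ((2 `^ gamma) `^ r * 2 `^ r)%R.
have K0 : (0 <= K)%R by rewrite mulr_ge0 ?powR_ge0.
exists (K * (1 + C))%R => [|u m_u u1].
  by rewrite mulr_ge0 ?addr_ge0.
rewrite conv_powS.
apply: le_trans (wnorm_convolution r1 g0 m_u (measurable_conv_pow j m_u) u1 _) _.
  exact: L1norm_conv_pow.
rewrite -/K [X in _ <= X * _]EFinM -muleA; apply: lee_wpmul2l; first by rewrite lee_fin.
rewrite EFinD ge0_muleDl ?lee_fin// mul1e; apply: leeD => //.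
exact: IH.
Qed.

Lemma ge0_L1norm_conv_pow u j (F : R) : measurable_fun [set: R] u ->
  (forall x, 0 <= u x)%R -> L1norm u = F%:E ->
  L1norm (conv_pow u j.+1) = (F ^+ j.+1)%:E.
Proof.
move=> m_u u0 uF; elim: j => [|j IH]; first by rewrite expr1.
rewrite conv_powS ge0_integral_convolution//.
- by rewrite uF IH [in RHS]exprS EFinM.
- exact: measurable_conv_pow.
- by move=> x; exact: conv_pow_ge0.
- by rewrite uF ltry.
- by rewrite IH ltry.
Qed.

Lemma ae_reflect (P : R -> Prop) z : {ae mu, forall x, P x} ->
  {ae mu, forall x, P (z - x)%R}.
Proof.
move=> [A [mA A0 PA]]; exists ((fun x => z - x)%R @^-1` A); split.
- rewrite -[X in measurable X]setTI.
  have : measurable_fun [set: R] (fun x : R => z - x)%R by exact: measurable_funB.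
  by apply.
- have mr : measurable ((fun x : R => z - x)%R @^-1` A).
    rewrite -[X in measurable X]setTI.
    have : measurable_fun [set: R] (fun x : R => z - x)%R by exact: measurable_funB.
    by apply.
  have e1 : \int[mu]_x (\1_((fun x : R => z - x)%R @^-1` A) x)%:E =
      mu ((fun x : R => z - x)%R @^-1` A) by rewrite integral_indic// setIT.
  have e2 : \int[mu]_x (\1_A x)%:E = mu A by rewrite integral_indic// setIT.
  rewrite -e1; apply: etrans (etrans e2 A0).
  apply: (@ge0_integral_reflect R (fun x => (\1_A x)%:E) z).
  + by apply/measurable_EFinP; exact: measurable_indic.
  + by move=> x; rewrite lee_fin.
- by move=> x /= H; exact: PA.
Qed.

(** The form needed for uniqueness, where two solutions are compared up to null sets. As soon as one
    convolution is taken, equality holds at every [z < c], because a null set of [x] does not affect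
    the integral. *)
Lemma conv_pow_local_ae u v j (c : R) : measurable_fun [set: R] u ->
  measurable_fun [set: R] v -> (forall x : R, x <= 0 -> u x = 0)%R ->
  (forall x : R, x <= 0 -> v x = 0)%R -> {ae mu, forall x, (x < c)%R -> u x = v x} ->
  {ae mu, forall z, (z < c)%R -> conv_pow u j.+1 z = conv_pow v j.+1 z}.
Proof.
move=> m_u mv u0 v0 uv; elim: j => [//|j IH]; apply: aeW => z zc.
have cu0 := (conv_pow_local (c := 0) j u0 u0 (fun _ _ => erefl)).1.
have cv0 := (conv_pow_local (c := 0) j v0 v0 (fun _ _ => erefl)).1.
rewrite !conv_powS /convolution /Rintegral; congr fine; apply: ae_eq_integral => //.
- apply/measurable_EFinP; apply: measurable_funM => //; apply: measurable_reflect.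
  exact: measurable_conv_pow.
- apply/measurable_EFinP; apply: measurable_funM => //; apply: measurable_reflect.
  exact: measurable_conv_pow.
apply: aeS (aeI uv (ae_reflect z IH)) => x [H1 H2] _; congr (_%:E).
have [x0|x0] := leP x 0%R; first by rewrite u0// v0// !mul0r.
have [zx|xz] := leP z x; first by rewrite cu0 ?cv0 ?mulr0//; lra.
by rewrite H1 ?H2//; lra.
Qed.

End conv_pow.

(** * The operator [Q] and its majorant on functions with values in [[0, +oo]] *)

Section Q_operator.
Context {R : realType}.
Local Notation mu := (@lebesgue_measure R).
Variables (N : nat) (p : nat -> R).
Hypothesis p0 : forall j, (1 <= j <= N)%N -> 0 <= p j.
Hypothesis p1 : \sum_(1 <= j < N.+1) p j = 1.
Implicit Types u v : R -> R.

Lemma QE u z : Q N p u z = \sum_(i < N) p i.+1 * conv_pow u i.+1 z.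
Proof. by rewrite /Q big_add1/= big_mkord. Qed.

Lemma pS_ge0 (i : 'I_N) : 0 <= p i.+1.
Proof. by apply: p0; rewrite ltn_ord. Qed.

Lemma sum_pS : \sum_(i < N) p i.+1 = 1.
Proof. by rewrite -p1 big_add1/= big_mkord. Qed.

Lemma measurable_Q2 d (T : measurableType d) (u : T -> R -> R) :
  measurable_fun setT (fun q : T * R => u q.1 q.2) ->
  measurable_fun setT (fun q : T * R => Q N p (u q.1) q.2).
Proof.
move=> m_u; under eq_fun do rewrite QE; apply: measurable_sum => i.
by apply: measurable_funM => //; exact: measurable_conv_pow2.
Qed.

Lemma measurable_Q u : measurable_fun [set: R] u -> measurable_fun [set: R] (Q N p u).
Proof.
move=> m_u; rewrite (_ : Q N p u = fun z => \sum_(i < N) p i.+1 * conv_pow u i.+1 z).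
  apply: measurable_sum => i; apply: measurable_funM => //.
  exact: measurable_conv_pow.
by apply/funext => z; rewrite QE.
Qed.

Lemma Q_ge0 u z : (forall x, 0 <= u x) -> 0 <= Q N p u z.
Proof.
move=> u0; rewrite QE sumr_ge0// => i _; rewrite mulr_ge0 ?pS_ge0//.
exact: conv_pow_ge0.
Qed.

Lemma Q_eq0 u (m z : R) : 0 < m -> (forall x, x <= m -> u x = 0) -> z <= m ->
  Q N p u z = 0.
Proof.
move=> m0 um zm; rewrite QE big1// => i _.
by rewrite (conv_pow_eq0 _ m0 um zm) mulr0.
Qed.

Lemma Q_local u v (c z : R) : (forall x, x <= 0 -> u x = 0) ->
  (forall x, x <= 0 -> v x = 0) -> (forall x, x < c -> u x = v x) -> z < c ->
  Q N p u z = Q N p v z.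
Proof.
move=> u0 v0 uv zc; rewrite !QE; apply: eq_bigr => i _.
by rewrite (conv_pow_local i u0 v0 uv).2.
Qed.

Lemma Q_scale u (a z : R) : 0 < a -> measurable_fun [set: R] u ->
  Q N p (fun x => a * u (a * x)) z = a * Q N p u (a * z).
Proof.
move=> a0 m_u; rewrite !QE mulr_sumr; apply: eq_bigr => i _.
by rewrite conv_pow_scale// mulrCA.
Qed.

Local Open Scope ereal_scope.

Lemma Q_local_ae u v (c : R) : measurable_fun [set: R] u ->
  measurable_fun [set: R] v -> (forall x : R, x <= 0 -> u x = 0)%R ->
  (forall x : R, x <= 0 -> v x = 0)%R -> {ae mu, forall x, (x < c)%R -> u x = v x} ->
  {ae mu, forall z, (z < c)%R -> Q N p u z = Q N p v z}.
Proof.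
move=> m_u m_v u0 v0 uv.
have : {ae mu, forall z, forall i, (z < c)%R -> conv_pow u i.+1 z = conv_pow v i.+1 z}.
  by apply/ae_foralln => i; exact: conv_pow_local_ae.
apply: aeS => z H zc; rewrite !QE; apply: eq_bigr => i _.
by rewrite H.
Qed.

Lemma L1norm_sum n (F : nat -> R -> R) : (forall i, measurable_fun [set: R] (F i)) ->
  L1norm (fun x => \sum_(i < n) F i x)%R <= \sum_(i < n) L1norm (F i).
Proof.
move=> mF; rewrite /L1norm -ge0_integral_sum//; last first.
  by move=> i; apply/measurable_EFinP; apply: (measurableT_comp (@normr_measurable R setT) (mF i)).
apply: ge0_le_integralT => x; first by rewrite lee_fin.
by rewrite sumEFin lee_fin ler_norm_sum.
Qed.

Lemma L1normZ (c : R) u : measurable_fun [set: R] u ->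
  L1norm (fun x => c * u x)%R = (`|c|%R)%:E * L1norm u.
Proof.
move=> m_u; rewrite /L1norm -ge0_integralZl//.
- by apply: eq_integral => x _; rewrite normrM EFinM.
- by apply/measurable_EFinP; apply: measurableT_comp.
Qed.

Let measurable_term u i : measurable_fun [set: R] u ->
  measurable_fun [set: R] (fun z => p i.+1 * conv_pow u i.+1 z)%R.
Proof. by move=> m_u; apply: measurable_funM => //; exact: measurable_conv_pow. Qed.

Lemma L1norm_Q u : measurable_fun [set: R] u -> L1norm u <= 1 -> L1norm (Q N p u) <= 1.
Proof.
move=> m_u u1; rewrite (_ : Q N p u = fun z => \sum_(i < N) p i.+1 * conv_pow u i.+1 z)%R; last first.
  by apply/funext => z; rewrite QE.
apply: le_trans (@L1norm_sum N (fun i z => p i.+1 * conv_pow u i.+1 z)%R _) _.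
  by move=> i; exact: measurable_term.
apply: (@le_trans _ _ (\sum_(i < N) (p i.+1)%:E)); last by rewrite sumEFin sum_pS.
apply: lee_sum => i _; rewrite L1normZ; last exact: measurable_conv_pow.
rewrite (ger0_norm (pS_ge0 i)).
rewrite -[leRHS]mule1; apply: lee_wpmul2l; first by rewrite lee_fin pS_ge0.
exact: L1norm_conv_pow.
Qed.

Lemma L1norm_QB : exists2 C : R, (0 <= C)%R & forall u v,
  measurable_fun [set: R] u -> measurable_fun [set: R] v ->
  L1norm u <= 1 -> L1norm v <= 1 ->
  L1norm (Q N p u \- Q N p v)%R <= C%:E * L1norm (u \- v)%R.
Proof.
exists (\sum_(i < N) p i.+1 * i.+1%:R)%R => [|u v m_u m_v u1 v1].
  by rewrite sumr_ge0// => i _; rewrite mulr_ge0 ?pS_ge0.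
rewrite (_ : (Q N p u \- Q N p v)%R =
  fun z => \sum_(i < N) p i.+1 * (conv_pow u i.+1 z - conv_pow v i.+1 z))%R; last first.
  by apply/funext => z /=; rewrite !QE -sumrB; apply: eq_bigr => i _; rewrite mulrBr.
have mB i : measurable_fun [set: R] (fun z => conv_pow u i.+1 z - conv_pow v i.+1 z)%R.
  by apply: measurable_funB; exact: measurable_conv_pow.
apply: le_trans (@L1norm_sum N (fun i z => p i.+1 * (conv_pow u i.+1 z - conv_pow v i.+1 z))%R _) _.
  by move=> i; exact: measurable_funM.
rewrite -sumEFin ge0_sume_distrl; last first.
  by move=> i _; rewrite lee_fin mulr_ge0 ?pS_ge0.
apply: lee_sum => i _; rewrite L1normZ ?(ger0_norm (pS_ge0 i))//.
rewrite EFinM -muleA; apply: lee_wpmul2l; first by rewrite lee_fin pS_ge0.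
exact: L1norm_conv_powB.
Qed.

Lemma wnorm_Q (r gamma : R) : (1 <= r)%R -> (0 <= gamma)%R ->
  exists2 C : R, (0 <= C)%R & forall u, measurable_fun [set: R] u ->
    L1norm u <= 1 -> wnorm r gamma (Q N p u) <= C%:E * wnorm r gamma u.
Proof.
move=> r1 g0; have r0 : (0 <= r)%R by lra.
(* Induction on the number of terms, as [wnormD] adds two functions at a time. Beyond [N] the sign
   of [p] is unknown, hence the absolute value in the constant. *)
suff [C C0 H] : exists2 C : R, (0 <= C)%R & forall u, measurable_fun [set: R] u ->
    L1norm u <= 1 -> wnorm r gamma (fun z => \sum_(i < N) p i.+1 * conv_pow u i.+1 z)%R
      <= C%:E * wnorm r gamma u.
  exists C => // u m_u u1; rewrite (_ : Q N p u = fun z => \sum_(i < N) p i.+1 * conv_pow u i.+1 z)%R.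
    exact: H.
  by apply/funext => z; rewrite QE.
elim: N => [|n [C C0 IH]].
  exists 0%R => // u _ _; rewrite mul0e /wnorm integral0_eq// => x _.
  by rewrite big_ord0 normr0 mulr0 powR0//; lra.
have [D D0 HD] := @wnorm_conv_pow R r gamma n r1 g0.
exists (2 `^ r * (C + `|p n.+1| `^ r * D))%R => [|u m_u u1].
  by rewrite mulr_ge0 ?powR_ge0 ?addr_ge0// mulr_ge0 ?powR_ge0.
rewrite (_ : (fun z => _) = fun z => (\sum_(i < n) p i.+1 * conv_pow u i.+1 z) +
   p n.+1 * conv_pow u n.+1 z)%R; last by apply/funext => z; rewrite big_ord_recr.
apply: le_trans (wnormD _ r0 _ _) _.
- by apply: measurable_sum => i; exact: measurable_term.
- exact: measurable_term.
rewrite [X in _ <= X * _]EFinM -muleA; apply: lee_wpmul2l; first by rewrite lee_fin powR_ge0.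
rewrite EFinD ge0_muleDl ?lee_fin//; last by rewrite mulr_ge0 ?powR_ge0.
apply: leeD; first exact: IH.
apply: (@le_trans _ _ (wnorm r gamma (fun x => `|p n.+1| * conv_pow u n.+1 x)%R)).
  by apply: wnorm_le => // x; rewrite !normrM normr_id.
rewrite wnormZ//; last exact: measurable_conv_pow.
rewrite EFinM -muleA; apply: lee_wpmul2l; first by rewrite lee_fin powR_ge0.
exact: HD.
Qed.

Lemma ge0_L1norm_Q u (F : R) : measurable_fun [set: R] u ->
  (forall x, 0 <= u x)%R -> L1norm u = F%:E ->
  L1norm (Q N p u) = (\sum_(i < N) p i.+1 * F ^+ i.+1)%R%:E.
Proof.
move=> m_u u0 uF; rewrite -sumEFin.
transitivity (\sum_(i < N) L1norm (fun z => p i.+1 * conv_pow u i.+1 z)%R).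
  rewrite /L1norm -ge0_integral_sum//; last first.
    by move=> i; apply/measurable_EFinP; apply: measurableT_comp => //; exact: measurable_term.
  apply: eq_integral => z _; rewrite sumEFin QE ger0_norm.
    congr (_%:E); apply: eq_bigr => i _; rewrite ger0_norm// mulr_ge0 ?pS_ge0//.
    exact: conv_pow_ge0.
  by rewrite sumr_ge0// => i _; rewrite mulr_ge0 ?pS_ge0 ?conv_pow_ge0.
apply: eq_bigr => i _; rewrite L1normZ; last exact: measurable_conv_pow.
rewrite (ger0_norm (pS_ge0 i)).
by rewrite (ge0_L1norm_conv_pow _ _ _ uF).
Qed.

(** On nonnegative functions this convolution has no junk values and is monotone, so the majorant of
    the solution can be iterated before its integrals are known to be finite. *)
Definition econv (f g : R -> \bar R) (z : R) : \bar R := \int[mu]_x (f x * g (z - x)%R).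

Definition econv_pow (g : R -> \bar R) (j : nat) := iter j.-1 (econv g) g.

Definition eQ (g : R -> \bar R) (z : R) : \bar R :=
  \sum_(i < N) (p i.+1)%:E * econv_pow g i.+1 z.

Lemma econv_powS g j : econv_pow g j.+2 = econv g (econv_pow g j.+1).
Proof. by []. Qed.

Lemma econv_pow_ge0 g j z : (forall x, 0 <= g x) -> 0 <= econv_pow g j.+1 z.
Proof.
move=> g0; elim: j z => [//|j IH] z; rewrite econv_powS.
by apply: integral_ge0 => x _; rewrite mule_ge0.
Qed.

Lemma measurable_econv_pow2 d (T : measurableType d) (g : T -> R -> \bar R) j :
  (forall t x, 0 <= g t x) -> measurable_fun setT (fun q : T * R => g q.1 q.2) ->
  measurable_fun setT (fun q : T * R => econv_pow (g q.1) j.+1 q.2).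
Proof.
move=> g0 mg; elim: j => [//|j IH]; under eq_fun do rewrite econv_powS.
have H : measurable_fun setT (fun q : T * R * R =>
    g q.1.1 q.2 * econv_pow (g q.1.1) j.+1 (q.1.2 - q.2)%R).
  apply: emeasurable_funM.
  - apply: (@measurable_fun_comp2 _ _ _ _ _ _ _ _ g
      (fun q : T * R * R => q.1.1) (fun q : T * R * R => q.2)) => //.
      by apply: measurableT_comp.
    exact: measurable_snd.
  - apply: (@measurable_fun_comp2 _ _ _ _ _ _ _ _ (fun t => econv_pow (g t) j.+1)
      (fun q : T * R * R => q.1.1) (fun q : T * R * R => q.1.2 - q.2)%R) => //.
      by apply: measurableT_comp.
    apply: measurable_funB; last exact: measurable_snd.
    by apply: measurableT_comp; [exact: measurable_snd|exact: measurable_fst].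
apply: (@measurable_ge0_integral _ _ (T * R)%type
  (fun q x => g q.1 x * econv_pow (g q.1) j.+1 (q.2 - x)%R) H).
by move=> q x; rewrite mule_ge0// econv_pow_ge0.
Qed.

Lemma measurable_econv_pow g j : (forall x, 0 <= g x) -> measurable_fun [set: R] g ->
  measurable_fun [set: R] (econv_pow g j.+1).
Proof.
move=> g0 mg.
have H : measurable_fun setT (fun q : R * R => econv_pow g j.+1 q.2).
  apply: (@measurable_econv_pow2 _ R (fun=> g)) => //.
  by apply: (measurableT_comp mg).
exact: (measurableT_comp H (g := fun x => (x, x)) (measurable_fun_pair _ _)).
Qed.

Lemma eQ_ge0 g z : (forall x, 0 <= g x) -> 0 <= eQ g z.
Proof.
move=> g0; apply: sume_ge0 => i _; rewrite mule_ge0 ?lee_fin ?pS_ge0//.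
exact: econv_pow_ge0.
Qed.

Lemma measurable_eQ2 d (T : measurableType d) (g : T -> R -> \bar R) :
  (forall t x, 0 <= g t x) -> measurable_fun setT (fun q : T * R => g q.1 q.2) ->
  measurable_fun setT (fun q : T * R => eQ (g q.1) q.2).
Proof.
move=> g0 mg; apply: emeasurable_sum => i; apply: emeasurable_funM => //.
exact: measurable_econv_pow2.
Qed.

Lemma econv_pow_le (g h : R -> \bar R) j z : (forall x, 0 <= g x) ->
  (forall x, g x <= h x) -> econv_pow g j.+1 z <= econv_pow h j.+1 z.
Proof.
move=> g0 gh; elim: j z => [//|j IH] z; rewrite !econv_powS.
apply: ge0_le_integralT => x; first by rewrite mule_ge0// econv_pow_ge0.
by apply: lee_pmul => //; exact: econv_pow_ge0.
Qed.

Lemma eQ_le (g h : R -> \bar R) z : (forall x, 0 <= g x) ->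
  (forall x, g x <= h x) -> eQ g z <= eQ h z.
Proof.
move=> g0 gh; apply: lee_sum => i _; apply: lee_wpmul2l; first by rewrite lee_fin pS_ge0.
exact: econv_pow_le.
Qed.

Lemma eQ_local (g h : R -> \bar R) (c z : R) : (forall x : R, (x <= 0)%R -> g x = 0) ->
  (forall x : R, (x <= 0)%R -> h x = 0) -> (forall x, (x < c)%R -> g x = h x) ->
  (z < c)%R -> eQ g z = eQ h z.
Proof.
move=> g0 h0 gh zc; apply: eq_bigr => i _; congr (_ * _).
have E0 (w : R -> \bar R) : (forall x : R, (x <= 0)%R -> w x = 0) ->
    forall k (y : R), (y <= 0)%R -> econv_pow w k.+1 y = 0.
  move=> w0; elim=> [|k IH] y y0; first exact: w0.
  rewrite econv_powS; apply: integral0_eq => x _.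
  have [x0|x0] := leP x 0%R; first by rewrite w0 ?mul0e.
  by rewrite IH ?mule0//; lra.
elim: (nat_of_ord i) z zc => [|j IH] z zc; first exact: gh.
rewrite !econv_powS; apply: eq_integral => x _.
have [x0|x0] := leP x 0%R; first by rewrite g0// h0// !mul0e.
have [zx|xz] := leP z x; first by rewrite !E0 ?mule0//; lra.
by rewrite gh ?IH//; lra.
Qed.

Lemma eQ_eq0 (g : R -> \bar R) (m z : R) : (0 < m)%R ->
  (forall x, (x <= m)%R -> g x = 0) -> (z <= m)%R -> eQ g z = 0.
Proof.
move=> m0 gm zm; rewrite /eQ big1// => i _.
suff -> : econv_pow g i.+1 z = 0 by rewrite mule0.
elim: (nat_of_ord i) z zm => [|j IH] z zm; first exact: gm.
rewrite econv_powS; apply: integral0_eq => x _.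
have [xm|xm] := leP x m; first by rewrite gm ?mul0e.
by rewrite IH ?mule0//; lra.
Qed.

Lemma integral_eQ_le1 g : (forall x, 0 <= g x) -> measurable_fun [set: R] g ->
  \int[mu]_x g x <= 1 -> \int[mu]_z eQ g z <= 1.
Proof.
move=> g0 mg g1.
rewrite ge0_integral_sum//; first last.
- by move=> i x _; rewrite mule_ge0 ?lee_fin ?pS_ge0// econv_pow_ge0.
- by move=> i; apply: emeasurable_funM => //; exact: measurable_econv_pow.
apply: (@le_trans _ _ (\sum_(i < N) (p i.+1)%:E)); last by rewrite sumEFin sum_pS.
apply: lee_sum => i _; rewrite ge0_integralZl//; first last.
- by rewrite lee_fin pS_ge0.
- by move=> x _; exact: econv_pow_ge0.
- exact: measurable_econv_pow.
rewrite -[leRHS]mule1; apply: lee_wpmul2l; first by rewrite lee_fin pS_ge0.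
elim: (nat_of_ord i) => [//|j IH].
rewrite econv_powS /econv tonelli_convolution//.
- by rewrite -[leRHS]mule1; apply: lee_pmul => //; apply: integral_ge0 => x _ //; exact: econv_pow_ge0.
- exact: measurable_econv_pow.
- by move=> x; exact: econv_pow_ge0.
Qed.

Lemma normr_Q_le u (g : R -> \bar R) z : measurable_fun [set: R] u ->
  (forall x, (`|u x|%R)%:E <= g x) -> (`|Q N p u z|%R)%:E <= eQ g z.
Proof.
move=> m_u ug; rewrite QE.
apply: (@le_trans _ _ (\sum_(i < N) (`|p i.+1 * conv_pow u i.+1 z|%R)%:E)).
  by rewrite sumEFin lee_fin ler_norm_sum.
apply: lee_sum => i _; rewrite normrM ger0_norm ?pS_ge0// EFinM.
apply: lee_wpmul2l; first by rewrite lee_fin pS_ge0.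
elim: (nat_of_ord i) z => [|j IH] z; first exact: ug.
rewrite econv_powS conv_powS.
apply: le_trans (normr_convolution_le _ m_u (measurable_conv_pow j m_u)) _.
apply: ge0_le_integralT => x; first by rewrite lee_fin mulr_ge0.
by rewrite EFinM; apply: lee_pmul.
Qed.

End Q_operator.

(** * Construction of the solution *)

Section causal_fixpoint.
Context {R : realType}.
Variables (X : Type) (z0 : X) (Psi : (R -> R -> X) -> R -> R -> X).
Hypothesis Psi0 : forall u tau x, x < 1 -> Psi u tau x = z0.
Hypothesis Psi_causal : forall u v (c : R) tau x,
  (forall s y, y < c -> u s y = v s y) -> x < c + 1 -> Psi u tau x = Psi v tau x.

Definition picard n := iter n Psi (fun _ _ => z0).

(* The value at [x] of the Picard iterates is stationary after about [x] steps. *)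
Definition causal_fix (tau x : R) : X := picard (Num.truncn x).+1 tau x.

(** All values of [Psi] vanish to [z0] below 1, and each application of [Psi] pushes the range of
    agreement up by one unit. *)
Lemma picardS n tau x : x < n%:R + 1 -> picard n.+1 tau x = picard n tau x.
Proof.
elim: n tau x => [|n IH] tau x xn.
  by rewrite /picard/= Psi0//; move: xn; rewrite add0r.
apply: (@Psi_causal _ _ (n%:R + 1)) => [s y|]; first exact: IH.
by move: xn; rewrite -natr1.
Qed.

Lemma picard_stationary n m tau x : (n <= m)%N -> x < n%:R + 1 ->
  picard m tau x = picard n tau x.
Proof.
move=> /subnK <-; elim: (m - n)%N => [//|k IH] xn.
rewrite addSn picardS ?IH//; apply: lt_le_trans xn _.
by rewrite lerD2r ler_nat leq_addl.
Qed.

Lemma causal_fix_picard n tau x : x < n%:R + 1 -> causal_fix tau x = picard n tau x.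
Proof.
move=> xn; rewrite /causal_fix; set t := Num.truncn x.
have xt : x < t%:R + 1 by rewrite natr1; exact: truncnS_gt.
rewrite picardS//.
by case: (leqP n t) => [nt|/ltnW tn]; [|symmetry]; exact: picard_stationary.
Qed.

Lemma causal_fixE tau x : Psi causal_fix tau x = causal_fix tau x.
Proof.
set t := Num.truncn x.
have xt : x < t%:R + 1 by rewrite natr1; exact: truncnS_gt.
apply: (@Psi_causal _ _ t%:R) => // s y yt.
by apply: causal_fix_picard; lra.
Qed.

Lemma causal_fix_cvg tau x : \forall n \near \oo, picard n tau x = causal_fix tau x.
Proof.
exists (Num.truncn x).+1 => // n /= tn; rewrite (causal_fix_picard (n := n))//.
apply: lt_trans (truncnS_gt x) _.
by rewrite natr1 ltr_nat ltnS.
Qed.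

End causal_fixpoint.

Section construction.
Context {R : realType}.
Local Notation mu := (@lebesgue_measure R).
Variables (N : nat) (p : nat -> R) (f0 : R -> R).
Hypothesis p0 : forall j, (1 <= j <= N)%N -> 0 <= p j.
Hypothesis mf0 : measurable_fun [set: R] f0.
Hypothesis f00 : forall x, x <= 1 -> f0 x = 0.

Definition cutoff (m : R) (u : R -> R) (x : R) : R := if m < x then u x else 0.

Definition source (u : R -> R -> R) (s x : R) : R :=
  expR s * u s (expR s) * Q N p (cutoff (expR s) (u s)) (x - expR s).

(* In the variable [x = e^tau y] the operator [S_tau] becomes the identity. *)
Definition duhamel (u : R -> R -> R) (tau x : R) : R :=
  f0 x + \int[mu]_s (if 0 <= s <= tau then source u s x else 0).

Definition profile := causal_fix 0 duhamel.

Local Open Scope ereal_scope.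

Definition ecutoff (m : R) (g : R -> \bar R) (x : R) : \bar R :=
  if (m < x)%R then g x else 0.

Definition esource (g : R -> R -> \bar R) (s x : R) : \bar R :=
  (expR s)%:E * g s (expR s) * eQ N p (ecutoff (expR s) (g s)) (x - expR s)%R.

Definition eduhamel (g : R -> R -> \bar R) (tau x : R) : \bar R :=
  (`|f0 x|%R)%:E + \int[mu]_s (if (0 <= s <= tau)%R then esource g s x else 0).

Definition envelope := causal_fix 0 eduhamel.

Lemma cutoff_eq0 (m x : R) (u : R -> R) : (x <= m)%R -> cutoff m u x = 0%R.
Proof. by move=> xm; rewrite /cutoff ltNge xm. Qed.

Lemma ecutoff_eq0 (m x : R) (g : R -> \bar R) : (x <= m)%R -> ecutoff m g x = 0.
Proof. by move=> xm; rewrite /ecutoff ltNge xm. Qed.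

Lemma ecutoff_ge0 (m x : R) (g : R -> \bar R) : (forall x, 0 <= g x) -> 0 <= ecutoff m g x.
Proof. by move=> g0; rewrite /ecutoff; case: ifP. Qed.

(** [Q] keeps the support in []e^s, +oo[] and the translation by [e^s] moves it to []2 e^s, +oo[].
    Both the causality and the freezing of the solution come from this. *)
Lemma source_eq0 u (s x : R) : (x <= 2 * expR s)%R -> source u s x = 0%R.
Proof.
move=> xs; rewrite /source (@Q_eq0 _ _ _ _ (expR s)) ?mulr0 ?expR_gt0//; last lra.
by move=> y; exact: cutoff_eq0.
Qed.

Lemma esource_eq0 g (s x : R) : (x <= 2 * expR s)%R -> esource g s x = 0.
Proof.
move=> xs; rewrite /esource (@eQ_eq0 _ _ _ _ (expR s)) ?mule0 ?expR_gt0//; last lra.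
by move=> y; exact: ecutoff_eq0.
Qed.

(** For [s >= 0] the shift [e^s] is at least 1. If [e^s < c], the trace is read below [c] and [Q] at
    [x - e^s < c] sees only arguments below [c]; if [e^s >= c], then [x < c + 1 <= 2 e^s] and the
    source vanishes. *)
Lemma source_local u v (c s x : R) : (forall s y, (y < c)%R -> u s y = v s y) ->
  (0 <= s)%R -> (x < c + 1)%R -> source u s x = source v s x.
Proof.
move=> uv s0 xc; have e1 : (1 <= expR s)%R by rewrite -expR0 ler_expR.
have [sc|cs] := ltP (expR s) c; last by rewrite !source_eq0//; lra.
rewrite /source uv//; congr (_ * _)%R; apply: (@Q_local _ _ _ _ _ c).
- by move=> y y0; apply: cutoff_eq0; lra.
- by move=> y y0; apply: cutoff_eq0; lra.
- by move=> y yc; rewrite /cutoff uv.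
- lra.
Qed.

Lemma esource_local u v (c s x : R) : (forall s y, (y < c)%R -> u s y = v s y) ->
  (0 <= s)%R -> (x < c + 1)%R -> esource u s x = esource v s x.
Proof.
move=> uv s0 xc; have e1 : (1 <= expR s)%R by rewrite -expR0 ler_expR.
have [sc|cs] := ltP (expR s) c; last by rewrite !esource_eq0//; lra.
rewrite /esource uv//.
apply: (f_equal (fun y => (expR s)%:E * v s (expR s) * y)); apply: (@eQ_local _ _ _ _ _ c).
- by move=> y y0; apply: ecutoff_eq0; lra.
- by move=> y y0; apply: ecutoff_eq0; lra.
- by move=> y yc; rewrite /ecutoff uv.
- lra.
Qed.

Lemma duhamel0 u (tau x : R) : (x <= 1)%R -> duhamel u tau x = 0%R.
Proof.
move=> x1; rewrite /duhamel f00// add0r; apply: Rintegral_eq0 => s.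
case: ifPn => // /andP[s0 _]; apply: source_eq0.
have : (1 <= expR s)%R by rewrite -expR0 ler_expR.
by move=> H; lra.
Qed.

Lemma eduhamel0 u (tau x : R) : (x <= 1)%R -> eduhamel u tau x = 0.
Proof.
move=> x1; rewrite /eduhamel f00// normr0 add0e; apply: integral0_eq => s _.
case: ifPn => // /andP[s0 _]; apply: esource_eq0.
have : (1 <= expR s)%R by rewrite -expR0 ler_expR.
by move=> H; lra.
Qed.

Lemma duhamel_causal u v (c tau x : R) : (forall s y, (y < c)%R -> u s y = v s y) ->
  (x < c + 1)%R -> duhamel u tau x = duhamel v tau x.
Proof.
move=> uv xc; apply: (f_equal (fun y => f0 x + y)%R); apply: eq_Rintegral => s _.
by case: ifPn => // /andP[s0 _]; exact: source_local xc.
Qed.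

Lemma eduhamel_causal u v (c tau x : R) : (forall s y, (y < c)%R -> u s y = v s y) ->
  (x < c + 1)%R -> eduhamel u tau x = eduhamel v tau x.
Proof.
move=> uv xc; rewrite /eduhamel; congr (_ + _); apply: eq_integral => s _.
by case: ifPn => // /andP[s0 _]; exact: esource_local xc.
Qed.

Let duhamel0' u (tau x : R) : (x < 1)%R -> duhamel u tau x = 0%R.
Proof. by move=> /ltW; exact: duhamel0. Qed.

Let eduhamel0' u (tau x : R) : (x < 1)%R -> eduhamel u tau x = 0.
Proof. by move=> /ltW; exact: eduhamel0. Qed.

Lemma profileE (tau x : R) : profile tau x = duhamel profile tau x.
Proof. by rewrite (causal_fixE duhamel0' duhamel_causal). Qed.

Lemma envelopeE (tau x : R) : envelope tau x = eduhamel envelope tau x.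
Proof. by rewrite (causal_fixE eduhamel0' eduhamel_causal). Qed.

Lemma profile_eq0 (tau x : R) : (x <= 1)%R -> profile tau x = 0%R.
Proof. by move=> x1; rewrite profileE duhamel0. Qed.

(** Sources emitted after [tau] live beyond [2 e^tau], so the value at [x <= 2 e^tau] no longer
    changes. For [x = e^s] this leaves a window of length [log 2] before [s], which is the window of
    the trace relation. *)
Lemma duhamel_time u (tau tau' x : R) : (0 <= tau)%R -> (tau <= tau')%R ->
  (x <= 2 * expR tau)%R -> duhamel u tau' x = duhamel u tau x.
Proof.
move=> t0 tt xt; rewrite /duhamel; congr (_ + _)%R; apply: eq_Rintegral => s _.
have [s0|] //= := leP 0%R s; have [st|ts] := leP s tau.
  by rewrite (le_trans st tt).
case: ifP => // _; apply: source_eq0; apply: le_trans xt _.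
by rewrite ler_pM2l// ler_expR ltW.
Qed.

Lemma eduhamel_time u (tau tau' x : R) : (0 <= tau)%R -> (tau <= tau')%R ->
  (x <= 2 * expR tau)%R -> eduhamel u tau' x = eduhamel u tau x.
Proof.
move=> t0 tt xt; rewrite /eduhamel; congr (_ + _); apply: eq_integral => s _.
have [s0|] //= := leP 0%R s; have [st|ts] := leP s tau.
  by rewrite (le_trans st tt).
case: ifP => // _; apply: esource_eq0; apply: le_trans xt _.
by rewrite ler_pM2l// ler_expR ltW.
Qed.

Lemma measurable_cutoff2 d (T : measurableType d) (u : T -> R -> R) (m : T -> R) :
  measurable_fun setT (fun q : T * R => u q.1 q.2) -> measurable_fun setT m ->
  measurable_fun setT (fun q : T * R => cutoff (m q.1) (u q.1) q.2).
Proof.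
move=> m_u mm; apply: measurable_fun_ifT => //.
apply: measurable_fun_ltr; last exact: measurable_snd.
by apply: (measurableT_comp mm).
Qed.

Lemma measurable_ecutoff2 d (T : measurableType d) (u : T -> R -> \bar R) (m : T -> R) :
  measurable_fun setT (fun q : T * R => u q.1 q.2) -> measurable_fun setT m ->
  measurable_fun setT (fun q : T * R => ecutoff (m q.1) (u q.1) q.2).
Proof.
move=> m_u mm; apply: measurable_fun_ifT => //.
apply: measurable_fun_ltr; last exact: measurable_snd.
by apply: (measurableT_comp mm).
Qed.

Lemma measurable_source2 u : measurable_fun setT (fun q : R * R => u q.1 q.2) ->
  measurable_fun setT (fun q : R * R => source u q.1 q.2).
Proof.
move=> m_u.
have me : measurable_fun setT (fun q : R * R => expR q.1).
  by apply: (measurableT_comp (@measurable_expR R)); exact: measurable_fst.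
apply: measurable_funM; first apply: measurable_funM => //.
- apply: (@measurable_fun_comp2 _ _ _ _ _ _ _ _ u (fun q : R * R => q.1)) => //;
    exact: measurable_fst.
- apply: (@measurable_fun_comp2 _ _ _ _ _ _ _ _
    (fun s => Q N p (cutoff (expR s) (u s))) (fun q : R * R => q.1)
    (fun q : R * R => q.2 - expR q.1)%R).
  + have H := measurable_cutoff2 m_u (@measurable_expR R).
    exact: (@measurable_Q2 R N p _ _ (fun s => cutoff (expR s) (u s)) H).
  + exact: measurable_fst.
  + by apply: measurable_funB => //; exact: measurable_snd.
Qed.

Lemma measurable_esource2 u : (forall s x, 0 <= u s x) ->
  measurable_fun setT (fun q : R * R => u q.1 q.2) ->
  measurable_fun setT (fun q : R * R => esource u q.1 q.2).
Proof.
move=> u0 m_u.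
have me : measurable_fun setT (fun q : R * R => expR q.1).
  by apply: (measurableT_comp (@measurable_expR R)); exact: measurable_fst.
apply: emeasurable_funM; first apply: emeasurable_funM => //.
- by apply/measurable_EFinP.
- apply: (@measurable_fun_comp2 _ _ _ _ _ _ _ _ u (fun q : R * R => q.1)) => //;
    exact: measurable_fst.
- apply: (@measurable_fun_comp2 _ _ _ _ _ _ _ _
    (fun s => eQ N p (ecutoff (expR s) (u s))) (fun q : R * R => q.1)
    (fun q : R * R => q.2 - expR q.1)%R).
  + have H := measurable_ecutoff2 m_u (@measurable_expR R).
    have E s x : 0 <= ecutoff (expR s) (u s) x by exact: ecutoff_ge0.
    exact: (@measurable_eQ2 R N p _ _ (fun s => ecutoff (expR s) (u s)) E H).
  + exact: measurable_fst.
  + by apply: measurable_funB => //; exact: measurable_snd.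
Qed.

Let measurable_timecond :
  measurable_fun setT (fun q : R * R * R => (0 <= q.2 <= q.1.1)%R).
Proof.
apply: measurable_and.
  by apply: measurable_fun_ler => //; exact: measurable_snd.
apply: measurable_fun_ler; first exact: measurable_snd.
by apply: measurableT_comp; exact: measurable_fst.
Qed.

Lemma measurable_duhamel2 u : measurable_fun setT (fun q : R * R => u q.1 q.2) ->
  measurable_fun setT (fun q : R * R => duhamel u q.1 q.2).
Proof.
move=> m_u; apply: measurable_funD.
  by apply: (measurableT_comp mf0); exact: measurable_snd.
apply: (@measurable_Rintegral _ _ (R * R)%type
  (fun q s => if (0 <= s <= q.1)%R then source u s q.2 else 0%R)).
apply: measurable_fun_ifT => //.
apply: (@measurable_fun_comp2 _ _ _ _ _ _ _ _ (source u) (fun q : R * R * R => q.2)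
  (fun q : R * R * R => q.1.2)); first exact: measurable_source2.
- exact: measurable_snd.
- by apply: measurableT_comp; [exact: measurable_snd|exact: measurable_fst].
Qed.

Lemma esource_ge0 u (s x : R) : (forall s x, 0 <= u s x) -> 0 <= esource u s x.
Proof.
move=> u0; rewrite /esource mule_ge0 ?mule_ge0 ?lee_fin ?expR_ge0//.
by apply: (eQ_ge0 p0) => y; exact: ecutoff_ge0.
Qed.

Lemma eduhamel_ge0 u (tau x : R) : (forall s x, 0 <= u s x) -> 0 <= eduhamel u tau x.
Proof.
move=> u0; rewrite adde_ge0//; apply: integral_ge0 => s _.
by case: ifP => // _; exact: esource_ge0.
Qed.

Lemma measurable_eduhamel2 u : (forall s x, 0 <= u s x) ->
  measurable_fun setT (fun q : R * R => u q.1 q.2) ->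
  measurable_fun setT (fun q : R * R => eduhamel u q.1 q.2).
Proof.
move=> u0 m_u; apply: emeasurable_funD.
  apply/measurable_EFinP; apply: (measurableT_comp (@normr_measurable R setT)).
  by apply: (measurableT_comp mf0); exact: measurable_snd.
have H : measurable_fun setT (fun q : R * R * R =>
    if (0 <= q.2 <= q.1.1)%R then esource u q.2 q.1.2 else 0).
  apply: measurable_fun_ifT => //.
  apply: (@measurable_fun_comp2 _ _ _ _ _ _ _ _ (esource u) (fun q : R * R * R => q.2)
    (fun q : R * R * R => q.1.2)); first exact: measurable_esource2.
  - exact: measurable_snd.
  - by apply: measurableT_comp; [exact: measurable_snd|exact: measurable_fst].
apply: (@measurable_ge0_integral _ _ (R * R)%type
  (fun q s => if (0 <= s <= q.1)%R then esource u s q.2 else 0) H).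
by move=> q s; case: ifP => // _; exact: esource_ge0.
Qed.

Notation f_ := (picard 0%R duhamel).
Notation g_ := (picard 0 eduhamel).

Lemma epicard_ge0 n (tau x : R) : 0 <= g_ n tau x.
Proof. by elim: n tau x => [//|n IH] tau x; exact: eduhamel_ge0. Qed.

Lemma measurable_picard2 n : measurable_fun setT (fun q : R * R => f_ n q.1 q.2).
Proof. by elim: n => [|n IH]; [exact: measurable_cst|exact: measurable_duhamel2]. Qed.

Lemma measurable_epicard2 n : measurable_fun setT (fun q : R * R => g_ n q.1 q.2).
Proof.
elim: n => [|n IH]; first exact: measurable_cst.
by apply: measurable_eduhamel2 => // s x; exact: epicard_ge0.
Qed.

(** Joint measurability passes to the fixed point because the iterates are eventually constant,
    hence convergent, at each point. *)
Lemma measurable_profile2 : measurable_fun setT (fun q : R * R => profile q.1 q.2).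
Proof.
apply/measurable_EFinP.
apply: (emeasurable_fun_cvg (fun n => fun q : R * R => (f_ n q.1 q.2)%:E)) => //.
  by move=> n; apply/measurable_EFinP; exact: measurable_picard2.
move=> [tau x] _ /=; apply: cvg_near_cst.
by apply: filterS (causal_fix_cvg duhamel0' duhamel_causal tau x) => n ->.
Qed.

Lemma measurable_envelope2 : measurable_fun setT (fun q : R * R => envelope q.1 q.2).
Proof.
apply: (emeasurable_fun_cvg (fun n => fun q : R * R => g_ n q.1 q.2)) => //.
  by move=> n; exact: measurable_epicard2.
move=> [tau x] _ /=.
apply: cvg_near_cst.
exact: (causal_fix_cvg eduhamel0' eduhamel_causal tau x).
Qed.

Lemma esource_le u v (s x : R) : (forall s x, 0 <= u s x) ->
  (forall s x, u s x <= v s x) -> esource u s x <= esource v s x.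
Proof.
move=> u0 uv; apply: lee_pmul.
- by rewrite mule_ge0 ?lee_fin ?expR_ge0.
- by apply: (eQ_ge0 p0) => y; exact: ecutoff_ge0.
- by apply: lee_wpmul2l => //; rewrite lee_fin expR_ge0.
- apply: (eQ_le p0); first by move=> y; exact: ecutoff_ge0.
  by move=> y; rewrite /ecutoff; case: ifP.
Qed.

Lemma eduhamel_le u v (tau x : R) : (forall s x, 0 <= u s x) ->
  (forall s x, u s x <= v s x) -> eduhamel u tau x <= eduhamel v tau x.
Proof.
move=> u0 uv; apply: leeD => //; apply: ge0_le_integralT => s.
  by case: ifP => // _; exact: esource_ge0.
by case: ifP => // _; exact: esource_le.
Qed.

Lemma eduhamel_le_time u (tau tau' x : R) : (forall s x, 0 <= u s x) ->
  (tau <= tau')%R -> eduhamel u tau x <= eduhamel u tau' x.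
Proof.
move=> u0 tt; apply: leeD => //; apply: ge0_le_integralT => s.
  by case: ifP => // _; exact: esource_ge0.
have [s0|] //= := leP 0%R s; case: (leP s tau) => // st.
  by rewrite (le_trans st tt).
by case: ifP => // _; exact: esource_ge0.
Qed.

Lemma epicard_le n (tau x : R) : g_ n tau x <= g_ n.+1 tau x.
Proof.
elim: n tau x => [|n IH] tau x; first exact: epicard_ge0.
by apply: eduhamel_le => // s y; exact: epicard_ge0.
Qed.

Lemma envelope_ge0 (tau x : R) : 0 <= envelope tau x.
Proof. exact: epicard_ge0. Qed.

Lemma source_le (u : R -> R -> R) (g : R -> R -> \bar R) (s x : R) : measurable_fun setT (fun q : R * R => u q.1 q.2) ->
  (forall s x, (`|u s x|%R)%:E <= g s x) -> (`|source u s x|%R)%:E <= esource g s x.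
Proof.
move=> m_u ug; rewrite /source !normrM EFinM; apply: lee_pmul => //.
- rewrite EFinM; apply: lee_pmul => //.
  by rewrite lee_fin ger0_norm// expR_ge0.
- apply: (normr_Q_le p0).
    have H := measurable_cutoff2 m_u (@measurable_expR R).
    exact: (measurableT_comp H (g := fun x => (s, x)) (measurable_fun_pair _ _)).
  by move=> y; rewrite /cutoff /ecutoff; case: ifP => // _; rewrite normr0.
Qed.

Lemma measurable_section2 (T : R -> R -> R) (s : R) :
  measurable_fun setT (fun q : R * R => T q.1 q.2) -> measurable_fun [set: R] (T s).
Proof.
by move=> mT; exact: (measurableT_comp mT (g := fun x => (s, x)) (measurable_fun_pair _ _)).
Qed.

Lemma measurable_section1 (T : R -> R -> R) (x : R) :
  measurable_fun setT (fun q : R * R => T q.1 q.2) -> measurable_fun [set: R] (T^~ x).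
Proof.
by move=> mT; exact: (measurableT_comp mT (g := fun s => (s, x)) (measurable_fun_pair _ _)).
Qed.

Lemma measurable_timeslice (T : R -> R -> R) (tau x : R) :
  measurable_fun setT (fun q : R * R => T q.1 q.2) ->
  measurable_fun [set: R] (fun s => if (0 <= s <= tau)%R then T s x else 0%R).
Proof.
move=> mT; apply: measurable_fun_ifT => //; last exact: measurable_section1.
by apply: measurable_and; exact: measurable_fun_ler.
Qed.

Lemma normr_picard_le n (tau x : R) : (`|f_ n tau x|%R)%:E <= g_ n tau x.
Proof.
elim: n tau x => [|n IH] tau x; first by rewrite normr0.
apply: (@le_trans _ _ (`|f0 x| + `|\int[mu]_s (if 0 <= s <= tau then source (f_ n) s x else 0)|)%R%:E).
  by rewrite lee_fin ler_normD.
rewrite EFinD; apply: leeD => //.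
apply: le_trans (normr_Rintegral_le _ _) _ => //.
  by apply: measurable_timeslice; apply: measurable_source2; exact: measurable_picard2.
apply: ge0_le_integralT => s; first by rewrite lee_fin.
case: ifP => _; last by rewrite normr0.
by apply: source_le => //; exact: measurable_picard2.
Qed.

(** At a given [x] both fixed points are read off the iterate of the same index, so no limit is
    taken. *)
Lemma normr_profile_le (tau x : R) : (`|profile tau x|%R)%:E <= envelope tau x.
Proof. exact: normr_picard_le. Qed.

End construction.

(** * Mass bounds *)

Section mass.
Context {R : realType}.
Local Notation mu := (@lebesgue_measure R).
Variables (N : nat) (p : nat -> R) (f0 : R -> R).
Hypothesis p0 : forall j, (1 <= j <= N)%N -> 0 <= p j.
Hypothesis p1 : \sum_(1 <= j < N.+1) p j = 1.
Hypothesis mf0 : measurable_fun [set: R] f0.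
Hypothesis f00 : forall x, x <= 1 -> f0 x = 0.
Hypothesis f01 : (L1norm f0 <= 1)%E.
Local Notation f := (profile N p f0).
Local Notation g := (envelope N p f0).
Local Notation g_ := (picard 0%E (eduhamel N p f0)).
Local Open Scope ereal_scope.

Lemma ge0_integral_stationary_le (h_ : nat -> R -> \bar R) (h : R -> \bar R) (M : \bar R) :
  (forall n, measurable_fun [set: R] (h_ n)) -> (forall n x, 0 <= h_ n x) ->
  (forall n x, h_ n x <= h_ n.+1 x) ->
  (forall x, \forall n \near \oo, h_ n x = h x) ->
  (forall n, \int[mu]_x h_ n x <= M) -> \int[mu]_x h x <= M.
Proof.
move=> mh h0 hh hh' hM.
have nd x : nondecreasing_seq (h_ ^~ x).
  by apply/nondecreasing_seqP => n; exact: hh.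
have E x : limn (h_ ^~ x) = h x by apply/cvg_lim => //; exact: cvg_near_cst.
under eq_integral do rewrite -E.
rewrite monotone_convergence//.
apply: lime_le; last exact: nearW.
apply: ereal_nondecreasing_is_cvgn; apply/nondecreasing_seqP => n.
exact: ge0_le_integralT.
Qed.

Lemma integral_expR_window (h : R -> \bar R) (S T : R) : measurable_fun [set: R] h ->
  (forall x, 0 <= h x) -> (0 <= S)%R ->
  \int[mu]_s (if (S < s <= T)%R then (expR s)%:E * h (expR s) else 0) =
  \int[mu]_x (if (expR S < x <= expR T)%R then h x else 0).
Proof.
move=> mh h0 S0; pose h' x := if (expR S < x <= expR T)%R then h x else 0.
have mh' : measurable_fun [set: R] h'.
  apply: measurable_fun_ifT => //; apply: measurable_and.
    exact: measurable_fun_ltr.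
  exact: measurable_fun_ler.
have h'0 x : 0 <= h' x by rewrite /h'; case: ifP.
have := ge0_integral_expR mh' h'0.
rewrite integral_mkcond [in X in _ = X]integral_mkcond => H.
transitivity (\int[mu]_x ((fun s => (expR s)%:E * h' (expR s)) \_ `]0%R, +oo[) x).
  apply: eq_integral => s _; rewrite patchE mem_setE in_itv/= andbT /h'.
  rewrite ltr_expR ler_expR; case: ifPn => [/andP[Ss sT]|].
    by rewrite (le_lt_trans S0 Ss).
  by rewrite mule0 if_same.
rewrite H; apply: eq_integral => x _; rewrite patchE mem_setE in_itv/= andbT /h'.
case: ifPn => // x1; case: ifPn => // /andP[Sx _].
by move: x1; rewrite (le_lt_trans _ Sx)// -expR0 ler_expR.
Qed.

Lemma integral_window_open (k : R -> \bar R) (T : R) : measurable_fun [set: R] k ->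
  (forall x, 0 <= k x) ->
  \int[mu]_s (if (0 <= s <= T)%R then k s else 0) =
  \int[mu]_s (if (0 < s <= T)%R then k s else 0).
Proof.
move=> mk k0; apply: ge0_ae_eq_integral => //.
- apply: measurable_fun_ifT => //; apply: measurable_and; exact: measurable_fun_ler.
- apply: measurable_fun_ifT => //; apply: measurable_and; first exact: measurable_fun_ltr.
  exact: measurable_fun_ler.
- by move=> s _; case: ifP.
- by move=> s _; case: ifP.
exists [set 0%R]; split; first exact: measurable_set1.
  exact: lebesgue_measure_set1.
move=> s /= H; apply: contrapT => s0; apply: H => _.
by rewrite (lt_neqAle 0%R) (_ : (0%R != s)%R = true)//; apply/eqP => e; apply: s0.
Qed.

Lemma measurable_ecutoff (m : R) (h : R -> \bar R) : measurable_fun [set: R] h ->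
  measurable_fun [set: R] (ecutoff m h).
Proof. by move=> mh; apply: measurable_fun_ifT => //; exact: measurable_fun_ltr. Qed.

(** The mass is cut at [x = e^T]; the substitution [x = e^s] turns the lower part into an integral
    over the times []0, T]]. *)
Lemma integral_expR_split (h : R -> \bar R) (T : R) : measurable_fun [set: R] h ->
  (forall x, 0 <= h x) -> (forall x, (x <= 1)%R -> h x = 0) -> (0 <= T)%R ->
  \int[mu]_s (if (0 < s <= T)%R then (expR s)%:E * h (expR s) else 0) +
  \int[mu]_x ecutoff (expR T) h x = \int[mu]_x h x.
Proof.
move=> mh h0 h1 T0; rewrite integral_expR_window// -ge0_integralD//.
- apply: eq_integral => x _; rewrite /ecutoff expR0.
  have e1 : (1 <= expR T)%R by rewrite -expR0 ler_expR.
  case: (leP x 1%R) => x1 /=.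
    by rewrite add0e h1// if_same.
  by case: (leP x (expR T)) => xT; rewrite ?add0e ?adde0.
- by move=> x _; case: ifP.
- apply: measurable_fun_ifT => //; apply: measurable_and; first exact: measurable_fun_ltr.
  exact: measurable_fun_ler.
- by move=> x _; exact: ecutoff_ge0.
- exact: measurable_ecutoff.
Qed.

Lemma measurable_esection2 (T : R -> R -> \bar R) (s : R) :
  measurable_fun setT (fun q : R * R => T q.1 q.2) -> measurable_fun [set: R] (T s).
Proof.
by move=> mT; exact: (measurableT_comp mT (g := fun x => (s, x)) (measurable_fun_pair _ _)).
Qed.

Lemma measurable_trace (u : R -> R -> \bar R) :
  measurable_fun setT (fun q : R * R => u q.1 q.2) ->
  measurable_fun [set: R] (fun s => (expR s)%:E * u s (expR s)).
Proof.
move=> m_u; apply: emeasurable_funM.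
  by apply/measurable_EFinP; exact: measurable_expR.
exact: (measurableT_comp m_u (g := fun x => (x, expR x)) (measurable_fun_pair _ _)).
Qed.

(** The quantity [B] of the overview for a general family [u]. *)
Definition etrace_mass (u : R -> R -> \bar R) (T : R) : \bar R :=
  \int[mu]_s (if (0 <= s <= T)%R then (expR s)%:E * u s (expR s) else 0).

Lemma etrace_mass_ge0 u T : (forall s x, 0 <= u s x) -> 0 <= etrace_mass u T.
Proof.
move=> u0; apply: integral_ge0 => s _; case: ifP => // _.
by rewrite mule_ge0 ?lee_fin ?expR_ge0.
Qed.

(** By Tonelli, the source at time [s] contributes the trace factor times the mass of [eQ], and [eQ]
    preserves the bound 1 on the mass. *)
Lemma integral_eduhamel_le (u : R -> R -> \bar R) (T : R) :
  measurable_fun setT (fun q : R * R => u q.1 q.2) -> (forall s x, 0 <= u s x) ->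
  (forall s, (0 <= s <= T)%R -> \int[mu]_x ecutoff (expR s) (u s) x <= 1) ->
  \int[mu]_x eduhamel N p f0 u T x <= 1 + etrace_mass u T.
Proof.
move=> m_u u0 H.
have mes : measurable_fun setT (fun q : R * R => if (0 <= q.2 <= T)%R then esource N p u q.2 q.1 else 0).
  apply: measurable_fun_ifT => //.
    by apply: measurable_and; apply: measurable_fun_ler => //; exact: measurable_snd.
  apply: (@measurable_fun_comp2 _ _ _ _ _ _ _ _ (esource N p u)
    (fun q : R * R => q.2) (fun q : R * R => q.1)).
  - exact: measurable_esource2.
  - exact: measurable_snd.
  - exact: measurable_fst.
have es0 x s : 0 <= (if (0 <= s <= T)%R then esource N p u s x else 0).
  by case: ifP => // _; exact: esource_ge0.
rewrite ge0_integralD//; first last.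
- exact: (@measurable_ge0_integral _ _ _ (fun x s => if (0 <= s <= T)%R then esource N p u s x else 0) mes es0).
- by move=> x _; apply: integral_ge0 => s _.
- apply/measurable_EFinP; exact: (measurableT_comp (@normr_measurable R setT) mf0).
apply: leeD => //.
rewrite (@tonelli _ (fun x s => if (0 <= s <= T)%R then esource N p u s x else 0))//.
apply: ge0_le_integralT => s; first by apply: integral_ge0 => x _.
case: ifPn => [sT|_]; last by rewrite integral0.
have mce : measurable_fun [set: R] (ecutoff (expR s) (u s)).
  by apply: measurable_ecutoff; exact: measurable_esection2.
have mQ : measurable_fun [set: R] (eQ N p (ecutoff (expR s) (u s))).
  apply: emeasurable_sum => i; apply: emeasurable_funM => //.
  by apply: measurable_econv_pow => // x; exact: ecutoff_ge0.
have Q0 x : 0 <= eQ N p (ecutoff (expR s) (u s)) x.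
  by apply: (eQ_ge0 p0) => y; exact: ecutoff_ge0.
rewrite /esource ge0_integralZl//; first last.
- by rewrite mule_ge0 ?lee_fin ?expR_ge0.
- by apply: (measurableT_comp mQ); exact: measurable_funB.
rewrite ge0_integral_shift// -[leRHS]mule1; apply: lee_wpmul2l.
  by rewrite mule_ge0 ?lee_fin ?expR_ge0.
apply: (integral_eQ_le1 p0 p1) => //; last exact: H.
by move=> x; exact: ecutoff_ge0.
Qed.

(** Write [B_n] for the trace mass and [F_n] for the mass beyond [e^T]. Splitting and Duhamel give
    [B_(n+1) + F_(n+1) <= 1 + B_n], and [B_n <= B_(n+1)] by monotonicity. Finiteness of [B_n] is
    carried along the induction because it permits the cancellation leading to [F_(n+1) <= 1]. *)
Lemma epicard_mass n (T : R) : (0 <= T)%R ->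
  \int[mu]_x ecutoff (expR T) (g_ n T) x <= 1 /\ etrace_mass (g_ n) T < +oo.
Proof.
have g0 := epicard_ge0 f0 p0; have mg := measurable_epicard2 p0 mf0.
have g10 m tau x : (x <= 1)%R -> g_ m tau x = 0.
  by case: m => [//|m] x1; exact: (eduhamel0 N p f00).
(* Only an inequality: the trace at time [s] reads [g_ m s], which is at most [g_ m T] as the
   iterates increase with time. *)
have split m : forall T, (0 <= T)%R -> etrace_mass (g_ m) T +
    \int[mu]_x ecutoff (expR T) (g_ m T) x <= \int[mu]_x g_ m T x.
  move=> {}T T0; have mgT := measurable_esection2 T (mg m).
  rewrite -(integral_expR_split mgT (g0 m T) (g10 m T) T0); apply: leeD => //.
  rewrite /etrace_mass integral_window_open.
  - apply: ge0_le_integralT => s.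
      by case: ifP => // _; rewrite mule_ge0 ?lee_fin ?expR_ge0.
    case: ifPn => // /andP[_ sT]; apply: lee_wpmul2l; first by rewrite lee_fin expR_ge0.
    case: m {mgT} => [//|m]; exact: eduhamel_le_time.
  - exact: measurable_trace.
  - by move=> s; rewrite mule_ge0 ?lee_fin ?expR_ge0.
elim: n T => [|n IH] T T0.
  split; first by rewrite integral0_eq// => x _; rewrite /ecutoff if_same.
  by rewrite /etrace_mass integral0_eq// => s _; rewrite mule0 if_same.
have [_ Bn] := IH T T0.
have B0 : 0 <= etrace_mass (g_ n) T by exact: etrace_mass_ge0.
have le1 : etrace_mass (g_ n.+1) T + \int[mu]_x ecutoff (expR T) (g_ n.+1 T) x <=
    1 + etrace_mass (g_ n) T.
  apply: le_trans (split _ _ T0) _; apply: integral_eduhamel_le => //.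
  by move=> s /andP[s0 _]; have [] := IH s s0.
have BB : etrace_mass (g_ n) T <= etrace_mass (g_ n.+1) T.
  apply: ge0_le_integralT => s.
    by case: ifP => // _; rewrite mule_ge0 ?lee_fin ?expR_ge0.
  case: ifP => // _; apply: lee_wpmul2l; first by rewrite lee_fin expR_ge0.
  exact: epicard_le.
have F0 : 0 <= \int[mu]_x ecutoff (expR T) (g_ n.+1 T) x.
  by apply: integral_ge0 => x _; exact: ecutoff_ge0.
split.
  have fB : etrace_mass (g_ n) T \is a fin_num by rewrite ge0_fin_numE.
  rewrite -(leeD2lE _ _ fB); apply: le_trans (leeD BB (lexx _)) _.
  by move: le1; rewrite (addeC 1).
apply: le_lt_trans (leeDl _ F0) _; apply: le_lt_trans le1 _.
by rewrite lte_add_pinfty// ltry.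
Qed.

Let mg : measurable_fun setT (fun q : R * R => g q.1 q.2).
Proof. exact: measurable_envelope2. Qed.

Let g0 tau x : 0 <= g tau x.
Proof. exact: envelope_ge0. Qed.

Lemma envelope_mass_le1 (T : R) : (0 <= T)%R ->
  \int[mu]_x ecutoff (expR T) (g T) x <= 1.
Proof.
move=> T0; apply: (@ge0_integral_stationary_le (fun n => ecutoff (expR T) (g_ n T))).
- move=> n; apply: measurable_ecutoff; apply: measurable_esection2.
  exact: measurable_epicard2.
- by move=> n x; apply: ecutoff_ge0 => y; exact: epicard_ge0.
- by move=> n x; rewrite /ecutoff; case: ifP => // _; exact: epicard_le.
- move=> x; have H := causal_fix_cvg (fun u t y y1 => eduhamel0 N p f00 u t (ltW y1))
    (fun u v c t y uv yc => @eduhamel_causal R N p f0 u v c t y uv yc) T x.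
  by apply: filterS H => n; rewrite /ecutoff => ->.
- by move=> n; have [] := epicard_mass n T0.
Qed.

Lemma envelope_time (tau tau' x : R) : (0 <= tau)%R -> (tau <= tau')%R ->
  (x <= 2 * expR tau)%R -> g tau' x = g tau x.
Proof.
move=> t0 tt xt; rewrite (envelopeE N p f00) [RHS](envelopeE N p f00).
exact: eduhamel_time.
Qed.

(** For [s] in []T, T + log 2]] freezing gives [g s (e^s) = g T (e^s)], so the trace over this
    window is part of the mass that [g T] has beyond [e^T]. *)
Lemma etrace_mass_window (T : R) : (0 <= T)%R ->
  \int[mu]_s (if (T < s <= T + ln 2)%R then (expR s)%:E * g s (expR s) else 0) <= 1.
Proof.
move=> T0; apply: le_trans (envelope_mass_le1 T0).
have e2 : expR (T + ln 2) = (2 * expR T)%R by rewrite expRD lnK ?posrE// mulrC.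
rewrite [leLHS](_ : _ = \int[mu]_s (if (T < s <= T + ln 2)%R
    then (expR s)%:E * g T (expR s) else 0)); last first.
  apply: eq_integral => s _; case: ifPn => // /andP[Ts sT]; congr (_ * _).
  by apply: envelope_time => //; [exact: ltW|rewrite -e2 ler_expR].
rewrite integral_expR_window//; last exact: measurable_esection2.
apply: ge0_le_integralT => x; first by case: ifP.
by rewrite /ecutoff; case: ifPn => [/andP[->]//|_]; case: ifP.
Qed.

(** The bounds on the trace masses of the iterates grow with [n] and are lost in the limit. Instead
    [[0, T]] is covered by windows of length [log 2], each contributing at most 1. *)
Lemma etrace_mass_lty (T : R) : etrace_mass g T < +oo.
Proof.
have b0 s : 0 <= (expR s)%:E * g s (expR s) by rewrite mule_ge0 ?lee_fin ?expR_ge0.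
have mb := measurable_trace mg.
have mif (c : R -> bool) : measurable_fun [set: R] c ->
   measurable_fun [set: R] (fun s => if c s then (expR s)%:E * g s (expR s) else 0).
  by move=> mc; exact: measurable_fun_ifT.
have l2 : (0 < ln 2 :> R)%R by rewrite ln_gt0//; lra.
have H n : etrace_mass g (n%:R * ln 2) < +oo.
  elim: n => [|n IH].
    rewrite /etrace_mass integral_window_open// integral0_eq// => s _.
    by case: ifPn => // /andP[s1]; rewrite mul0r leNgt s1.
  apply: (@le_lt_trans _ _ (etrace_mass g (n%:R * ln 2) + 1)); last first.
    by rewrite lte_add_pinfty// ltry.
  have n0 : (0 <= n%:R * ln 2 :> R)%R by rewrite mulr_ge0// ltW.
  apply: le_trans (leeD (lexx _) (etrace_mass_window n0)).
  rewrite -ge0_integralD//.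
  - apply: ge0_le_integralT => s; first by case: ifP.
    rewrite -natr1 mulrDl mul1r.
    case: (leP 0%R s) => //= s0; last first.
      by rewrite add0e; case: ifP.
    case: (leP s (n%:R * ln 2)%R) => s1 /=; first by rewrite (le_trans s1) ?adde0// lerDl ltW.
    by rewrite add0e.
  - by move=> s _; case: ifP.
  - by apply: mif; apply: measurable_and; exact: measurable_fun_ler.
  - by move=> s _; case: ifP.
  - by apply: mif; apply: measurable_and; [exact: measurable_fun_ltr|exact: measurable_fun_ler].
have [n Tn] : exists n : nat, (T <= n%:R * ln 2)%R.
  exists (Num.truncn (T / ln 2)).+1; rewrite -ler_pdivrMr//.
  exact/ltW/truncnS_gt.
apply: le_lt_trans (H n); apply: ge0_le_integralT => s; first by case: ifP.
case: ifPn => [/andP[-> sT]|_]; first by rewrite (le_trans sT Tn).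
by case: ifP.
Qed.

Lemma envelope_total_lty (T : R) : \int[mu]_x g T x < +oo.
Proof.
apply: (@le_lt_trans _ _ (1 + etrace_mass g T)); last first.
  by rewrite lte_add_pinfty ?ltry// etrace_mass_lty.
under eq_integral do rewrite (envelopeE N p f00).
apply: integral_eduhamel_le => // s /andP[s0 _]; exact: envelope_mass_le1.
Qed.

Definition trace (s : R) : R := (expR s * f s (expR s))%R.

Lemma measurable_profile : measurable_fun setT (fun q : R * R => f q.1 q.2).
Proof. exact: measurable_profile2. Qed.

Lemma measurable_profile_section (T : R) : measurable_fun [set: R] (f T).
Proof. exact: (measurable_section2 T measurable_profile). Qed.

Lemma measurable_profile_trace : measurable_fun [set: R] trace.
Proof.
apply: measurable_funM; first exact: measurable_expR.
exact: (measurableT_comp measurable_profile (g := fun x => (x, expR x)) (measurable_fun_pair _ _)).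
Qed.

Lemma measurable_cutoff (m : R) (u : R -> R) : measurable_fun [set: R] u ->
  measurable_fun [set: R] (cutoff m u).
Proof. by move=> m_u; apply: measurable_fun_ifT => //; exact: measurable_fun_ltr. Qed.

Lemma L1norm_cutoff_profile (T : R) : (0 <= T)%R -> L1norm (cutoff (expR T) (f T)) <= 1.
Proof.
move=> T0; apply: le_trans (envelope_mass_le1 T0).
apply: ge0_le_integralT => x; first by rewrite lee_fin.
rewrite /cutoff /ecutoff; case: ifP => _; last by rewrite normr0.
exact: normr_profile_le.
Qed.

Lemma L1norm_profile_lty (T : R) : L1norm (f T) < +oo.
Proof.
apply: le_lt_trans (envelope_total_lty T); apply: ge0_le_integralT => x.
  by rewrite lee_fin.
exact: normr_profile_le.
Qed.

Lemma trace_integrable (T : R) :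
  exists2 W : R, (0 < W)%R &
    \int[mu]_s (if (0 <= s <= T)%R then (`|trace s|%R)%:E else 0) <= W%:E.
Proof.
have gW := etrace_mass_lty T.
have g1 : etrace_mass g T \is a fin_num by rewrite ge0_fin_numE// etrace_mass_ge0.
(* The added 1 makes [W] positive, as the division by [W] in Jensen's inequality requires. *)
exists (fine (etrace_mass g T) + 1)%R.
  by rewrite ltr_wpDl// fine_ge0// etrace_mass_ge0.
apply: (@le_trans _ _ (etrace_mass g T)); last by rewrite EFinD fineK// leeDl.
apply: ge0_le_integralT => s; first by case: ifP.
case: ifP => // _; rewrite normrM ger0_norm ?expR_ge0// EFinM.
apply: lee_wpmul2l; first by rewrite lee_fin expR_ge0.
exact: normr_profile_le.
Qed.

End mass.

(** * Weighted bounds *)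

Section gronwall.
Context {R : realType}.
Local Notation mu := (@lebesgue_measure R).
Local Open Scope ereal_scope.

Lemma measurable_window (T : R -> \bar R) (S S' : R) : measurable_fun [set: R] T ->
  measurable_fun [set: R] (fun s => if (S <= s <= S')%R then T s else 0).
Proof.
move=> mT; apply: measurable_fun_ifT => //.
by apply: measurable_and; exact: measurable_fun_ler.
Qed.

(** Absolute continuity of the integral: some truncation of [b] at height [n] loses at most [e / 2]
    of the integral, and a window of length [d] carries at most [n d <= e / 2] of the truncation. *)
Lemma ge0_integral_small_window (b : R -> \bar R) (e : R) : measurable_fun [set: R] b ->
  (forall s, 0 <= b s) -> \int[mu]_s b s < +oo -> (0 < e)%R ->
  exists2 d : R, (0 < d)%R & forall S S' : R, (S' <= S + d)%R ->
    \int[mu]_s (if (S <= s <= S')%R then b s else 0) <= e%:E.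
Proof.
move=> mb b0 boo e0; pose m n s := mine (b s) n%:R%:E.
have mm n : measurable_fun [set: R] (m n) by exact: measurable_mine.
have m0 n s : 0 <= m n s by rewrite le_min b0 lee_fin ler0n.
have ndm s : nondecreasing_seq (m ^~ s).
  move=> i j ij; rewrite le_min ge_min lexx/= ge_min; apply/orP; right.
  by rewrite lee_fin ler_nat.
have limm s : m ^~ s @ \oo --> b s.
  case E : (b s) (b0 s) => [r| |]// _.
    apply: cvg_near_cst; exists (Num.truncn r).+1 => // n /= rn.
    rewrite /m E; apply: min_l; rewrite lee_fin; apply/ltW.
    by apply: lt_le_trans (truncnS_gt r) _; rewrite ler_nat.
  rewrite (_ : m ^~ s = fun n => n%:R%:E).
    by apply/cvgeryP; exact: cvgr_idn.
  by apply/funext => n; rewrite /m E; apply: min_r; rewrite leey.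
have Ib : \int[mu]_s m n s @[n --> \oo] --> \int[mu]_s b s.
  rewrite [X in _ --> X](_ : _ = \int[mu]_s limn (m ^~ s)); last first.
    by apply: eq_integral => s _; apply/esym/cvg_lim => //; exact: limm.
  exact: cvg_monotone_convergence.
have fb : \int[mu]_s b s \is a fin_num by rewrite ge0_fin_numE// integral_ge0.
have [n Hn] : exists n, \int[mu]_s b s <= \int[mu]_s m n s + (e / 2)%:E.
  have lt1 : \int[mu]_s b s - (e / 2)%:E < \int[mu]_s b s.
    by rewrite lteBlDr// lteDl// lte_fin divr_gt0.
  apply: contrapT => /forallNP H.
  have cI : cvgn (fun n => \int[mu]_s m n s) by apply/cvg_ex; eexists; exact: Ib.
  have F : limn (fun n => \int[mu]_s m n s) <= \int[mu]_s b s - (e / 2)%:E.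
    apply: lime_le => //; apply: nearW => n.
    by have /negP := H n; rewrite -ltNge leeBrDr// => /ltW.
  by move: F; rewrite (cvg_lim _ Ib)// leNgt lt1.
exists (e / 2 / n.+1%:R)%R; first by rewrite !divr_gt0.
move=> S S' SS'; pose c s := (S <= s <= S')%R.
have mc : measurable_fun [set: R] c by apply: measurable_and; exact: measurable_fun_ler.
have split h : measurable_fun [set: R] h -> (forall s, 0 <= h s) ->
    \int[mu]_s h s = \int[mu]_s (if c s then h s else 0) + \int[mu]_s (if c s then 0 else h s).
  move=> mh h0; rewrite -ge0_integralD//.
  - by apply: eq_integral => s _; case: ifP; rewrite ?add0e ?adde0.
  - by move=> s _; case: ifP.
  - exact: measurable_fun_ifT.
  - by move=> s _; case: ifP.
  - exact: measurable_fun_ifT.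
have foo : \int[mu]_s (if c s then 0 else b s) \is a fin_num.
  rewrite ge0_fin_numE; last by apply: integral_ge0 => s _; case: ifP.
  apply: le_lt_trans boo; apply: ge0_le_integralT => s; first by case: ifP.
  by case: ifP.
rewrite -(leeD2rE _ _ foo) -split//; apply: le_trans Hn _.
rewrite (split _ (mm n) (m0 n)) addeAC; apply: leeD; last first.
  apply: ge0_le_integralT => s; first by case: ifP.
  by case: ifP => // _; rewrite ge_min lexx.
rewrite [in leRHS](_ : e = e / 2 + e / 2)%R; last by field.
rewrite EFinD; apply: leeD => //.
apply: (@le_trans _ _ (\int[mu]_(s in `[S, S']) (n%:R)%:E)).
  rewrite [leRHS]integral_mkcond; apply: ge0_le_integralT => s.
    by case: ifP.
  by rewrite patchE mem_setE in_itv/= -/(c s); case: ifP => // _; rewrite ge_min lexx orbT.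
rewrite integral_cst//= lebesgue_measure_itv/= lte_fin; case: ifPn => [SS|_]; last first.
  by rewrite mule0 lee_fin divr_ge0// ltW.
rewrite -EFinB -EFinM lee_fin.
apply: (@le_trans _ _ (n.+1%:R * (e / 2 / n.+1%:R))%R); last first.
  by rewrite mulrC divfK// pnatr_eq0.
apply: ler_pM => //; [by rewrite subr_ge0 ltW|by rewrite ler_nat|by rewrite lerBlDl].
Qed.

(* Stated for a sequence, so that it applies to quantities that are not known to
   be finite beforehand, through their truncations, and to geometric multiples
   [2 ^+ n * d] of one function [d], which it forces to vanish. *)
Lemma gronwall (b : R -> R) (T A C : R) : measurable_fun [set: R] b ->
  (forall s, 0 <= b s)%R -> (0 <= A)%R -> (0 <= C)%R ->
  \int[mu]_s (if (0 <= s <= T)%R then (b s)%:E else 0) < +oo ->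
  forall u : nat -> R -> \bar R, (forall n, measurable_fun [set: R] (u n)) ->
  (forall n s, 0 <= u n s) -> (forall s, (0 <= s <= T)%R -> u 0%N s <= A%:E) ->
  (forall n t, (0 <= t <= T)%R ->
    u n.+1 t <= A%:E + C%:E * \int[mu]_s (if (0 <= s <= t)%R then (b s)%:E * u n s else 0)) ->
  exists2 M : R, (0 <= M)%R & forall n t, (0 <= t <= T)%R -> u n t <= M%:E.
Proof.
move=> mb b0 A0 C0 boo u m_u u0 uA uS.
have mbE : measurable_fun [set: R] (EFin \o b) by exact/measurable_EFinP.
pose bT s := if (0 <= s <= T)%R then (b s)%:E else 0.
have bT0 s : 0 <= bT s by rewrite /bT; case: ifP; rewrite ?lee_fin.
have mbT : measurable_fun [set: R] bT by exact: measurable_window.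
have C1 : (0 < 2 * (C + 1))%R by lra.
(* With this much [b]-mass per window, the current window contributes, after multiplication by [C],
   at most half of the bound being proved. The added 1 covers [C = 0]. *)
have e0 : (0 < (2 * (C + 1))^-1)%R by rewrite invr_gt0.
have [d d0 Hd] := ge0_integral_small_window mbT bT0 boo e0.
have W0 : 0 <= \int[mu]_s bT s by exact: integral_ge0.
pose W := fine (\int[mu]_s bT s).
have WE : \int[mu]_s bT s = W%:E by rewrite fineK// ge0_fin_numE.
have W0' : (0 <= W)%R by rewrite fine_ge0.
suff H k : exists2 M : R, (0 <= M)%R &
    forall n t, (0 <= t <= T)%R -> (t < k%:R * d)%R -> u n t <= M%:E.
  have [M M0 HM] := H (Num.truncn (T / d)).+1; exists M => // n t tT.
  apply: HM => //; rewrite -ltr_pdivrMr//; apply: le_lt_trans (truncnS_gt (T / d)).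
  by rewrite ler_pM2r ?invr_gt0//; case/andP : tT.
elim: k => [|k [M M0 IH]].
  by exists 0%R => // n t /andP[t0 _]; rewrite mul0r ltNge t0.
(* The solution of [M' = A + C M W + M' / 2]: [M] bounds [u] on the earlier windows, of total
   [b]-mass at most [W], and the last term is the half absorbed by the current window. *)
pose M' := (2 * (A + C * (M * W)))%R.
have M'0 : (0 <= M')%R by rewrite mulr_ge0// addr_ge0 ?mulr_ge0.
exists M' => // n; elim: n => [|n IHn] t tT tk.
  apply: le_trans (uA _ tT) _; rewrite lee_fin /M'.
  have : (0 <= C * (M * W))%R by rewrite !mulr_ge0.
  by lra.
apply: le_trans (uS _ _ tT) _.
have key : \int[mu]_s (if (0 <= s <= t)%R then (b s)%:E * u n s else 0) <=
    (M * W + M' * (2 * (C + 1))^-1)%:E.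
  pose w s := if (k%:R * d <= s <= t)%R then bT s else 0.
  have w0 s : 0 <= w s by rewrite /w; case: ifP.
  have mw : measurable_fun [set: R] w by exact: measurable_window.
  apply: (@le_trans _ _ (\int[mu]_s (M%:E * bT s + M'%:E * w s))).
    apply: ge0_le_integralT => s.
      by case: ifP => // _; rewrite mule_ge0// lee_fin.
    case: ifPn => [/andP[s0 st]|_]; last by rewrite adde_ge0// mule_ge0.
    have sT : (0 <= s <= T)%R by rewrite s0 (le_trans st)//; case/andP : tT.
    have [sk|ks] := ltP s (k%:R * d)%R.
      apply: (@le_trans _ _ (M%:E * bT s)); last by rewrite leeDl// mule_ge0.
      by rewrite muleC /bT sT; apply: lee_wpmul2r; rewrite ?lee_fin//; exact: IH.
    apply: (@le_trans _ _ (M'%:E * w s)); last by rewrite leeDr// mule_ge0.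
    rewrite muleC /w ks st /bT sT; apply: lee_wpmul2r; rewrite ?lee_fin//.
    by apply: IHn => //; exact: le_lt_trans tk.
  rewrite ge0_integralD//; first last.
  - by apply: measurable_funeM.
  - by move=> s _; rewrite mule_ge0.
  - by apply: measurable_funeM.
  - by move=> s _; rewrite mule_ge0.
  rewrite !ge0_integralZl// EFinD; apply: leeD; first by rewrite WE EFinM.
  rewrite [leRHS]EFinM; apply: lee_wpmul2l; first by rewrite lee_fin.
  apply: Hd; move: tk; rewrite -natr1 mulrDl mul1r => /ltW; lra.
apply: le_trans (leeD (lexx _) (lee_wpmul2l _ key)) _; first by rewrite lee_fin.
rewrite -EFinM -EFinD lee_fin.
have : (C * (2 * (C + 1))^-1 <= 2^-1)%R.
  rewrite ler_pdivrMr//; lra.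
move=> HC; have := ler_wpM2r M'0 HC; rewrite /M' => H.
have -> : (A + C * (M * W + 2 * (A + C * (M * W)) * (2 * (C + 1))^-1) =
  A + C * (M * W) + C * (2 * (C + 1))^-1 * (2 * (A + C * (M * W))))%R by ring.
lra.
Qed.

Lemma normr_le_shift (x m : R) : (0 < m)%R -> (m < x - m)%R -> (`|x| <= 2 * `|x - m|)%R.
Proof. by move=> m0 mx; rewrite !ger0_norm; lra. Qed.

End gronwall.

Section weighted_bound.
Context {R : realType}.
Local Notation mu := (@lebesgue_measure R).
Variables (N : nat) (p : nat -> R) (f0 : R -> R).
Hypothesis p0 : forall j, (1 <= j <= N)%N -> 0 <= p j.
Hypothesis p1 : \sum_(1 <= j < N.+1) p j = 1.
Hypothesis mf0 : measurable_fun [set: R] f0.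
Hypothesis f00 : forall x, x <= 1 -> f0 x = 0.
Hypothesis f01 : (L1norm f0 <= 1)%E.
Local Notation f := (profile N p f0).
Local Notation g := (envelope N p f0).
Local Notation beta := (trace N p f0).
Variables r gamma : R.
Hypothesis r1 : 1 <= r.
Hypothesis gamma0 : 0 <= gamma.
Local Open Scope ereal_scope.

Let mbeta : measurable_fun [set: R] beta.
Proof. exact: measurable_profile_trace. Qed.

Let mprofile : measurable_fun setT (fun q : R * R => f q.1 q.2).
Proof. exact: measurable_profile. Qed.

(** Unlike in [source], the trace factor remains that of the solution. This makes room for
    truncations of the solution in the place of [v], whose own traces would be truncated as well. *)
Definition gain (v : R -> R -> R) (s x : R) : R :=
  (beta s * Q N p (cutoff (expR s) (v s)) (x - expR s))%R.

Lemma source_gain (s x : R) : source N p f s x = gain f s x.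
Proof. by []. Qed.

Let measurable_gain2 v : measurable_fun setT (fun q : R * R => v q.1 q.2) ->
  measurable_fun setT (fun q : R * R => gain v q.1 q.2).
Proof.
move=> mv; apply: measurable_funM.
  by apply: (measurableT_comp mbeta); exact: measurable_fst.
apply: (@measurable_fun_comp2 _ _ _ _ _ _ _ _
    (fun s => Q N p (cutoff (expR s) (v s))) (fun q : R * R => q.1)
    (fun q : R * R => q.2 - expR q.1)%R).
- have H := measurable_cutoff2 mv (@measurable_expR R).
  exact: (@measurable_Q2 R N p _ _ (fun s => cutoff (expR s) (v s)) H).
- exact: measurable_fst.
- apply: measurable_funB; first exact: measurable_snd.
  by apply: (measurableT_comp (@measurable_expR R)); exact: measurable_fst.
Qed.

(** Where [u (x - m)] is nonzero one has [x - m > m], so [|x| <= 2 |x - m|]: the weight loses a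
    factor [2^gamma] that does not depend on the shift. *)
Lemma wnorm_shift_le (u : R -> R) (m : R) : measurable_fun [set: R] u -> (0 < m)%R ->
  (forall x, (x <= m)%R -> u x = 0%R) ->
  wnorm r gamma (fun x => u (x - m)%R) <= ((2 `^ gamma) `^ r)%:E * wnorm r gamma u.
Proof.
move=> m_u m0 um; have r0 : (0 < r)%R := lt_le_trans ltr01 r1.
have mw := measurable_wfun r gamma m_u.
rewrite /wnorm -[X in _ <= _ * X](@ge0_integral_shift _
   (fun x => ((`|x| `^ gamma * `|u x|) `^ r)%:E) m); first last.
- by move=> x; rewrite lee_fin powR_ge0.
- exact/measurable_EFinP.
have mws : measurable_fun [set: R] (fun x => (`|x - m| `^ gamma * `|u (x - m)|) `^ r)%R.
  by apply: (measurableT_comp mw); exact: measurable_funB.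
rewrite -ge0_integralZl//; first last.
- exact/measurable_EFinP.
apply: ge0_le_integralT => x; first by rewrite lee_fin powR_ge0.
rewrite -EFinM lee_fin -powRM ?powR_ge0 ?mulr_ge0 ?powR_ge0//.
apply: ge0_ler_powR; rewrite ?nnegrE ?mulr_ge0 ?powR_ge0//; first exact: ltW.
have [xm|mx] := leP (x - m)%R m; first by rewrite um// normr0 !mulr0.
rewrite mulrA; apply: ler_wpM2r => //; rewrite -powRM//.
apply: ge0_ler_powR; rewrite ?nnegrE ?mulr_ge0//.
exact: normr_le_shift.
Qed.

(** Jensen in [s] against the weight [|beta|], of mass at most [W] on [[0, T]], then Tonelli,
    [wnorm_shift_le] and [wnorm_Q]. The free window and the almost-everywhere bound on [phi] allow
    two uses: for truncations of the solution and for its increments in time. *)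
Lemma wnorm_gain_le (T : R) : exists2 K : R, (0 <= K)%R &
  forall (v : R -> R -> R) (S S' : R) (phi : R -> R),
    measurable_fun setT (fun q : R * R => v q.1 q.2) ->
    (0 <= S)%R -> (S' <= T)%R ->
    (forall s, (0 <= s <= T)%R -> L1norm (cutoff (expR s) (v s)) <= 1) ->
    measurable_fun [set: R] phi ->
    {ae mu, forall x, (`|phi x|%R)%:E <=
       \int[mu]_s (if (S <= s <= S')%R then (`|gain v s x|%R)%:E else 0)} ->
    wnorm r gamma phi <=
      K%:E * \int[mu]_s (if (S <= s <= S')%R then (`|beta s|%R)%:E * wnorm r gamma (v s) else 0).
Proof.
have r0 : (0 < r)%R := lt_le_trans ltr01 r1.
have [W W0 HW] := trace_integrable p0 p1 mf0 f00 f01 T.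
have [C C0 HC] := wnorm_Q N p r1 gamma0.
have K2 : (0 <= (2 `^ gamma) `^ r)%R by rewrite powR_ge0.
exists (W `^ (r - 1) * ((2 `^ gamma) `^ r * C))%R.
  by rewrite mulr_ge0 ?powR_ge0// mulr_ge0.
move=> v S S' phi mv S0 S'T v1 mphi phiE.
pose q s x := Q N p (cutoff (expR s) (v s)) (x - expR s)%R.
pose w s := (if (S <= s <= S')%R then `|beta s| else 0)%R.
have w0 s : (0 <= w s)%R by rewrite /w; case: ifP.
have mw : measurable_fun [set: R] w.
  apply: measurable_fun_ifT => //; last exact: (measurableT_comp (@normr_measurable R setT) mbeta).
  by apply: measurable_and; exact: measurable_fun_ler.
have wW : \int[mu]_s (w s)%:E <= W%:E.
  apply: le_trans HW; apply: ge0_le_integralT => s; first by rewrite lee_fin.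
  rewrite /w; case: (boolP (S <= s <= S')%R) => [/andP[Ss sS]|_]; last first.
    by case: ifP => // _; rewrite lee_fin.
  by rewrite (le_trans S0 Ss) (le_trans sS S'T).
have mq2 : measurable_fun setT (fun z : R * R => q z.1 z.2).
  apply: (@measurable_fun_comp2 _ _ _ _ _ _ _ _
    (fun s => Q N p (cutoff (expR s) (v s))) (fun q : R * R => q.1)
    (fun q : R * R => q.2 - expR q.1)%R).
  - have H := measurable_cutoff2 mv (@measurable_expR R).
    exact: (@measurable_Q2 R N p _ _ (fun s => cutoff (expR s) (v s)) H).
  - exact: measurable_fst.
  - apply: measurable_funB; first exact: measurable_snd.
    by apply: (measurableT_comp (@measurable_expR R)); exact: measurable_fst.
pose h x s := (`|x| `^ gamma * `|q s x|)%R.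
have h0 x s : (0 <= h x s)%R by rewrite mulr_ge0 ?powR_ge0.
have mh2 : measurable_fun setT (fun z : R * R => h z.1 z.2).
  apply: measurable_funM.
    apply: (measurableT_comp (measurable_powR gamma)).
    by apply: (measurableT_comp (@normr_measurable R setT)); exact: measurable_fst.
  apply: (measurableT_comp (@normr_measurable R setT)).
  by apply: (@measurable_fun_comp2 _ _ _ _ _ _ _ _ q (fun z : R * R => z.2) (fun z : R * R => z.1));
     [exact: mq2|exact: measurable_snd|exact: measurable_fst].
have mhw : measurable_fun setT (fun z : R * R => ((h z.1 z.2) `^ r * w z.2)%:E).
  apply/measurable_EFinP; apply: measurable_funM.
    by apply: (measurableT_comp (measurable_powR r)).
  by apply: (measurableT_comp mw); exact: measurable_snd.
have hw0 x s : 0 <= ((h x s) `^ r * w s)%:E by rewrite lee_fin mulr_ge0// powR_ge0.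
have Jx x : (`|phi x|%R)%:E <= \int[mu]_s (if (S <= s <= S')%R then (`|gain v s x|%R)%:E else 0) ->
    (((`|x| `^ gamma * `|phi x|) `^ r)%R)%:E <=
    (W `^ (r - 1))%:E * \int[mu]_s ((h x s) `^ r * w s)%:E.
  move=> phix; apply: le_trans (jensen_weighted W0 r1 (measurable_section2 x mh2) mw (h0 x) w0 wW).
  rewrite -poweR_EFin; apply: gt0_ler_poweR.
  - exact: ltW.
  - by rewrite in_itv/= leey andbT lee_fin mulr_ge0 ?powR_ge0.
  - by rewrite in_itv/= leey andbT; apply: integral_ge0 => s _; rewrite lee_fin mulr_ge0.
  rewrite EFinM; apply: le_trans (lee_wpmul2l _ phix) _; first by rewrite lee_fin powR_ge0.
  rewrite -ge0_integralZl//; first last.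
    - by move=> s _; case: ifP.
  - apply: measurable_window; apply/measurable_EFinP.
    apply: (measurableT_comp (@normr_measurable R setT)).
    exact: (measurable_section1 x (measurable_gain2 mv)).
  apply: ge0_le_integralT => s; first by case: ifP; rewrite ?mule0// mule_ge0// lee_fin powR_ge0.
  rewrite /w; case: ifP => _; last by rewrite mulr0 mule0.
  rewrite -EFinM lee_fin (_ : `|x| `^ gamma * `|gain v s x| = h x s * `|beta s|)%R//.
  by rewrite /h /gain normrM -/(q s x); ring.
have mIx : measurable_fun [set: R] (fun x => \int[mu]_s ((h x s) `^ r * w s)%:E).
  exact: (measurable_ge0_integral mhw hw0).
apply: (@le_trans _ _ (\int[mu]_x ((W `^ (r - 1))%:E * \int[mu]_s ((h x s) `^ r * w s)%:E))).
  apply: ae_ge0_le_integral => //.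
  - by apply/measurable_EFinP; exact: measurable_wfun.
  - by move=> x _; rewrite mule_ge0 ?lee_fin ?powR_ge0// integral_ge0.
  - exact: measurable_funeM.
  by apply: aeS phiE => x Hx _; exact: Jx.
rewrite ge0_integralZl//; first last.
- by rewrite lee_fin powR_ge0.
- by move=> x _; exact: integral_ge0.
rewrite EFinM -muleA; apply: lee_wpmul2l; first by rewrite lee_fin powR_ge0.
rewrite (tonelli mhw hw0).
have mwn : measurable_fun [set: R] (fun s => wnorm r gamma (v s)).
  apply: (measurable_ge0_integral (f := fun s x => ((`|x| `^ gamma * `|v s x|) `^ r)%:E)).
    apply/measurable_EFinP; apply: (measurableT_comp (measurable_powR r)).
    apply: measurable_funM.
      apply: (measurableT_comp (measurable_powR gamma)).
      by apply: (measurableT_comp (@normr_measurable R setT)); exact: measurable_snd.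
    exact: (measurableT_comp (@normr_measurable R setT) mv).
  by move=> s x; rewrite lee_fin powR_ge0.
rewrite -ge0_integralZl//; first last.
- by rewrite lee_fin mulr_ge0.
- by move=> s _; case: ifP => // _; rewrite mule_ge0 ?wnorm_ge0.
- apply: measurable_window; apply: emeasurable_funM => //.
  by apply/measurable_EFinP; exact: (measurableT_comp (@normr_measurable R setT) mbeta).
apply: ge0_le_integralT => s; first exact: integral_ge0.
under eq_integral do rewrite mulrC EFinM.
rewrite ge0_integralZl//; first last.
- by rewrite lee_fin.
- by move=> x _; rewrite lee_fin powR_ge0.
- apply/measurable_EFinP; apply: (measurableT_comp (measurable_powR r)).
  exact: (measurable_section1 s mh2).
rewrite /w; case: ifPn => [/andP[Ss sS]|_]; last by rewrite mul0e mule0.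
have s0T : (0 <= s <= T)%R by rewrite (le_trans S0 Ss) (le_trans sS S'T).
have mcv : measurable_fun [set: R] (cutoff (expR s) (v s)).
  by apply: measurable_cutoff; exact: measurable_section2.
rewrite muleCA; apply: lee_wpmul2l => //.
apply: le_trans (wnorm_shift_le (measurable_Q N p mcv) (expR_gt0 s) _) _.
  move=> x xs; apply: (@Q_eq0 _ _ _ _ (expR s)) => //; first exact: expR_gt0.
  by move=> y; exact: cutoff_eq0.
rewrite EFinM -muleA; apply: lee_wpmul2l; first by rewrite lee_fin.
apply: le_trans (HC _ mcv (v1 _ s0T)) _; apply: lee_wpmul2l; first by rewrite lee_fin.
apply: wnorm_le; first exact: ltW.
by move=> x; rewrite /cutoff; case: ifP; rewrite ?normr0.
Qed.

(** The norm of [f t] is not known to be finite, so Gronwall is applied to the truncations of [f] to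
    [x < n]. By causality truncation [n + 1] is controlled by truncation [n], starting from 0, and
    the resulting bound is uniform in [n]. *)
Lemma wnorm_profile_le (T : R) : wnorm r gamma f0 < +oo ->
  exists2 M : R, (0 <= M)%R & forall t, (0 <= t <= T)%R -> wnorm r gamma (f t) <= M%:E.
Proof.
move=> f0oo; have r0 : (0 < r)%R := lt_le_trans ltr01 r1.
have [K K0 HK] := wnorm_gain_le T.
have [W W0 HW] := trace_integrable p0 p1 mf0 f00 f01 T.
have f0E : wnorm r gamma f0 = (fine (wnorm r gamma f0))%:E.
  by rewrite fineK// ge0_fin_numE// wnorm_ge0.
pose ftr (n : nat) (t x : R) := if (x < n%:R)%R then f t x else 0%R.
have mcond n : measurable_fun setT (fun q : R * R => q.2 < n%:R)%R.
  by apply: measurable_fun_ltr => //; exact: measurable_snd.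
have mftr n : measurable_fun setT (fun q : R * R => ftr n q.1 q.2).
  exact: measurable_fun_ifT.
have mfs n t : measurable_fun [set: R] (ftr n t) by exact: (measurable_section2 t (mftr n)).
have mabs : measurable_fun [set: R] (fun s => `|beta s|)%R.
  exact: (measurableT_comp (@normr_measurable R setT) mbeta).
have A0 : (0 <= 2 `^ r * fine (wnorm r gamma f0))%R.
  by rewrite mulr_ge0 ?powR_ge0 ?fine_ge0 ?wnorm_ge0.
have C0 : (0 <= 2 `^ r * K)%R by rewrite mulr_ge0 ?powR_ge0.
have boo : \int[mu]_s (if (0 <= s <= T)%R then (`|beta s|%R)%:E else 0) < +oo.
  by apply: le_lt_trans HW _; rewrite ltry.
have mu_n n : measurable_fun [set: R] (fun t => wnorm r gamma (ftr n t)).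
  apply: (measurable_ge0_integral (f := fun s x => ((`|x| `^ gamma * `|ftr n s x|) `^ r)%:E)).
    apply/measurable_EFinP; apply: (measurableT_comp (measurable_powR r)).
    apply: measurable_funM.
      apply: (measurableT_comp (measurable_powR gamma)).
      by apply: (measurableT_comp (@normr_measurable R setT)); exact: measurable_snd.
    exact: (measurableT_comp (@normr_measurable R setT) (mftr n)).
  by move=> s x; rewrite lee_fin powR_ge0.
have u0 (s : R) : (0 <= s <= T)%R ->
    wnorm r gamma (ftr 0%N s) <= (2 `^ r * fine (wnorm r gamma f0))%:E.
  move=> _; rewrite [leLHS](_ : _ = 0) ?lee_fin//.
  rewrite /wnorm integral0_eq// => x _; rewrite /ftr; case: ifPn => x0.
    rewrite (profile_eq0 N p f00) ?normr0 ?mulr0 ?powR0 ?gt_eqF//.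
    by apply: ltW; apply: lt_trans x0 _.
  by rewrite normr0 mulr0 powR0// gt_eqF.
have uS n (t : R) : (0 <= t <= T)%R -> wnorm r gamma (ftr n.+1 t) <=
    (2 `^ r * fine (wnorm r gamma f0))%:E + (2 `^ r * K)%:E *
      \int[mu]_s (if (0 <= s <= t)%R then (`|beta s|%R)%:E * wnorm r gamma (ftr n s) else 0).
  move=> /andP[t0 tT].
  pose phi x := if (x < n.+1%:R)%R then (f t x - f0 x)%R else 0%R.
  have mphi : measurable_fun [set: R] phi.
    apply: measurable_fun_ifT => //; first exact: measurable_fun_ltr.
    by apply: measurable_funB => //; exact: measurable_profile_section.
  apply: (@le_trans _ _ (wnorm r gamma (fun x => f0 x + phi x)%R)).
    apply: wnorm_le; first exact: ltW.
    move=> x; rewrite /ftr /phi; case: ifP => _; last by rewrite normr0.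
    by rewrite addrC subrK.
  apply: le_trans (wnormD _ (ltW r0) mf0 mphi) _.
  rewrite [X in _ <= X + _]EFinM [X in _ <= _ + X * _]EFinM -muleA -f0E.
  rewrite -ge0_muleDr ?wnorm_ge0//; last first.
    rewrite mule_ge0// integral_ge0// => s _; case: ifP => // _.
    by rewrite mule_ge0 ?wnorm_ge0.
  apply: lee_wpmul2l; first by rewrite lee_fin powR_ge0.
  apply: leeD => //; apply: HK => //.
    move=> s /andP[s0 sT]; apply: le_trans (L1norm_cutoff_profile p0 p1 mf0 f00 f01 s0).
    apply: ge0_le_integralT => x; first by rewrite lee_fin.
    rewrite lee_fin /cutoff; case: ifP => // _; rewrite /ftr; case: ifP => //.
    by rewrite normr0.
  apply: aeW => x; rewrite /phi; case: ifPn => xn; last first.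
    by rewrite normr0; apply: integral_ge0 => s _; case: ifP.
  rewrite {1}(profileE N p f00) /duhamel addrC addKr.
  apply: le_trans (normr_Rintegral_le _ _) _ => //.
    by apply: measurable_timeslice; apply: measurable_source2.
  apply: ge0_le_integralT => s; first by rewrite lee_fin.
  case: ifPn => [/andP[s0 st]|_]; last by rewrite normr0.
  suff -> : source N p f s x = gain (ftr n) s x by [].
  (* Since [e^s >= 1], the point [x - e^s] is below [n] when [x < n + 1], and there [Q] sees only
     the truncated function. *)
  rewrite source_gain /gain; congr (_ * _)%R; apply: (@Q_local _ _ _ _ _ n%:R).
  - by move=> y y0; apply: cutoff_eq0; exact: le_trans y0 (expR_ge0 _).
  - by move=> y y0; apply: cutoff_eq0; exact: le_trans y0 (expR_ge0 _).
  - by move=> y yn; rewrite /cutoff /ftr yn.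
  - rewrite ltrBlDr; apply: lt_le_trans xn _; rewrite -natr1 lerD2l.
    by rewrite -expR0 ler_expR.
have [M M0 HM] := gronwall mabs (fun s => normr_ge0 (beta s)) A0 C0 boo
  mu_n (fun n t => wnorm_ge0 r gamma (ftr n t)) u0 uS.
exists M => // t tT.
apply: (@ge0_integral_stationary_le _ (fun n x => ((`|x| `^ gamma * `|ftr n t x|) `^ r)%:E)).
- by move=> n; apply/measurable_EFinP; exact: measurable_wfun.
- by move=> n x; rewrite lee_fin powR_ge0.
- move=> n x; rewrite lee_fin; apply: ge0_ler_powR; rewrite ?nnegrE ?mulr_ge0 ?powR_ge0//.
    exact: ltW.
  apply: ler_wpM2l; first exact: powR_ge0.
  rewrite /ftr; case: ifPn => [xn|_]; last by rewrite normr0.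
  by rewrite (lt_trans xn)// ltr_nat.
- move=> x; exists (Num.truncn x).+1 => // n /= xn; rewrite /ftr.
  by rewrite (lt_le_trans (truncnS_gt x))// ler_nat.
- by move=> n; exact: HM.
Qed.

(** The increment is the integral of the sources emitted between [S] and [S'], whose norms are
    bounded by [wnorm_profile_le]. Subtracting the two Duhamel integrals needs both to converge;
    this holds wherever the envelope is finite, that is almost everywhere. *)
Lemma wnorm_profileB_le (T : R) : wnorm r gamma f0 < +oo ->
  exists2 K : R, (0 <= K)%R & forall S S', (0 <= S)%R -> (S <= S')%R -> (S' <= T)%R ->
    wnorm r gamma (f S' \- f S)%R <=
      K%:E * \int[mu]_s (if (S <= s <= S')%R then (`|beta s|%R)%:E else 0).
Proof.
move=> f0oo; have [K K0 HK] := wnorm_gain_le T.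
have [M M0 HM] := wnorm_profile_le T f0oo.
exists (K * M)%R; first exact: mulr_ge0.
move=> S S' S0 SS S'T.
have mfs t : measurable_fun [set: R] (f t) by exact: measurable_profile_section.
apply: (@le_trans _ _ (K%:E * \int[mu]_s
    (if (S <= s <= S')%R then (`|beta s|%R)%:E * wnorm r gamma (f s) else 0))).
  apply: HK => //.
  - by move=> s /andP[s0 _]; exact: (L1norm_cutoff_profile p0 p1 mf0 f00 f01 s0).
  - exact: measurable_funB.
  have g0 t x : 0 <= g t x by exact: envelope_ge0.
  have mg t : measurable_fun [set: R] (g t).
    by apply: measurable_esection2; exact: measurable_envelope2.
  have ig : mu.-integrable setT (g S').
    apply/integrableP; split; first exact: mg.
    rewrite (_ : \int[mu]_x `|g S' x| = \int[mu]_x g S' x).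
      exact: (envelope_total_lty p0 p1 mf0 f00 f01 S').
    by apply: eq_integral => x _; rewrite gee0_abs.
  have := @integrable_ae _ _ _ mu setT measurableT _ ig; apply: aeS => x /(_ I) gx.
  have goo : g S' x < +oo by rewrite -ge0_fin_numE.
  have mts t : measurable_fun [set: R] (fun s => if (0 <= s <= t)%R then source N p f s x else 0%R).
    by apply: measurable_timeslice; apply: measurable_source2.
  have its t : (t <= S')%R ->
      mu.-integrable setT (fun s => (if (0 <= s <= t)%R then source N p f s x else 0%R)%:E).
    move=> tS; apply: integrable_ge0 => //; apply: le_lt_trans goo.
    rewrite (envelopeE N p f00) /eduhamel.
    apply: le_trans (leeDr _ _) => //; apply: ge0_le_integralT => s; first by rewrite lee_fin.
    case: ifPn => [/andP[s0 st]|_]; last first.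
      by rewrite normr0; case: ifP => // _; exact: esource_ge0.
    rewrite s0 (le_trans st tS)/=; apply: (source_le p0) => // t' y.
    exact: normr_profile_le.
  rewrite /= (profileE N p f00 S') (profileE N p f00 S) /duhamel opprD addrACA subrr add0r.
  rewrite -RintegralB//; [|exact: its|exact: its].
  apply: le_trans (normr_Rintegral_le _ _) _ => //; first exact: measurable_funB.
  apply: ge0_le_integralT => s; first by rewrite lee_fin.
  rewrite -source_gain; case: (leP 0%R s) => s0 /=; last first.
    by rewrite subrr normr0; case: ifP => // _; rewrite lee_fin.
  case: (leP s S) => sS.
    by rewrite (le_trans sS SS) subrr normr0; case: ifP => // _; rewrite lee_fin.
  by rewrite (ltW sS) subr0 /=; case: ifP; rewrite ?normr0.
rewrite EFinM -muleA; apply: lee_wpmul2l => //.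
have mabs : measurable_fun [set: R] (fun s => (`|beta s|%R)%:E).
  by apply/measurable_EFinP; exact: (measurableT_comp (@normr_measurable R setT) mbeta).
rewrite -ge0_integralZl//; first last.
- by move=> s _; case: ifP.
- exact: measurable_window.
apply: ge0_le_integralT => s; first by case: ifP => // _; rewrite mule_ge0 ?wnorm_ge0.
case: ifPn => [/andP[Ss sS]|_]; last by rewrite mule0.
rewrite muleC; apply: lee_wpmul2r => //; apply: HM.
by rewrite (le_trans S0 Ss) (le_trans sS S'T).
Qed.

End weighted_bound.

(** * Continuity of dilations *)

Section dilation.
Local Open Scope ereal_scope.
Context {R : realType}.
Local Notation mu := (@lebesgue_measure R).

Lemma cvge0P (T : Type) (F : set_system T) {FF : Filter F} (u : T -> \bar R) :
  (forall t, 0 <= u t) ->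
  (u @ F --> 0) <-> (forall e : R, (0 < e)%R -> \forall t \near F, u t <= e%:E).
Proof.
move=> u0; split.
- move=> /fine_cvgP[uf /cvgrPdist_le H] e e0.
  near=> t; have ut : u t \is a fin_num by near: t.
  have : (`|0 - fine (u t)| <= e)%R by near: t; exact: H.
  by rewrite sub0r normrN ger0_norm ?fine_ge0// -lee_fin fineK.
- move=> H; apply/fine_cvgP; split.
    near=> t; rewrite ge0_fin_numE//; apply: (@le_lt_trans _ _ (1%R)%:E); last by rewrite ltry.
    by near: t; exact: H.
  apply/cvgrPdist_le => e e0; near=> t.
  have ut : u t <= e%:E by near: t; exact: H.
  rewrite sub0r normrN ger0_norm ?fine_ge0//= -lee_fin fineK// ge0_fin_numE//.
  by rewrite (le_lt_trans ut)// ltry.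
Unshelve. all: by end_near. Qed.

Lemma cvge0_seqP (u : nat -> \bar R) : (forall n, 0 <= u n) ->
  (u @ \oo --> 0) <->
  (forall e : R, (0 < e)%R -> exists n0, forall n, (n0 <= n)%N -> u n <= e%:E).
Proof.
move=> u0; rewrite (cvge0P u0); split => H e e0.
- by have [n0 _ Hn] := H e e0; exists n0 => n; exact: Hn.
- by have [n0 Hn] := H e e0; exists n0 => // n; exact: Hn.
Qed.

Lemma cvg_powR0 (r : R) (a : nat -> R) : (1 <= r)%R -> (forall n, 0 <= a n)%R ->
  (a n @[n --> \oo] --> 0)%R -> ((a n `^ r)%R @[n --> \oo] --> 0)%R.
Proof.
move=> r1 a0 /cvgrPdist_le H; apply/cvgrPdist_le => e e0.
have e1 : (0 < Num.min e 1)%R by rewrite lt_min e0/=.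
near=> n; have : (`|0 - a n| <= Num.min e 1)%R by near: n; exact: H.
rewrite !sub0r !normrN !ger0_norm ?powR_ge0// le_min => /andP[ae a1].
have [->|an0] := eqVneq (a n) 0%R; first by rewrite powR0 ?gt_eqF ?ltW// (lt_le_trans ltr01).
by apply: le_trans _ ae; rewrite ge1r_powR// lt_neqAle eq_sym an0 a0 a1.
Unshelve. all: by end_near. Qed.

Lemma wnorm_dct (r gamma : R) (w : nat -> R -> R) (W : R -> R) : (1 <= r)%R ->
  (forall n, measurable_fun [set: R] (w n)) -> measurable_fun [set: R] W ->
  (forall n x, `|w n x| <= `|W x|)%R -> wnorm r gamma W < +oo ->
  {ae mu, forall x, (w n x @[n --> \oo] --> 0)%R} ->
  wnorm r gamma (w n) @[n --> \oo] --> 0.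
Proof.
move=> r1 mw mW wW Woo w0; have r0 : (0 < r)%R := lt_le_trans ltr01 r1.
pose F n x : \bar R := ((`|x| `^ gamma * `|w n x|) `^ r)%:E.
have mF n : measurable_fun setT (F n) by apply/measurable_EFinP; exact: measurable_wfun.
have F0 : {ae mu, forall x, [set: R] x -> F n x @[n --> \oo] --> cst 0 x}.
  apply: aeS w0 => x wx _.
  suff : ((`|x| `^ gamma * `|w n x|) `^ r @[n --> \oo] --> 0)%R.
    by move=> A; apply/fine_cvgP; split; [exact: nearW|exact: A].
  apply: cvg_powR0 => [//|n|]; first by rewrite mulr_ge0 ?powR_ge0.
  rewrite -(mulr0 (`|x| `^ gamma)%R); apply: cvgMl_tmp.
  by rewrite -(@normr0 _ R); exact: cvg_norm.
have iW : mu.-integrable setT (fun x => ((`|x| `^ gamma * `|W x|) `^ r)%:E).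
  apply: integrable_ge0 => //; first exact: measurable_wfun.
  by under eq_integral do rewrite ger0_norm ?powR_ge0//.
have FW : {ae mu, forall x, forall n, [set: R] x ->
    `|F n x| <= ((`|x| `^ gamma * `|W x|) `^ r)%:E}.
  apply: aeW => x n _; rewrite gee0_abs ?lee_fin ?powR_ge0//.
  apply: (ge0_ler_powR (ltW r0)); rewrite ?nnegrE ?mulr_ge0 ?powR_ge0//.
  by rewrite ler_wpM2l ?powR_ge0.
have [_ _] := @dominated_convergence _ _ _ mu setT measurableT _ _ _ mF (@measurable_cst _ _ _ _ setT (0 : \bar R)) F0 iW FW.
by rewrite integral_cst// mul0e.
Qed.

Definition dil (t : R) (u : R -> R) (x : R) : R := (expR t * u (expR t * x))%R.

Lemma measurable_dil t u : measurable_fun [set: R] u -> measurable_fun [set: R] (dil t u).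
Proof.
move=> mu_; apply: measurable_funM => //; apply: (measurableT_comp mu_).
exact: measurable_funM.
Qed.

Lemma wnorm_dil_le (r gamma t : R) u : (0 <= r)%R -> (0 <= gamma)%R -> (0 <= t)%R ->
  measurable_fun [set: R] u ->
  wnorm r gamma (dil t u) <= (expR t `^ r)%:E * wnorm r gamma u.
Proof.
move=> r0 g0 t0 mu_; have mW := measurable_wfun r gamma mu_.
have e1 : (1 <= expR t)%R by rewrite -expR0 ler_expR.
rewrite /wnorm -[X in _ <= _ * X](@ge0_integral_scale _
   (fun x => ((`|x| `^ gamma * `|u x|) `^ r)%:E) (expR t)); first last.
- by move=> x; rewrite lee_fin powR_ge0.
- by apply/measurable_EFinP.
- exact: expR_gt0.
have mW' : measurable_fun [set: R] (fun x => expR t * (`|expR t * x| `^ gamma * `|u (expR t * x)|) `^ r)%R.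
  apply: measurable_funM => //.
  by apply: (measurableT_comp mW); exact: measurable_funM.
rewrite -ge0_integralZl//.
- apply: ge0_le_integralT => x; first by rewrite lee_fin powR_ge0.
  rewrite -!EFinM lee_fin.
  apply: (@le_trans _ _ ((expR t `^ r) * (`|expR t * x| `^ gamma * `|u (expR t * x)|) `^ r)%R).
    rewrite -powRM ?expR_ge0 ?mulr_ge0 ?powR_ge0//.
    apply: ge0_ler_powR => //; rewrite ?nnegrE ?mulr_ge0 ?powR_ge0 ?expR_ge0//.
    rewrite /dil normrM (ger0_norm (expR_ge0 _)) mulrCA ler_wpM2l ?expR_ge0// ler_wpM2r//.
    apply: ge0_ler_powR => //; rewrite ?nnegrE// normrM (ger0_norm (expR_ge0 _)).
    exact: ler_peMl.
  by rewrite ler_wpM2l ?powR_ge0// ler_peMl ?powR_ge0.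
- by apply/measurable_EFinP; exact: mW'.
Qed.

Definition dil_continuous (r gamma : R) (u : R -> R) : Prop :=
  forall tau e : R, (0 <= tau)%R -> (0 < e)%R ->
  exists2 d : R, (0 < d)%R & forall t, (0 <= t)%R -> (`|t - tau| <= d)%R ->
    wnorm r gamma (dil t u \- dil tau u)%R <= e%:E.

(** Reduction to sequences of times, to which dominated convergence applies. *)
Lemma dil_continuous_seq (r gamma : R) (u : R -> R) :
  (forall (tau : R) (t : nat -> R), (0 <= tau)%R -> (forall n, 0 <= t n)%R ->
    (t n @[n --> \oo] --> tau)%R ->
    wnorm r gamma (dil (t n) u \- dil tau u)%R @[n --> \oo] --> 0) ->
  dil_continuous r gamma u.
Proof.
move=> H tau e tau0 e0; apply: contrapT => K.
have /choice[t Ht] (n : nat) : exists t, [/\ (0 <= t)%R, (`|t - tau| <= n.+1%:R^-1)%R &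
    e%:E < wnorm r gamma (dil t u \- dil tau u)%R].
  apply: contrapT => L; apply: K; exists n.+1%:R^-1%R => // t t0 ttau.
  by rewrite leNgt; apply/negP => M; apply: L; exists t.
have tt : (t n @[n --> \oo] --> tau)%R.
  apply/cvgrPdist_le => d d0; near=> n.
  have [_ + _] := Ht n; rewrite distrC => /le_trans; apply.
  apply: ltW; near: n; exact: (near_infty_natSinv_lt (PosNum d0)).
have := H tau t tau0 (fun n => let: And3 a _ _ := Ht n in a) tt.
rewrite cvge0_seqP; last by move=> n; exact: wnorm_ge0.
move=> /(_ e e0)[n0 /(_ n0 (leqnn _))]; rewrite leNgt.
by have [_ _ ->] := Ht n0.
Unshelve. all: by end_near. Qed.

(** Dilations are uniformly bounded for times up to [tau + 1], so strong continuity passes to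
    limits: [u] is replaced by [v] at both times. *)
Lemma dil_continuous_approx (r gamma : R) (u : R -> R) : (1 <= r)%R -> (0 <= gamma)%R ->
  measurable_fun [set: R] u ->
  (forall e : R, (0 < e)%R -> exists v, [/\ measurable_fun [set: R] v,
     dil_continuous r gamma v & wnorm r gamma (u \- v)%R <= e%:E]) ->
  dil_continuous r gamma u.
Proof.
move=> r1 g0 mu_ H tau e tau0 e0; have r0 : (0 <= r)%R := le_trans ler01 r1.
pose K := (expR (tau + 1) `^ r)%R.
have K0 : (0 <= K)%R by exact: powR_ge0.
have two0 : (0 <= 2 `^ r :> R)%R by exact: powR_ge0.
(* [D - 1] is the factor multiplying [e / D] after two uses of [wnormD]; the added 1 keeps [D]
   positive. *)
pose D : R := (2 `^ r * (K + 2 `^ r * (1 + K)) + 1)%R.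
have D0 : (0 < D)%R by rewrite ltr_pwDr// !(mulr_ge0, addr_ge0).
have e'0 : (0 < e / D)%R by rewrite divr_gt0.
have [v [mv vc uv]] := H _ e'0.
have [d d0 Hd] := vc tau _ tau0 e'0.
exists (Num.min d 1)%R; first by rewrite lt_min d0/=.
move=> t t0; rewrite le_min => /andP[td td1].
have mB t1 t2 : measurable_fun [set: R] (dil t1 v \- dil t2 v)%R.
  by apply: measurable_funB; exact: measurable_dil.
have muv : measurable_fun [set: R] (u \- v)%R by exact: measurable_funB.
have mvu : measurable_fun [set: R] (v \- u)%R by exact: measurable_funB.
have step t' (w : R -> R) : (0 <= t' <= tau + 1)%R -> measurable_fun [set: R] w ->
    wnorm r gamma w <= (e / D)%:E -> wnorm r gamma (dil t' w) <= (K * (e / D))%:E.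
  move=> /andP[t'0 t'1] mw we; apply: le_trans (wnorm_dil_le r0 g0 t'0 mw) _.
  rewrite EFinM; apply: lee_pmul; rewrite ?lee_fin; [exact: powR_ge0|exact: wnorm_ge0| |exact: we].
  by apply: ge0_ler_powR; rewrite ?nnegrE ?expR_ge0// ler_expR.
have vu : wnorm r gamma (v \- u)%R <= (e / D)%:E.
  by apply: le_trans uv; apply: wnorm_le => // x; rewrite /= distrC.
have E : (dil t u \- dil tau u)%R =
   (fun x => dil t (u \- v)%R x + ((dil t v \- dil tau v)%R x + dil tau (v \- u)%R x))%R.
  apply/funext => x; rewrite /dil/=; ring.
rewrite E; apply: le_trans (wnormD _ _ _ _) _ => //; first exact: measurable_dil.
  by apply: measurable_funD => //; exact: measurable_dil.
apply: (@le_trans _ _ ((2 `^ r)%:E * ((K * (e / D))%:E + (2 `^ r)%:E * ((e / D)%:E + (K * (e / D))%:E)))).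
  apply: lee_wpmul2l; first by rewrite lee_fin.
  apply: leeD.
    apply: (step _ _ _ muv uv); rewrite t0/= -lerBlDl; exact: le_trans (ler_norm _) td1.
  apply: le_trans (wnormD _ _ _ _) _ => //; first exact: measurable_dil.
  apply: lee_wpmul2l; first by rewrite lee_fin.
  apply: leeD; first exact: Hd.
  by apply: (step _ _ _ mvu vu); rewrite tau0 lerDl/=.
rewrite -!(EFinD, EFinM) lee_fin.
have -> : (2 `^ r * (K * (e / D) + 2 `^ r * (e / D + K * (e / D))) = (D - 1) * (e / D))%R.
  by rewrite /D; ring.
rewrite mulrBl mul1r mulrCA mulfV ?gt_eqF// mulr1.
by rewrite lerBlDr lerDl ltW.
Qed.


Lemma wnorm_bounded_lty (r gamma A k : R) : (1 <= r)%R -> (0 <= gamma)%R -> (0 <= A)%R ->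
  (0 <= k)%R ->
  wnorm r gamma (fun x => if (`|x| <= A)%R then k else 0%R) < +oo.
Proof.
move=> r1 g0 A0 k0; have r0 : (0 < r)%R := lt_le_trans ltr01 r1.
apply: (@le_lt_trans _ _ (\int[mu]_(x in `[(- A)%R, A]) ((A `^ gamma * k) `^ r)%:E)).
  rewrite [leRHS]integral_mkcond; apply: ge0_le_integralT => x.
    by rewrite lee_fin powR_ge0.
  rewrite patchE; case: ifPn => xA; last first.
    rewrite memNset ?normr0 ?mulr0; last first.
      by move=> /=; rewrite in_itv/= -ler_norml; exact/negP.
    by rewrite powR0// gt_eqF.
  rewrite mem_set; last by move=> /=; rewrite in_itv/= -ler_norml.
  rewrite (ger0_norm k0) lee_fin.
  apply: (ge0_ler_powR (ltW r0)); rewrite ?nnegrE ?mulr_ge0 ?powR_ge0//.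
  rewrite ler_wpM2r//; apply: ge0_ler_powR => //.
rewrite integral_cst//= lebesgue_measure_itv/= lte_fin.
by case: ifPn => _; rewrite -?EFinB -?EFinM ?mule0 ltry.
Qed.

Lemma cvg_seqn_le (t : nat -> R) (tau : R) : (t n @[n --> \oo] --> tau)%R ->
  exists T : R, forall n, (t n <= T)%R.
Proof.
move=> tt; have /cvg_seq_bounded[M [Mr HM]] : cvg (t n @[n --> \oo]) by apply/cvg_ex; exists tau.
exists (M + 1)%R => n; apply: le_trans (ler_norm _) _; apply: HM => //.
by rewrite ltrDl.
Qed.

(** Dominated convergence: dilations with [t >= 0] shrink the support into [[-A, A]], which gives a
    bounded compactly supported majorant, and pointwise convergence can fail only at the two points
    where [|e^tau x| = A]. *)
Lemma dil_continuous_compact_support (r gamma A k : R) (h : R -> R) : (1 <= r)%R ->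
  (0 <= gamma)%R -> (0 <= A)%R -> continuous h -> (forall x, `|h x| <= k)%R ->
  dil_continuous r gamma (fun x => if (`|x| <= A)%R then h x else 0%R).
Proof.
move=> r1 g0 A0 ch hk; have r0 : (0 <= r)%R := le_trans ler01 r1.
have k0 : (0 <= k)%R := le_trans (normr_ge0 _) (hk 0%R).
set u := fun x : R => _.
have mu_ : measurable_fun [set: R] u.
  apply: measurable_fun_ifT => //; first exact: measurable_fun_ler.
  exact: continuous_measurable_fun.
apply: dil_continuous_seq => tau t tau0 t0 tt.
have [T HT] := cvg_seqn_le tt.
pose W (x : R) : R := if (`|x| <= A)%R then (expR T * k + expR tau * k)%R else 0%R.
have mW : measurable_fun [set: R] W.
  by apply: measurable_fun_ifT => //; exact: measurable_fun_ler.
have W0 : (0 <= expR T * k + expR tau * k)%R by rewrite addr_ge0 ?mulr_ge0 ?expR_ge0.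
apply: (wnorm_dct r1 (W := W)) => //.
- by move=> n; apply: measurable_funB; exact: measurable_dil.
- move=> n x; rewrite /= /W /dil /u.
  have out s : (0 <= s)%R -> (A < `|x|)%R -> (`|expR s * x| <= A)%R = false.
    move=> s0 Ax; apply/negbTE; rewrite -ltNge (lt_le_trans Ax)// normrM ger0_norm ?expR_ge0//.
    by rewrite ler_peMl// -expR0 ler_expR.
  have [xA|Ax] := leP `|x|%R A; last by rewrite !out// !mulr0 subrr.
  rewrite [leRHS]ger0_norm//; apply: le_trans (ler_normB _ _) _.
  have hif (b : bool) y : (`|if b then h y else 0| <= k)%R by case: b => //; rewrite normr0.
  by apply: lerD; rewrite normrM ger0_norm ?expR_ge0// ler_pM ?expR_ge0// ler_expR.
- exact: wnorm_bounded_lty.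
- pose N := [set expR (- tau) * A; - (expR (- tau) * A)]%R.
  have N0 : mu N = 0 by apply: countable_lebesgue_measure0; apply: finite_set_countable; exact: finite_set2.
  exists N; split => // [|x /= Hx]; first by apply: measurableU.
  apply: contrapT => NN; apply: Hx.
  have yA : (`|expR tau * x|)%R != A.
    apply/eqP => H; apply: NN; move/eqP: H; rewrite eqr_norml => /andP[/orP[]/eqP H _]; [left|right];
      by rewrite -?mulrN -H mulrA -expRD addNr expR0 mul1r.
  have ey : (expR (t n) @[n --> \oo] --> expR tau)%R.
    by apply: continuous_cvg tt; exact: continuous_expR.
  have cu : {for (expR tau * x)%R, continuous u}.
    have nc : (`|z| @[z --> (expR tau * x)%R] --> `|expR tau * x|)%R.
      by apply: cvg_norm.
    have loc (g : R -> R) : continuous g -> (\forall z \near (expR tau * x)%R, g z = u z) ->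
        {for (expR tau * x)%R, continuous u}.
      move=> cg gu; have guy : g (expR tau * x)%R = u (expR tau * x)%R by exact: nbhs_singleton gu.
      by apply: cvg_trans (near_eq_cvg gu) _; rewrite -guy; exact: cg.
    have [H|H|H] := ltgtP `|expR tau * x|%R A; last by rewrite H eqxx in yA.
      apply: (loc h) => //; near=> z; rewrite /u ifT//; apply: ltW.
      by near: z; exact: (cvgr_lt _ nc).
    apply: (loc (cst 0%R)); first by move=> ?; exact: cvg_cst.
    near=> z; rewrite /u ifF//; apply: negbTE; rewrite -ltNge.
    by near: z; exact: (cvgr_gt _ nc).
  have C : (expR (t n) * u (expR (t n) * x) @[n --> \oo] --> expR tau * u (expR tau * x))%R.
    by apply: cvgM => //; apply: continuous_cvg => //; exact: cvgMr_tmp.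
  rewrite /dil /= -(subrr (expR tau * u (expR tau * x))%R).
  by apply: cvgB => //; exact: cvg_cst.
Unshelve. all: by end_near. Qed.

(** On [[0, K]] the convex power lies below its chord. For bounded functions this turns smallness in
    [L^1] into smallness in [L^r]. *)
Lemma powR_chord (r K a : R) : (1 <= r)%R -> (0 < K)%R -> (0 <= a <= K)%R ->
  (a `^ r <= K `^ r / K * a)%R.
Proof.
move=> r1 K0 /andP[]; rewrite le_eqVlt => /predU1P[<-|a0] aK.
  by rewrite powR0 ?gt_eqF ?(lt_le_trans ltr01)// mulr0.
rewrite mulrAC -mulrA [leRHS]mulrC -{1}(divfK (lt0r_neq0 K0) a).
by apply: ge1r_powRZ; rewrite ?(ltW K0)// divr_gt0//= ler_pdivrMr ?mul1r.
Qed.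

Definition clip (k y : R) : R := Num.max (- k)%R (Num.min k y).

Lemma normr_clip k y : (0 <= k)%R -> (`|clip k y| <= k)%R.
Proof.
move=> k0; rewrite ler_norml /clip le_max lexx/= ge_max ge_min lexx/= andbT.
by rewrite (le_trans _ k0)// oppr_le0.
Qed.

Lemma normrB_clip k z y : (`|z| <= k)%R -> (`|z - clip k y| <= `|z - y|)%R.
Proof.
rewrite ler_norml => /andP[k1 k2]; rewrite /clip.
case: (leP k y) => ky; case: (leP (- k)%R _) => yk.
- have zy := le_trans k2 ky.
  rewrite [leLHS]ler0_norm ?subr_le0// [leRHS]ler0_norm ?subr_le0//; lra.
- lra.
- by [].
- rewrite [leLHS]ger0_norm ?subr_ge0// [leRHS]ger0_norm ?subr_ge0; lra.
Qed.

Lemma continuous_clip k (g : R -> R) : continuous g -> continuous (fun x => clip k (g x)).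
Proof.
move=> cg x; apply: (@continuous_max R R (cst (- k)%R) (cst k \min g)); first exact: cst_continuous.
by apply: (@continuous_min R R); [exact: cst_continuous|exact: cg].
Qed.

(** Two approximations: first by truncation of both support and height, then on the bounded support
    by a continuous function close in [L^1]. Clipping the latter at height [k] brings it no farther
    from the target and lets [powR_chord] convert the [L^1] estimate. *)
Lemma dil_continuousP (r gamma : R) (u : R -> R) : (1 <= r)%R -> (0 <= gamma)%R ->
  measurable_fun [set: R] u -> wnorm r gamma u < +oo -> dil_continuous r gamma u.
Proof.
move=> r1 g0 mu_ uoo; have r0 : (0 < r)%R := lt_le_trans ltr01 r1.
apply: dil_continuous_approx => // e e0.
pose tr (n : nat) (x : R) : R := if (`|x| <= n%:R)%R && (`|u x| <= n%:R)%R then u x else 0%R.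
have mtr n : measurable_fun [set: R] (tr n).
  apply: measurable_fun_ifT => //; apply: measurable_and; apply: measurable_fun_ler => //.
  by apply: measurableT_comp.
have truc : wnorm r gamma (u \- tr n)%R @[n --> \oo] --> 0.
  apply: (wnorm_dct r1 (W := u)) => //.
  - by move=> n; exact: measurable_funB.
  - by move=> n x; rewrite /= /tr; case: ifP; rewrite ?subrr ?normr0// subr0.
  - apply: aeW => x /=; apply: cvg_near_cst; near=> n.
    rewrite /tr ifT ?subrr//; apply/andP; split; near: n; exact: nbhs_infty_ger.
move: truc; rewrite cvge0_seqP; last by move=> n; exact: wnorm_ge0.
move=> /(_ e e0)[n /(_ n (leqnn _)) un].
exists (tr n); split => //.
apply: dil_continuous_approx => // d d0.
pose k : R := n%:R; have k0 : (0 <= k)%R by rewrite ler0n.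
(* [K] exceeds [|tr n - h| <= 2 k], with 1 added for positivity. The constant [c] below is the
   largest weight on [[-k, k]] times the slope of the chord over [[0, K]]. *)
pose K : R := (k + k + 1)%R; have K0 : (0 < K)%R by rewrite ltr_pwDr// addr_ge0.
pose c : R := ((k `^ gamma) `^ r * (K `^ r / K))%R.
have c0 : (0 <= c)%R by rewrite !mulr_ge0 ?powR_ge0// invr_ge0 ltW.
have c1 : (0 < c + 1)%R by rewrite ltr_pwDr.
pose E : set R := [set` `[(- k)%R, k]].
have mE : measurable E by exact: measurable_itv.
have Eoo : mu E < +oo.
  by rewrite /E lebesgue_measure_itv/= lte_fin; case: ifPn => _; rewrite -?EFinB ltry.
have trk x : (`|tr n x| <= k)%R by rewrite /tr; case: ifPn => [/andP[]//|_]; rewrite normr0.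
have itr : mu.-integrable E (EFin \o tr n).
  apply: measurable_bounded_integrable => //; first exact: measurable_funS (mtr n).
  by exists k; split=> [|M kM x _ /=]; [exact: num_real|exact: le_trans (trk x) (ltW kM)].
have [g [cg ig]] := approximation_continuous_integrable mE Eoo itr.
rewrite cvge0_seqP; last by move=> m; exact: integral_ge0.
have d10 : (0 < d / (c + 1))%R by rewrite divr_gt0.
move=> /(_ _ d10)[m /(_ m (leqnn _)) gm].
pose h x : R := clip k (g m x).
have ch : continuous h by exact: continuous_clip.
have hk x : (`|h x| <= k)%R by exact: normr_clip.
have hg x : (`|tr n x - h x| <= `|tr n x - g m x|)%R by exact: normrB_clip.
pose v (x : R) : R := if (`|x| <= k)%R then h x else 0%R.
have mv : measurable_fun [set: R] v.
  apply: measurable_fun_ifT => //; first exact: measurable_fun_ler.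
  exact: continuous_measurable_fun.
exists v; split => //; first exact: dil_continuous_compact_support.
apply: (@le_trans _ _ (\int[mu]_(x in E) (c%:E * `|(tr n x - g m x)%:E|))).
  rewrite [leRHS]integral_mkcond; apply: ge0_le_integralT => x; first by rewrite lee_fin powR_ge0.
  rewrite patchE; have [xk|kx] := leP `|x|%R k; last first.
    rewrite memNset; last by rewrite /E/= in_itv/= -ler_norml; apply/negP; rewrite -ltNge.
    have kx' : (`|x| <= k)%R = false by apply/negbTE; rewrite -ltNge.
    by rewrite /= /v /tr -/k kx'/= subrr normr0 mulr0 powR0// gt_eqF.
  rewrite mem_set; last by rewrite /E/= in_itv/= -ler_norml.
  rewrite abse_EFin -EFinM lee_fin powRM ?powR_ge0// /c -mulrA.
  apply: ler_pM; [exact: powR_ge0|exact: powR_ge0| |].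
    by apply: (ge0_ler_powR (ltW r0)); rewrite ?nnegrE ?powR_ge0//; exact: ge0_ler_powR.
  rewrite /= /v ifT//.
  have aK : (`|tr n x - h x| <= K)%R.
    by rewrite (le_trans (ler_normB _ _))// /K (le_trans (lerD (trk x) (hk x)))// lerDl.
  apply: (le_trans (powR_chord r1 K0 _)); first by rewrite normr_ge0.
  by rewrite ler_wpM2l ?mulr_ge0 ?powR_ge0 ?invr_ge0// ltW.
rewrite ge0_integralZl//.
  apply: (@le_trans _ _ (c%:E * (d / (c + 1))%:E)); first exact: lee_wpmul2l.
  by rewrite -EFinM lee_fin mulrCA ger_pMr// ler_pdivrMr// mul1r lerDl.
apply/measurable_EFinP; apply: measurableT_comp => //; apply: measurable_funB; first exact: measurable_funS (mtr n).
by have /integrableP[/measurable_EFinP] := ig m.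
Unshelve. all: by end_near. Qed.

End dilation.

(** * Comparison of the norms on the half-line with those on the whole line *)

Section norms.
Local Open Scope ereal_scope.
Context {R : realType}.
Local Notation mu := (@lebesgue_measure R).

Lemma mem_itv1y (x : R) : (x \in [set` `]1%R, +oo[]) = (1 < x)%R.
Proof. by apply/idP/idP; rewrite inE/= in_itv/= andbT. Qed.

(** Makes the [L^1] continuity statements the case [r = 1], [gamma = 0] of the weighted ones. *)
Lemma wnorm10 (u : R -> R) : wnorm 1 0 u = L1norm u.
Proof.
by apply: eq_integral => x _; rewrite powRr0 mul1r powRr1.
Qed.

Lemma norm1_le (u : R -> R) : norm1 u <= L1norm u.
Proof.
rewrite /norm1 integral_mkcond; apply: ge0_le_integralT => x; rewrite patchE; case: ifPn => // _.
by rewrite lee_fin.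
Qed.

Lemma normLp_le (r gamma : R) (u : R -> R) : (0 < r)%R ->
  normLp r gamma u <= wnorm r gamma u `^ r^-1.
Proof.
move=> r0; apply: gt0_ler_poweR.
- by rewrite invr_ge0 ltW.
- by rewrite in_itv/= leey andbT; apply: integral_ge0 => x _; rewrite lee_fin powR_ge0.
- by rewrite in_itv/= leey andbT wnorm_ge0.
- rewrite integral_mkcond; apply: ge0_le_integralT => x; rewrite patchE; case: ifPn.
  + by rewrite lee_fin powR_ge0.
  + by [].
  + by rewrite mem_itv1y => /(lt_trans ltr01)/ltW/ger0_norm ->.
  + by rewrite lee_fin powR_ge0.
Qed.

Lemma norm1_dil (t : R) (u : R -> R) : measurable_fun [set: R] u ->
  norm1 (dil t u) = L1norm (cutoff (expR t) u).
Proof.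
move=> mu_; have mc := measurable_cutoff (expR t) mu_.
rewrite /L1norm -(@ge0_integral_scale _ (fun x => (`|cutoff (expR t) u x|%R)%:E) (expR t)); first last.
- by move=> x; rewrite lee_fin.
- by apply/measurable_EFinP; apply: measurableT_comp.
- exact: expR_gt0.
rewrite /norm1 integral_mkcond; apply: eq_integral => x _; rewrite patchE /cutoff.
rewrite -[X in (X < _)%R]mulr1 ltr_pM2l ?expR_gt0//.
rewrite mem_itv1y; case: ifPn => _.
  by rewrite normrM ger0_norm ?expR_ge0// EFinM.
by rewrite normr0 mule0.
Qed.

Lemma inC0_of_eps (inX : (R -> R) -> Prop) (nrm : (R -> R) -> \bar R) (eta : R -> R -> R) :
  (forall w, 0 <= nrm w) -> (forall tau, (0 <= tau)%R -> inX (eta tau)) ->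
  (forall tau e : R, (0 <= tau)%R -> (0 < e)%R -> exists2 d : R, (0 < d)%R &
    forall t, (0 <= t)%R -> (`|t - tau| <= d)%R -> nrm (eta t \- eta tau)%R <= e%:E) ->
  inC0 inX nrm eta.
Proof.
move=> n0 eX H; split => // tau tau0; apply/cvge0P => // e e0.
have [d d0 Hd] := H tau e tau0 e0.
apply/nbhs_ballP; exists d => //= t; rewrite /ball/= distrC => td.
by rewrite in_itv/= andbT => t0; apply: Hd => //; exact: ltW.
Qed.

Lemma compact_integrable (K D : set R) (w : R -> R) : compact K -> K `<=` D ->
  measurable D -> mu.-integrable D (EFin \o w) -> mu.-integrable K (EFin \o w).
Proof.
move=> cK KD mD; apply: integrableS => //.
exact: compact_measurable.
Qed.

End norms.

(** * Return to the original variables: bounds and continuity in time *)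

Section mild_solution.
Context {R : realType}.
Local Notation mu := (@lebesgue_measure R).
Variables (N : nat) (p : nat -> R) (f0 : R -> R).
Hypothesis p0 : forall j, (1 <= j <= N)%N -> 0 <= p j.
Hypothesis p1 : \sum_(1 <= j < N.+1) p j = 1.
Hypothesis mf0 : measurable_fun [set: R] f0.
Hypothesis f00 : forall x, x <= 1 -> f0 x = 0.
Hypothesis f01 : (L1norm f0 <= 1)%E.
Local Notation f := (profile N p f0).
Local Notation beta := (trace N p f0).

Definition mild (tau : R) : R -> R := dil tau (f tau).

Local Open Scope ereal_scope.

Lemma measurable_mild tau : measurable_fun [set: R] (mild tau).
Proof. by apply: measurable_dil; exact: measurable_profile_section. Qed.

Lemma norm1_mild tau : (0 <= tau)%R -> norm1 (mild tau) <= 1.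
Proof.
move=> t0; rewrite norm1_dil; first exact: L1norm_cutoff_profile.
exact: measurable_profile_section.
Qed.

Lemma integrable_mild tau : (0 <= tau)%R -> mu.-integrable setT (EFin \o mild tau).
Proof.
move=> t0; apply: integrable_ge0 => //; first exact: measurable_mild.
have -> : \int[mu]_x (`|mild tau x|%R)%:E = wnorm 1 0 (mild tau) by rewrite wnorm10.
apply: le_lt_trans (wnorm_dil_le _ _ t0 _) _ => //; first exact: measurable_profile_section.
rewrite wnorm10; have := L1norm_profile_lty p0 p1 mf0 f00 f01 tau.
rewrite -ge0_fin_numE ?L1norm_ge0// => /fineK <-.
by rewrite -EFinM ltry.
Qed.

(** The increment is [dil t (f t - f tau) + (dil t - dil tau) (f tau)]. The first term is small
    because the trace has little mass on short windows, the second by strong continuity of dilations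
    at the fixed function [f tau]. *)
Lemma mild_continuous (r gamma : R) : (1 <= r)%R -> (0 <= gamma)%R ->
  wnorm r gamma f0 < +oo ->
  forall tau e : R, (0 <= tau)%R -> (0 < e)%R -> exists2 d : R, (0 < d)%R &
    forall t, (0 <= t)%R -> (`|t - tau| <= d)%R ->
    wnorm r gamma (mild t \- mild tau)%R <= e%:E.
Proof.
move=> r1 g0 f0oo tau e tau0 e0; have r0 : (0 <= r)%R := le_trans ler01 r1.
pose T : R := (tau + 1)%R.
have [K K0 HK] := wnorm_profileB_le p0 p1 mf0 f00 f01 r1 g0 T f0oo.
have [W W0 HW] := trace_integrable p0 p1 mf0 f00 f01 T.
have [M M0 HM] := wnorm_profile_le p0 p1 mf0 f00 f01 r1 g0 T f0oo.
have mf t : measurable_fun [set: R] (f t) by exact: measurable_profile_section.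
pose b s := if (0 <= s <= T)%R then (`|beta s|%R)%:E else 0.
have mb : measurable_fun [set: R] b.
  apply: measurable_window; apply/measurable_EFinP; apply: measurableT_comp => //.
  exact: measurable_profile_trace.
have b0 s : 0 <= b s by rewrite /b; case: ifP => // _; rewrite lee_fin.
have boo : \int[mu]_s b s < +oo by exact: le_lt_trans HW (ltry _).
pose L : R := (expR T `^ r * K)%R; have L0 : (0 <= L)%R by rewrite mulr_ge0 ?powR_ge0.
pose D : R := (2 `^ r * (L + 1) + 1)%R.
have D0 : (0 < D)%R by rewrite ltr_pwDr// !(mulr_ge0, powR_ge0, addr_ge0).
have eD : (0 < e / D)%R by rewrite divr_gt0.
have [d1 d10 Hd1] := ge0_integral_small_window mb b0 boo eD.
have dc : dil_continuous r gamma (f tau).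
  apply: (dil_continuousP r1 g0 (mf tau)); apply: le_lt_trans (HM tau _) (ltry _).
  by rewrite tau0 lerDl/=.
have [d2 d20 Hd2] := dc tau _ tau0 eD.
exists (Num.min (Num.min d1 d2) 1)%R; first by rewrite !lt_min d10 d20/=.
move=> t t0; rewrite !le_min => /andP[/andP[td1 td2] td].
have tT : (t <= T)%R by rewrite -lerBlDl; exact: le_trans (ler_norm _) td.
have tauT : (tau <= T)%R by rewrite lerDl.
have win S S' : (0 <= S)%R -> (S' <= T)%R -> (S' <= S + d1)%R ->
    \int[mu]_s (if (S <= s <= S')%R then (`|beta s|%R)%:E else 0) <= (e / D)%:E.
  move=> S0 S'T SS'; rewrite (le_trans _ (Hd1 S S' SS'))//; apply: ge0_le_integralT => s.
    by case: ifP => // _; rewrite lee_fin.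
  case: ifP => // /andP[Ss sS']; rewrite /b ifT//.
  by rewrite (le_trans S0 Ss) (le_trans sS' S'T).
have fB : wnorm r gamma (f t \- f tau)%R <= (K * (e / D))%:E.
  have [tt|tt] := leP tau t.
    apply: le_trans (HK tau t tau0 tt tT) _; rewrite EFinM; apply: lee_wpmul2l; rewrite ?lee_fin//.
    by apply: win => //; rewrite -lerBlDl; exact: le_trans (ler_norm _) td1.
  apply: (@le_trans _ _ (wnorm r gamma (f tau \- f t)%R)).
    by apply: wnorm_le => // x; rewrite /= distrC.
  apply: le_trans (HK t tau t0 (ltW tt) tauT) _; rewrite EFinM; apply: lee_wpmul2l; rewrite ?lee_fin//.
  apply: win => //; rewrite -lerBlDl; rewrite distrC in td1; exact: le_trans (ler_norm _) td1.
have mfB : measurable_fun [set: R] (f t \- f tau)%R by exact: measurable_funB.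
have E : (mild t \- mild tau)%R =
    (fun x => dil t (f t \- f tau)%R x + (dil t (f tau) \- dil tau (f tau))%R x)%R.
  by apply/funext => x; rewrite /mild /dil/= mulrBr addrA subrK.
rewrite E; apply: le_trans (wnormD _ _ _ _) _ => //.
- exact: measurable_dil.
- by apply: measurable_funB; exact: measurable_dil.
apply: (@le_trans _ _ ((2 `^ r)%:E * ((L * (e / D))%:E + (e / D)%:E))).
  apply: lee_wpmul2l; first by rewrite lee_fin powR_ge0.
  apply: leeD; last exact: Hd2.
  apply: le_trans (wnorm_dil_le _ _ t0 _) _ => //.
  rewrite /L -mulrA EFinM; apply: lee_pmul.
  - by rewrite lee_fin powR_ge0.
  - exact: wnorm_ge0.
  - by rewrite lee_fin; apply: ge0_ler_powR; rewrite ?nnegrE ?expR_ge0// ler_expR.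
  - exact: fB.
rewrite -!(EFinD, EFinM) lee_fin.
have -> : (2 `^ r * (L * (e / D) + e / D) = (D - 1) * (e / D))%R by rewrite /D; ring.
by rewrite mulrBl mul1r mulrCA mulfV ?gt_eqF// mulr1 lerBlDr lerDl ltW.
Qed.

Lemma mild_C0_L1 : inC0 (@inL1 R) (@norm1 R) mild.
Proof.
apply: inC0_of_eps.
- by move=> w; apply: integral_ge0 => x _; rewrite lee_fin.
- move=> tau t0; rewrite /inL1; apply: integrableS (integrable_mild t0) => //.
- move=> tau e tau0 e0.
  have [|d d0 Hd] := mild_continuous (lexx 1%R) (lexx 0%R) _ tau0 e0.
    by rewrite wnorm10; exact: le_lt_trans f01 (ltry _).
  exists d => // t t0 td; apply: le_trans (norm1_le _) _; rewrite -wnorm10; exact: Hd.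
Qed.

Lemma mild_C0_Lp (r gamma : R) : (1 <= r)%R -> (0 <= gamma)%R ->
  wnorm r gamma f0 < +oo -> inC0 (inLp r gamma) (normLp r gamma) mild.
Proof.
move=> r1 g0 f0oo; have r0 : (0 < r)%R := lt_le_trans ltr01 r1.
have ri0 : (r^-1 != 0)%R by rewrite invr_neq0// gt_eqF.
apply: inC0_of_eps.
- by move=> w; exact: poweR_ge0.
- move=> tau t0; split.
    move=> K cK _; apply: compact_integrable cK _ _ (integrable_mild t0) => //.
  apply: le_lt_trans (normLp_le _ _ r0) _.
  have [M M0 HM] := wnorm_profile_le p0 p1 mf0 f00 f01 r1 g0 tau f0oo.
  have : wnorm r gamma (mild tau) < +oo.
    apply: le_lt_trans (wnorm_dil_le (ltW r0) _ t0 _) _ => //; first exact: measurable_profile_section.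
    apply: le_lt_trans (lee_wpmul2l _ (HM tau _)) _; rewrite ?lee_fin ?powR_ge0 ?t0 ?lexx//.
    by rewrite -EFinM ltry.
  by rewrite -ge0_fin_numE ?wnorm_ge0// => /fineK <-; rewrite poweR_EFin ltry.
- move=> tau e tau0 e0.
  have er0 : (0 < e `^ r)%R by exact: powR_gt0.
  have [d d0 Hd] := mild_continuous r1 g0 f0oo tau0 er0.
  exists d => // t t0 td; apply: le_trans (normLp_le _ _ r0) _.
  have -> : e%:E = (e `^ r)%:E `^ r^-1.
    by rewrite poweR_EFin -powRrM mulfV ?gt_eqF// powRr1// ltW.
  apply: gt0_ler_poweR; rewrite ?invr_ge0 ?(ltW r0)// ?in_itv/= ?leey ?andbT ?wnorm_ge0//.
    by rewrite lee_fin ltW.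
  exact: Hd.
Qed.

End mild_solution.

(** * Bochner integrals *)

Section step_functions.
Context {R : realType}.
Local Notation mu := (@lebesgue_measure R).

Lemma measurable_truncn (g : R -> R) : measurable_fun [set: R] g ->
  measurable_fun [set: R] (fun t => (Num.truncn (g t))%:R : R).
Proof.
apply: (@measurableT_comp _ _ _ _ _ _ (fun x : R => (Num.truncn x)%:R : R)).
by apply: nondecreasing_measurable => // x y xy; rewrite ler_nat le_truncn.
Qed.

Lemma step_cells (A : set R) (m : nat) (d : R -> nat) (v : nat -> R -> R) (t y : R) :
  (A t -> (d t < m)%N) ->
  step m (fun i => A `&` [set s | d s = i]) v t y = \1_A t * v (d t) y.
Proof.
move=> dm; rewrite /step; have [At|nAt] := pselect (A t); last first.
  rewrite indicE memNset// mul0r big1// => i _.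
  by rewrite indicE memNset ?mul0r// => -[].
rewrite (indicE _ A) mem_set// mul1r (bigD1 (Ordinal (dm At)))//= big1.
  by rewrite indicE mem_set// mul1r addr0.
move=> i /eqP ni; rewrite indicE memNset ?mul0r// => -[_ di]; apply: ni.
exact/val_inj.
Qed.

Lemma Rintegral_step (m : nat) (E : nat -> set R) (v : nat -> R -> R) (y : R) :
  (forall i, (i < m)%N -> measurable (E i) /\ (mu (E i) < +oo)%E) ->
  mu.-integrable setT (fun t => (step m E v t y)%:E) /\
  \int[mu]_t step m E v t y = step_integral m E v y.
Proof.
move=> mE.
have iI (B : set R) : measurable B -> (mu B < +oo)%E -> mu.-integrable setT (fun t => (\1_B t)%:E).
  move=> mB Boo; apply: integrable_ge0 => //.
  by under eq_integral do rewrite ger0_norm//; rewrite integral_indic// setIT.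
have iE (i : 'I_m) : mu.-integrable setT (fun t => (\1_(E i) t * v i y)%:E).
  have [mEi Ei] := mE i (ltn_ord i).
  under eq_fun do rewrite EFinM.
  by apply: integrableZr => //; exact: iI.
have -> : (fun t => (step m E v t y)%:E) = (fun t => \sum_(i < m) (\1_(E i) t * v i y)%:E)%E.
  by apply/funext => t; rewrite sumEFin.
split; first exact: integrable_sum.
rewrite /Rintegral.
transitivity (fine (\sum_(i < m) \int[mu]_t (\1_(E i) t * v i y)%:E)%E).
  by rewrite -integral_sum//; congr fine; apply: eq_integral => t _; rewrite sumEFin.
transitivity (fine (\sum_(i < m) (fine (mu (E i)) * v i y)%:E)%E); last by rewrite sumEFin.
congr fine; apply: eq_bigr => i _; have [mEi Ei] := mE i (ltn_ord i).
under eq_integral do rewrite EFinM.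
rewrite integralZr//; last exact: iI.
by rewrite integral_indic// setIT EFinM fineK// ge0_fin_numE.
Qed.

End step_functions.

Section bochner_product.
Local Open Scope ereal_scope.
Context {R : realType}.
Local Notation mu := (@lebesgue_measure R).

Lemma L1normD (u v : R -> R) : measurable_fun [set: R] u -> measurable_fun [set: R] v ->
  L1norm (u \+ v)%R <= L1norm u + L1norm v.
Proof.
move=> mu_ mv; rewrite /L1norm -ge0_integralD//.
- by apply: ge0_le_integralT => x; rewrite -?EFinD lee_fin//; exact: ler_normD.
- by apply/measurable_EFinP; apply: measurableT_comp.
- by apply/measurable_EFinP; apply: measurableT_comp.
Qed.

(** For jointly measurable [F] the pointwise integral is a Bochner integral: by Tonelli its distance
    to the integral of a step function is at most the integral of the distances. The subtraction
    under the integral is legitimate for almost every [y], where [F] is integrable in time. *)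
Lemma bochner_of_approx (tau : R) (F : R -> R -> R) (m : nat -> nat) (E : nat -> nat -> set R)
    (v : nat -> nat -> R -> R) :
  (0 <= tau)%R -> measurable_fun setT (fun q : R * R => F q.1 q.2) ->
  (forall t y, ~ (0 <= t <= tau)%R -> F t y = 0%R) ->
  \int[mu]_t L1norm (F t) < +oo ->
  (forall t, (0 <= t <= tau)%R -> L1norm (F t) < +oo) ->
  (forall n i, (i < m n)%N -> [/\ measurable (E n i), E n i `<=` [set` `[0%R, tau]],
     measurable_fun [set: R] (v n i) & L1norm (v n i) < +oo]) ->
  (forall t, (0 <= t <= tau)%R ->
    L1norm (F t \- step (m n) (E n) (v n) t)%R @[n --> \oo] --> 0) ->
  \int[mu]_t L1norm (F t \- step (m n) (E n) (v n) t)%R @[n --> \oo] --> 0 ->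
  bochner [set` `[0%R, tau]] F (fun y => \int[mu]_t F t y)%R.
Proof.
move=> tau0 mF F0 Foo Ft H cv cvI; pose A : set R := [set` `[0%R, tau]].
have mA : measurable A by exact: measurable_itv.
have Aoo : mu A < +oo.
  by rewrite /A lebesgue_measure_itv/= lte_fin; case: ifPn => _; rewrite -?EFinB ltry.
have mEA n i : (i < m n)%N -> measurable (E n i) /\ mu (E n i) < +oo.
  move=> im; have [mEi EA _ _] := H n i im; split => //.
  by apply: le_lt_trans Aoo; rewrite le_measure// inE.
have mg : measurable_fun [set: R] (fun y => \int[mu]_t F t y)%R.
  apply: (measurable_Rintegral (f := fun y t => F t y)).
  exact: (measurableT_comp mF (g := fun q : R * R => (q.2, q.1)) (measurable_fun_pair _ _)).
have mFt t : measurable_fun [set: R] (F t).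
  exact: (measurableT_comp mF (g := fun x => (t, x)) (measurable_fun_pair _ _)).
have mFy y : measurable_fun [set: R] (F ^~ y).
  exact: (measurableT_comp mF (g := fun x => (x, y)) (measurable_fun_pair _ _)).
have mst n : measurable_fun setT (fun q : R * R => step (m n) (E n) (v n) q.1 q.2).
  apply: measurable_sum => i; have [mEi _ mvi _] := H n i (ltn_ord i).
  apply: measurable_funM.
    by apply: (measurableT_comp (measurable_indic mEi)); exact: measurable_fst.
  by apply: (measurableT_comp mvi); exact: measurable_snd.
have mst1 n t : measurable_fun [set: R] (step (m n) (E n) (v n) t).
  exact: (measurableT_comp (mst n) (g := fun x => (t, x)) (measurable_fun_pair _ _)).
have m2 : measurable_fun setT (fun q : R * R => (`|F q.1 q.2|%R)%:E).
  by apply/measurable_EFinP; apply: measurableT_comp.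
have m2s : measurable_fun setT (fun q : R * R => (`|F q.2 q.1|%R)%:E).
  exact: (measurableT_comp m2 (g := fun q : R * R => (q.2, q.1)) (measurable_fun_pair _ _)).
have aeF : {ae mu, forall y, \int[mu]_t (`|F t y|%R)%:E < +oo}.
  have I0 y : 0 <= \int[mu]_t (`|F t y|%R)%:E by apply: integral_ge0 => t _; rewrite lee_fin.
  have ih : mu.-integrable setT (fun y => \int[mu]_t (`|F t y|%R)%:E).
    apply/integrableP; split; first exact: (measurable_ge0_integral (f := fun y t => (`|F t y|%R)%:E) m2s).
    under eq_integral do rewrite gee0_abs//.
    by rewrite (tonelli (f := fun y t => (`|F t y|%R)%:E)).
  have := @integrable_ae _ _ _ mu setT measurableT _ ih.
  by apply: aeS => y /(_ I); rewrite ge0_fin_numE.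
have gB n : norm1 ((fun y => \int[mu]_t F t y)%R \- step_integral (m n) (E n) (v n))%R <=
    \int[mu]_t L1norm (F t \- step (m n) (E n) (v n) t)%R.
  apply: le_trans (norm1_le _) _; rewrite /L1norm (tonelli
      (f := fun t y => (`|(F t \- step (m n) (E n) (v n) t)%R y|%R)%:E)); first last.
  - by move=> t y; rewrite lee_fin.
  - by apply/measurable_EFinP; apply: measurableT_comp => //; exact: measurable_funB.
  apply: ae_ge0_le_integral => //.
  - apply/measurable_EFinP; apply: measurableT_comp => //; apply: measurable_funB => //.
    apply: measurable_sum => i; have [_ _ mvi _] := H n i (ltn_ord i).
    exact: measurable_funM.
  - by move=> y _; exact: integral_ge0.
  - apply: (measurable_ge0_integral (f := fun y t => (`|F t y - step (m n) (E n) (v n) t y|%R)%:E)) => [|t x]; last by rewrite lee_fin.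
    apply/measurable_EFinP; apply: measurableT_comp => //; apply: measurable_funB.
      exact: (measurableT_comp mF (g := fun q : R * R => (q.2, q.1)) (measurable_fun_pair _ _)).
    exact: (measurableT_comp (mst n) (g := fun q : R * R => (q.2, q.1)) (measurable_fun_pair _ _)).
  - apply: aeS aeF => y Fy _; have [iS sE] := Rintegral_step (v n) y (mEA n).
    have iF : mu.-integrable setT (fun t => (F t y)%:E) by exact: integrable_ge0.
    rewrite /= -sE -RintegralB//; apply: normr_Rintegral_le => //.
    apply: measurable_funB => //.
    exact: (measurableT_comp (mst n) (g := fun x => (x, y)) (measurable_fun_pair _ _)).
have sq (u w : nat -> \bar R) : (forall n, 0 <= u n) -> (forall n, u n <= w n) ->
    w n @[n --> \oo] --> 0 -> u n @[n --> \oo] --> 0.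
  move=> u0 uw w0; apply: (squeeze_cvge _ _ w0); last exact: cvg_cst.
  by apply: nearW => n; rewrite u0 uw.
have n10 w : 0 <= norm1 w :> \bar R by apply: integral_ge0 => x _; rewrite lee_fin.
have inL1_of (w : R -> R) : measurable_fun [set: R] w -> L1norm w < +oo -> inL1 w.
  move=> mw woo; apply: (integrableS measurableT) => //; exact: integrable_ge0.
split.
  apply: inL1_of => //; apply: le_lt_trans Foo; rewrite /L1norm.
  rewrite (tonelli (f := fun t y => (`|F t y|%R)%:E))//.
  by apply: ge0_le_integralT => y; [rewrite lee_fin|exact: normr_Rintegral_le].
exists m, E, v; split.
- move=> n i im; have [mEi EA mvi vi] := H n i im; have [_ Eoo] := mEA n i im.
  by split => //; exact: inL1_of.
- apply: aeW => t; rewrite /= in_itv/= => tA; split; first exact: inL1_of (Ft t tA).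
  apply: sq (cv t tA) => // n; exact: norm1_le.
- apply: sq cvI => n; first by apply: integral_ge0 => t _.
  rewrite integral_mkcond; apply: ge0_le_integralT => t; rewrite patchE; case: ifPn => // _.
  + exact: norm1_le.
  + exact: L1norm_ge0.
- exact: sq cvI.
Qed.

Lemma truncn_grid (h a : R) : (0 < h)%R -> (0 <= a)%R ->
  let z := ((Num.truncn (h * a)%R)%:R / h)%R in
  [/\ (0 <= z)%R, (z <= a)%R & (a <= z + h^-1)%R].
Proof.
move=> h0 a0; have ha0 : (0 <= h * a)%R by rewrite mulr_ge0// ltW.
have /andP[c1 c2] := truncn_itv ha0; split.
- by rewrite divr_ge0// ltW.
- by rewrite ler_pdivrMr// [leRHS]mulrC.
- by rewrite -[X in (_ + X)%R]mul1r -mulrDl ler_pdivlMr// mulrC natr1; exact: ltW.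
Qed.

Lemma normrBB_le (z a h e : R) : (0 <= e)%R -> (z <= a + h)%R -> (a + h <= z + e)%R ->
  (`|z - h - a| <= e)%R.
Proof. move=> *; rewrite ler_norml; apply/andP; split; lra. Qed.

Lemma L1norm_scale_diff_le (b q : R) (u v : R -> R) : measurable_fun [set: R] u ->
  measurable_fun [set: R] v -> L1norm u <= 1 ->
  L1norm (fun y => b * u y - q * v y)%R <= (`|b - q|%R)%:E + (`|q|%R)%:E * L1norm (v \- u)%R.
Proof.
move=> mu_ mv u1.
have -> : (fun y => b * u y - q * v y)%R = ((fun y => (b - q) * u y) \+ (fun y => q * (u y - v y)))%R.
  by apply/funext => y /=; ring.
apply: le_trans (L1normD _ _) _.
- exact: measurable_funM.
- by apply: measurable_funM => //; exact: measurable_funB.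
rewrite !L1normZ//; last by apply: measurable_funB.
apply: leeD; first by rewrite -[leRHS]mule1; apply: lee_wpmul2l; rewrite ?lee_fin.
apply: lee_wpmul2l; rewrite ?lee_fin//; apply: ge0_le_integralT => x; rewrite ?lee_fin//=.
by rewrite distrC.
Qed.

Lemma L1norm_scale_diff_le2 (b q : R) (u v : R -> R) : measurable_fun [set: R] u ->
  measurable_fun [set: R] v -> L1norm u <= 1 -> L1norm v <= 1 ->
  L1norm (fun y => b * u y - q * v y)%R <= (`|b| + `|q|)%:E.
Proof.
move=> mu_ mv u1 v1.
have -> : (fun y => b * u y - q * v y)%R = ((fun y => b * u y) \+ (fun y => (- q) * v y))%R.
  by apply/funext => y /=; rewrite mulNr.
apply: le_trans (L1normD _ _) _; [exact: measurable_funM|exact: measurable_funM|].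
rewrite !L1normZ// normrN EFinD -[X in _ <= X + _]mule1 -[X in _ <= _ + X]mule1.
by apply: leeD; apply: lee_wpmul2l; rewrite ?lee_fin.
Qed.

Lemma normr_clip_le (k y : R) : (0 <= k)%R -> (`|clip k y| <= `|y|)%R.
Proof.
move=> k0; have := @normrB_clip _ k 0%R y; rewrite normr0 !sub0r !normrN; exact.
Qed.

(** The simple functions are explicit: [k] is sampled at grid times, which is accurate by its
    continuity, and [b] is clipped and rounded so as to take finitely many values. Convergence holds
    at each time, and its integral over time tends to 0 by domination. *)
Lemma bochner_product (tau : R) (b : R -> R) (k : R -> R -> R) :
  (0 <= tau)%R -> measurable_fun [set: R] b ->
  (forall t, ~ (0 <= t <= tau)%R -> b t = 0%R) -> L1norm b < +oo ->
  measurable_fun setT (fun q : R * R => k q.1 q.2) ->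
  (forall t, (0 <= t <= tau)%R -> L1norm (k t) <= 1) ->
  (forall t e : R, (0 <= t <= tau)%R -> (0 < e)%R -> exists2 d : R, (0 < d)%R &
    forall s, (0 <= s <= tau)%R -> (`|s - t| <= d)%R -> L1norm (k s \- k t)%R <= e%:E) ->
  bochner [set` `[0%R, tau]] (fun t y => b t * k t y)%R (fun y => \int[mu]_t (b t * k t y))%R.
Proof.
move=> tau0 mb b0 boo mk k1 kc.
pose A : set R := [set` `[0%R, tau]].
pose h n : R := n.+1%:R; have h0 n : (0 < h n)%R by rewrite ltr0n.
have hi0 n : (0 <= (h n)^-1)%R by rewrite invr_ge0 ltW.
pose bc n t := clip (h n) (b t).
pose g n t := (h n * (bc n t + h n))%R.
(* Cells of mesh [1 / h n] in time (index [c]) and in the clipped values of [b]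
   (index [l]), encoded as [c * B + l]. *)
pose c n t := Num.truncn (h n * t)%R; pose tg n t := ((c n t)%:R / h n)%R.
pose l n t := Num.truncn (g n t); pose q n t := ((l n t)%:R / h n - h n)%R.
pose C n := (Num.truncn (h n * tau)%R).+1; pose B n := (Num.truncn (h n * (h n + h n))%R).+1.
pose d n t := (c n t * B n + l n t)%N.
pose m n := (C n * B n)%N.
pose v n i (y : R) : R := (((i %% B n)%N%:R / h n - h n) * k ((i %/ B n)%N%:R / h n) y)%R.
pose E n i := A `&` [set t | d n t = i].
have bcb n t : (- h n <= bc n t <= h n)%R by rewrite -ler_norml; apply: normr_clip; exact: ltW.
have g0 n t : (0 <= g n t)%R.
  apply: mulr_ge0; first exact: ltW.
  by have /andP[+ _] := bcb n t; rewrite -subr_ge0 opprK.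
have lB n t : (l n t < B n)%N.
  rewrite ltnS; apply: le_truncn; rewrite ler_pM2l// lerD2r.
  by have /andP[] := bcb n t.
have cC n t : (t <= tau)%R -> (c n t < C n)%N.
  by move=> tt; rewrite ltnS; apply: le_truncn; rewrite ler_pM2l.
have dm n t : A t -> (d n t < m n)%N.
  rewrite /A/= in_itv/= => /andP[_ tt]; rewrite /d /m.
  apply: (@leq_trans (c n t * B n + B n)%N); first by rewrite ltn_add2l.
  by rewrite addnC -mulSn leq_mul2r cC// orbT.
have dq n t : (d n t %% B n)%N = l n t by rewrite /d modnMDl modn_small.
have dc n t : (d n t %/ B n)%N = c n t by rewrite /d divnMDl// divn_small// addn0.
have vd n t y : v n (d n t) y = (q n t * k (tg n t) y)%R by rewrite /v dq dc.
have stepE n t : step (m n) (E n) (v n) t = (fun y => \1_A t * (q n t * k (tg n t) y))%R.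
  by apply/funext => y; rewrite step_cells ?vd//; exact: dm.
have tgP n t : (0 <= t)%R -> (0 <= tg n t <= t)%R /\ (`|tg n t - t| <= (h n)^-1)%R.
  move=> t0; have [z0 z1 z2] := truncn_grid (h0 n) t0.
  split; first exact/andP.
  by rewrite -/(tg n t) in z0 z1 z2; rewrite ler0_norm ?subr_le0// opprB lerBlDl.
have qb n t : (`|q n t - bc n t| <= (h n)^-1)%R.
  have a0 : (0 <= bc n t + h n)%R.
    by have /andP[+ _] := bcb n t; rewrite -subr_ge0 opprK.
  have [_ z1 z2] := truncn_grid (h0 n) a0; exact: normrBB_le.
have h1 n : ((h n)^-1 <= 1)%R by rewrite invf_le1// /h ler1n.
have bb n t : (`|bc n t| <= `|b t|)%R by apply: normr_clip_le; exact: ltW.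
have qle n t : (`|q n t| <= `|b t| + 1)%R.
  have -> : q n t = (bc n t + (q n t - bc n t))%R by rewrite addrC subrK.
  apply: le_trans (ler_normD _ _) _; apply: lerD => //; exact: le_trans (qb n t) (h1 n).
have mc n : measurable_fun [set: R] (fun t => (c n t)%:R : R).
  by apply: measurable_truncn; exact: measurable_funM.
have mtg n : measurable_fun [set: R] (tg n) by exact: measurable_funM.
have mbc n : measurable_fun [set: R] (bc n).
  have cc : continuous (clip (h n)) by exact: (@continuous_clip _ (h n) (fun x => x) (fun x => cvg_id)).
  by apply: (measurableT_comp _ mb); exact: continuous_measurable_fun.
have ml n : measurable_fun [set: R] (fun t => (l n t)%:R : R).
  by apply: measurable_truncn; apply: measurable_funM => //; exact: measurable_funD.
have mq n : measurable_fun [set: R] (q n).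
  by apply: measurable_funB => //; exact: measurable_funM.
have mk1 t : measurable_fun [set: R] (k t).
  exact: (measurableT_comp mk (g := fun x => (t, x)) (measurable_fun_pair _ _)).
have mA : measurable A by exact: measurable_itv.
have mE n i : measurable (E n i).
  apply: measurableI => //.
  have md : measurable_fun [set: R] (fun t => (d n t)%:R : R).
    under eq_fun do rewrite natrD natrM.
    by apply: measurable_funD => //; exact: measurable_funM.
  have -> : [set t | d n t = i] = (fun t => (d n t)%:R : R) @^-1` [set i%:R].
    by apply/seteqP; split=> t /=; [move=> ->|move=> /eqP; rewrite eqr_nat => /eqP].
  by rewrite -[X in measurable X]setTI; apply: md.
have AP t : (0 <= t <= tau)%R -> A t by rewrite /A/= in_itv/=.
have tgA n t : (0 <= t <= tau)%R -> (0 <= tg n t <= tau)%R.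
  move=> /andP[t0 tt]; have [/andP[z0 z1] _] := tgP n t t0.
  by rewrite z0 (le_trans z1).
have mF : measurable_fun setT (fun q : R * R => b q.1 * k q.1 q.2)%R.
  by apply: measurable_funM => //; exact: measurableT_comp.
have FE t n : (0 <= t <= tau)%R ->
    ((fun y => b t * k t y) \- step (m n) (E n) (v n) t)%R =
    (fun y => b t * k t y - q n t * k (tg n t) y)%R.
  move=> tA; apply/funext => y /=; rewrite stepE indicE mem_set ?mul1r//; exact: AP.
(* The majorant comes from [|q| <= |b| + 1]: clipping does not increase [|b|], and rounding costs at
   most [1 / h n <= 1]. *)
have bnd t n : L1norm ((fun y => b t * k t y) \- step (m n) (E n) (v n) t)%R <=
    (if (0 <= t <= tau)%R then (2 * `|b t| + 1)%R else 0)%:E.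
  case: ifPn => [tA|/negP tA].
    rewrite FE//; apply: le_trans (L1norm_scale_diff_le2 _ _ _ _ _ _) _ => //; rewrite ?k1 ?tgA//.
    by rewrite lee_fin mulrDl mul1r -addrA lerD2l.
  rewrite /L1norm integral0_eq// => y _ /=; rewrite stepE b0// mul0r indicE memNset ?mul0r ?subrr ?normr0//.
have cv t : (0 <= t <= tau)%R ->
    L1norm ((fun y => b t * k t y) \- step (m n) (E n) (v n) t)%R @[n --> \oo] --> 0.
  move=> tA; rewrite cvge0_seqP; last by move=> n; exact: L1norm_ge0.
  move=> e e0; have e20 : (0 < e / 2)%R by rewrite divr_gt0.
  have D0 : (0 < `|b t| + 1)%R by rewrite ltr_pwDr.
  have eD : (0 < e / 2 / (`|b t| + 1))%R by rewrite divr_gt0.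
  have [dd dd0 Hd] := kc t _ tA eD.
  have [n0 Hn0] : exists n0 : nat, forall n, (n0 <= n)%N ->
      [/\ (`|b t| <= h n)%R, ((h n)^-1 <= dd)%R & ((h n)^-1 <= e / 2)%R].
    pose M := (Num.max `|b t| (Num.max dd^-1 (e / 2)^-1))%R.
    exists (Num.truncn M) => n Mn.
    have : (M <= h n)%R.
      by rewrite (le_trans (ltW (truncnS_gt M)))// ler_nat ltnS.
    rewrite !ge_max => /and3P[-> a1 a2]; split => //.
    - by rewrite invf_ple ?posrE.
    - by rewrite invf_ple ?posrE.
  exists n0 => n /Hn0[n1 n2 n3]; rewrite FE//.
  apply: le_trans (L1norm_scale_diff_le _ _ _ _ _) _ => //; first exact: k1.
  have bcE : bc n t = b t.
    move: n1; rewrite ler_norml => /andP[x1 x2]; rewrite /bc /clip.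
    by rewrite (min_r x2) (max_r x1).
  have /andP[t0 _] := tA; have [_ tgt] := tgP n t t0.
  apply: (@le_trans _ _ ((e / 2)%:E + (`|b t| + 1)%:E * (e / 2 / (`|b t| + 1))%:E)).
    apply: leeD; first by rewrite lee_fin -bcE distrC (le_trans (qb n t)).
    apply: lee_pmul; rewrite ?lee_fin ?L1norm_ge0//.
    by apply: Hd; [exact: tgA|exact: le_trans tgt n2].
  by rewrite -EFinM [X in _ + X%:E]mulrC divfK ?gt_eqF// -EFinD -splitr.
apply: (@bochner_of_approx _ _ m E v) => //.
- by move=> t y tA; rewrite b0// mul0r.
- apply: le_lt_trans boo; apply: ge0_le_integralT => t; first exact: L1norm_ge0.
  rewrite [leLHS]L1normZ//; have [tA|/negP/b0->] := boolP (0 <= t <= tau)%R; last by rewrite normr0 mul0e.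
  by rewrite -[leRHS]mule1; apply: lee_wpmul2l; rewrite ?lee_fin//; exact: k1.
- move=> t tA; rewrite L1normZ//; apply: le_lt_trans (lee_wpmul2l _ (k1 t tA)) _; rewrite ?lee_fin//.
  by rewrite mule1 ltry.
- move=> n i im; split => //.
  + by move=> t [].
  + exact: measurable_funM.
  + have xA : (0 <= (i %/ B n)%N%:R / h n <= tau)%R.
      rewrite divr_ge0 ?(ltW (h0 n))//= ler_pdivrMr// mulrC.
      have : (i %/ B n < C n)%N by rewrite ltn_divLR.
      by rewrite ltnS truncn_ge_nat// mulr_ge0// ltW.
    rewrite /v L1normZ//; apply: le_lt_trans (lee_wpmul2l _ (k1 _ xA)) _; rewrite ?lee_fin//.
    by rewrite mule1 ltry.
- have mst n : measurable_fun setT (fun q : R * R => step (m n) (E n) (v n) q.1 q.2).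
    apply: measurable_sum => i; apply: measurable_funM.
      by apply: (measurableT_comp (measurable_indic (mE n i))); exact: measurable_fst.
    by apply: measurable_funM => //; apply: (measurableT_comp (mk1 _)); exact: measurable_snd.
  pose G n t := L1norm ((fun y => b t * k t y) \- step (m n) (E n) (v n) t)%R.
  have mG n : measurable_fun setT (G n).
    apply: (measurable_ge0_integral (f := fun t y => (`|b t * k t y - step (m n) (E n) (v n) t y|%R)%:E))
      => [|t x]; last by rewrite lee_fin.
    by apply/measurable_EFinP; apply: measurableT_comp => //; exact: measurable_funB.
  have G0 : {ae mu, forall t, [set: R] t -> G n t @[n --> \oo] --> cst 0 t}.
    apply: aeW => t _; have [tA|tA] := boolP (0 <= t <= tau)%R; first exact: cv.
    apply: cvg_near_cst; apply: nearW => n; apply/eqP; rewrite eq_le L1norm_ge0 andbT.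
    by have := bnd t n; rewrite (negbTE tA).
  have iD : mu.-integrable setT (fun t => (if (0 <= t <= tau)%R then (2 * `|b t| + 1)%R else 0)%:E).
    have mif : measurable_fun [set: R] (fun t => (if (0 <= t <= tau)%R then (2 * `|b t| + 1)%R else 0%R)).
      apply: measurable_fun_ifT => //.
        by apply: measurable_and; exact: measurable_fun_ler.
      by apply: measurable_funD => //; apply: measurable_funM => //; exact: measurableT_comp.
    apply: integrable_ge0 => //.
    have m2b : measurable_fun [set: R] (fun t => (2 * `|b t|)%:E).
      by apply/measurable_EFinP; apply: measurable_funM => //; exact: measurableT_comp.
    apply: (@le_lt_trans _ _ (\int[mu]_t ((2 * `|b t|)%:E + (\1_A t)%:E))).
      apply: ge0_le_integralT => t; rewrite ?lee_fin//.
      case: ifPn => tA; last by rewrite normr0 addr_ge0 ?mulr_ge0.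
      by rewrite ger0_norm ?addr_ge0 ?mulr_ge0// indicE mem_set//; exact: AP.
    rewrite ge0_integralD//; last by apply/measurable_EFinP; exact: measurable_indic.
    rewrite integral_indic// setIT lte_add_pinfty//; last first.
      by rewrite /A/= lebesgue_measure_itv/= lte_fin; case: ifPn => _; rewrite -?EFinB ltry.
    have -> : \int[mu]_t (2 * `|b t|)%:E = 2%:E * L1norm b.
      rewrite -[X in X%:E * _](ger0_norm (ler0n R 2)) -L1normZ//; apply: eq_integral => t _.
      by rewrite normrM (ger0_norm (ler0n R 2)).
    by rewrite lte_mul_pinfty.
  have GD : {ae mu, forall t, forall n, [set: R] t ->
     `|G n t| <= (if (0 <= t <= tau)%R then (2 * `|b t| + 1)%R else 0)%:E}.
    by apply: aeW => t n _; rewrite gee0_abs ?L1norm_ge0//; exact: bnd.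
  have [_ _] := @dominated_convergence _ _ _ mu setT measurableT _ _ _ mG
    (@measurable_cst _ _ _ _ setT (0 : \bar R)) G0 iD GD.
  by rewrite integral_cst// mul0e.
Qed.

End bochner_product.

(** * The integral equation *)

Section integral_equation.
Local Open Scope ereal_scope.
Context {R : realType}.
Local Notation mu := (@lebesgue_measure R).

Lemma ae_scale (P : R -> Prop) (a : R) : (0 < a)%R -> {ae mu, forall x, P x} ->
  {ae mu, forall x, P (a * x)%R}.
Proof.
move=> a0 [A [mA A0 PA]].
have mr : measurable ((fun x => a * x)%R @^-1` A).
  rewrite -[X in measurable X]setTI.
  have : measurable_fun [set: R] (fun x : R => a * x)%R by exact: measurable_funM.
  by apply.
exists ((fun x => a * x)%R @^-1` A); split => //; last by move=> x /= H; exact: (PA (a * x)%R).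
have H : \int[mu]_x (a%:E * (\1_A (a * x)%R)%:E) = 0.
  rewrite (@ge0_integral_scale _ (fun x => (\1_A x)%:E))//; last first.
    by apply/measurable_EFinP; exact: measurable_indic.
  by rewrite integral_indic// setIT.
have : \int[mu]_x (a%:E * (\1_((fun x => a * x)%R @^-1` A) x)%:E) = 0 by exact: H.
rewrite ge0_integralZl//; first last.
- by rewrite lee_fin ltW.
- by apply/measurable_EFinP; exact: measurable_indic.
rewrite integral_indic// setIT => /eqP; rewrite mule_eq0 => /orP[|/eqP//].
by rewrite eqe gt_eqF.
Qed.

Lemma eq_bochner (A : set R) (F F' : R -> R -> R) (g : R -> R) :
  (forall t, A t -> F t = F' t) -> bochner A F g -> bochner A F' g.
Proof.
move=> FF [ig [m [E [v [H1 H2 H3 H4]]]]]; split => //.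
have E' : (fun n => \int[mu]_(t in A) norm1 (F' t \- step (m n) (E n) (v n) t)%R) =
    (fun n => \int[mu]_(t in A) norm1 (F t \- step (m n) (E n) (v n) t)%R).
  by apply/funext => n; apply: eq_integral => t; rewrite inE => At; rewrite FF.
exists m, E, v; split; [exact: H1| |by rewrite E'|exact: H4].
by apply: aeS H2 => t H At; rewrite -FF//; exact: H.
Qed.

Variables (N : nat) (p : nat -> R) (f0 : R -> R).
Hypothesis p0 : (forall j, (1 <= j <= N)%N -> 0 <= p j)%R.
Hypothesis p1 : (\sum_(1 <= j < N.+1) p j = 1)%R.
Hypothesis mf0 : measurable_fun [set: R] f0.
Hypothesis f00 : (forall x, x <= 1 -> f0 x = 0)%R.
Hypothesis f01 : L1norm f0 <= 1.
Local Notation f := (profile N p f0).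
Local Notation beta := (trace N p f0).
Local Notation eta := (mild N p f0).

Definition trunc_mild (s : R) : R -> R := ext0 (eta s).

Lemma trunc_mildE s : trunc_mild s = fun y => (expR s * cutoff (expR s) (f s) (expR s * y))%R.
Proof.
apply/funext => y; rewrite /trunc_mild /ext0 /cutoff /mild /dil.
by rewrite -[X in (X < _ * _)%R]mulr1 ltr_pM2l ?expR_gt0//; case: ifP; rewrite ?mulr0.
Qed.

Lemma measurable_mild2 : measurable_fun setT (fun q : R * R => eta q.1 q.2).
Proof.
have me : measurable_fun setT (fun q : R * R => expR q.1).
  by apply: (measurableT_comp (@measurable_expR R)); exact: measurable_fst.
apply: measurable_funM => //.
apply: (@measurable_fun_comp2 _ _ _ _ _ _ _ _ f fst (fun q => expR q.1 * q.2)%R).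
- exact: measurable_profile.
- exact: measurable_fst.
- by apply: measurable_funM => //; exact: measurable_snd.
Qed.

Lemma measurable_trunc_mild2 : measurable_fun setT (fun q : R * R => trunc_mild q.1 q.2).
Proof.
apply: measurable_fun_ifT => //; last exact: measurable_mild2.
by apply: measurable_fun_ltr => //; exact: measurable_snd.
Qed.

Lemma measurable_trunc_mild s : measurable_fun [set: R] (trunc_mild s).
Proof. exact: (measurable_section2 s measurable_trunc_mild2). Qed.

Lemma L1norm_trunc_mild s : (0 <= s)%R -> L1norm (trunc_mild s) <= 1.
Proof.
move=> s0; rewrite (_ : L1norm _ = norm1 (eta s)); first exact: norm1_mild.
rewrite /norm1 integral_mkcond; apply: eq_integral => x _; rewrite patchE mem_itv1y /trunc_mild /ext0.
by case: ifP => //; rewrite normr0.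
Qed.

Lemma L1norm_trunc_mildB s t :
  L1norm (trunc_mild s \- trunc_mild t)%R <= wnorm 1 0 (eta s \- eta t)%R.
Proof.
rewrite wnorm10; apply: ge0_le_integralT => x; rewrite lee_fin// /trunc_mild /ext0/=.
by case: ifP => _; [exact: lexx|rewrite subrr normr0].
Qed.

Definition kernel (tau s : R) : R -> R := S_ (tau - s) (T1 (Q N p (trunc_mild s))).

Definition gainT (s : R) : R -> R := T1 (Q N p (trunc_mild s)).

Lemma measurable_gainT2 : measurable_fun setT (fun q : R * R => gainT q.1 q.2).
Proof.
apply: measurable_fun_ifT => //; first by apply: measurable_fun_ler => //; exact: measurable_snd.
apply: (@measurable_fun_comp2 _ _ _ _ _ _ _ _ (fun s => Q N p (trunc_mild s)) fst (fun q : R * R => (q.2 - 1)%R)).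
- exact: (measurable_Q2 N p (u := trunc_mild) measurable_trunc_mild2).
- exact: measurable_fst.
- by apply: measurable_funB => //; exact: measurable_snd.
Qed.

Lemma measurable_gainT s : measurable_fun [set: R] (gainT s).
Proof. exact: (measurable_section2 s measurable_gainT2). Qed.

Lemma measurable_kernel2 tau : measurable_fun setT (fun q : R * R => kernel tau q.1 q.2).
Proof.
have me : measurable_fun setT (fun q : R * R => expR (tau - q.1)).
  by apply: (measurableT_comp (@measurable_expR R)); apply: measurable_funB => //; exact: measurable_fst.
apply: measurable_fun_ifT => //; first by apply: measurable_fun_ler => //; exact: measurable_snd.
apply: measurable_funM => //.
apply: (@measurable_fun_comp2 _ _ _ _ _ _ _ _ gainT fst (fun q => expR (tau - q.1) * q.2)%R).
- exact: measurable_gainT2.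
- exact: measurable_fst.
- by apply: measurable_funM => //; exact: measurable_snd.
Qed.

Lemma L1norm_shift (u : R -> R) (c : R) : measurable_fun [set: R] u ->
  L1norm (fun x => u (x - c)%R) = L1norm u.
Proof.
move=> m_u; rewrite /L1norm (@ge0_integral_shift _ (fun x => (`|u x|%R)%:E))//.
by apply/measurable_EFinP; apply: measurableT_comp.
Qed.

Lemma L1norm_T1B (u v : R -> R) : measurable_fun [set: R] u -> measurable_fun [set: R] v ->
  L1norm (T1 u \- T1 v)%R <= L1norm (u \- v)%R.
Proof.
move=> m_u mv; rewrite -[leRHS](L1norm_shift 1); last exact: measurable_funB.
by apply: ge0_le_integralT => x; rewrite lee_fin// /T1/=; case: ifP => //; rewrite subrr normr0.
Qed.

Lemma L1norm_T1 (u : R -> R) : measurable_fun [set: R] u -> L1norm (T1 u) <= L1norm u.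
Proof.
move=> m_u; rewrite -[leRHS](L1norm_shift 1)//.
by apply: ge0_le_integralT => x; rewrite lee_fin// /T1/=; case: ifP => //; rewrite normr0.
Qed.

Lemma L1norm_dil t (u : R -> R) : measurable_fun [set: R] u -> L1norm (dil t u) = L1norm u.
Proof.
move=> m_u; rewrite /L1norm -[RHS](@ge0_integral_scale _ (fun x => (`|u x|%R)%:E) (expR t))//.
- by apply: eq_integral => x _; rewrite normrM ger0_norm ?expR_ge0// EFinM.
- exact: expR_gt0.
- by apply/measurable_EFinP; apply: measurableT_comp.
Qed.

Lemma L1norm_gainT s : (0 <= s)%R -> L1norm (gainT s) <= 1.
Proof.
move=> s0; have mt := measurable_trunc_mild s.
apply: le_trans (L1norm_T1 _) _; first exact: measurable_Q.
by apply: L1norm_Q => //; exact: L1norm_trunc_mild.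
Qed.

Lemma L1norm_kernel tau s : (0 <= s)%R -> L1norm (kernel tau s) <= 1.
Proof.
move=> s0; apply: le_trans (L1norm_gainT s0); rewrite -(L1norm_dil (tau - s) (measurable_gainT s)).
by apply: ge0_le_integralT => x; rewrite lee_fin// /kernel /S_; case: ifP => //; rewrite normr0.
Qed.

(** Change the state first, then the dilation. [Q] is Lipschitz on the unit ball and [T1] and
    dilations do not increase the norm, so the continuity of [s |-> eta s] controls the first
    change; strong continuity of dilations at [gainT t] controls the second. *)
Lemma kernel_continuous (tau t e : R) : (0 <= t <= tau)%R -> (0 < e)%R ->
  exists2 d : R, (0 < d)%R &
    forall s, (0 <= s <= tau)%R -> (`|s - t| <= d)%R -> L1norm (kernel tau s \- kernel tau t)%R <= e%:E.
Proof.
move=> /andP[t0 tt] e0; have e20 : (0 < e / 2)%R by rewrite divr_gt0.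
have [C C0 HC] := L1norm_QB p0.
have f0oo : wnorm 1 0 f0 < +oo by rewrite wnorm10; exact: le_lt_trans f01 (ltry _).
have C10 : (0 < C + 1)%R by rewrite ltr_pwDr.
have eC : (0 < e / 2 / (C + 1))%R by rewrite divr_gt0.
have [d1 d10 Hd1] := mild_continuous p0 p1 mf0 f00 f01 (lexx 1%R) (lexx 0%R) f0oo t0 eC.
have dc : dil_continuous 1 0 (gainT t).
  apply: dil_continuousP (lexx _) (lexx _) (measurable_gainT t) _.
  by rewrite wnorm10; exact: le_lt_trans (L1norm_gainT t0) (ltry _).
have tt0 : (0 <= tau - t)%R by rewrite subr_ge0.
have [d2 d20 Hd2] := dc _ _ tt0 e20.
exists (Num.min d1 d2); first by rewrite lt_min d10.
move=> s /andP[s0 st]; rewrite le_min => /andP[sd1 sd2].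
have mg r : measurable_fun [set: R] (gainT r) by exact: measurable_gainT.
apply: (@le_trans _ _ (L1norm (dil (tau - s) (gainT s \- gainT t) \+
    (dil (tau - s) (gainT t) \- dil (tau - t) (gainT t)))%R)).
  apply: ge0_le_integralT => x; rewrite lee_fin// /kernel /S_/=.
  case: ifP => _; last by rewrite subrr normr0.
  by rewrite /dil/= mulrBr addrA subrK.
apply: le_trans (L1normD _ _) _.
- by apply: measurable_dil; exact: measurable_funB.
- by apply: measurable_funB; exact: measurable_dil.
apply: (@le_trans _ _ ((C * (e / 2 / (C + 1)))%:E + (e / 2)%:E)).
  apply: leeD; last first.
    rewrite -wnorm10; apply: Hd2; first by rewrite subr_ge0.
    by rewrite (_ : _ - _ = t - s)%R ?(distrC t)//; ring.
  rewrite L1norm_dil; last exact: measurable_funB.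
  have mt r := measurable_trunc_mild r.
  apply: le_trans (L1norm_T1B _ _) _; [exact: measurable_Q|exact: measurable_Q|].
  apply: le_trans (HC _ _ _ _ _ _) _ => //; [exact: L1norm_trunc_mild|exact: L1norm_trunc_mild|].
  rewrite EFinM; apply: lee_wpmul2l; first by rewrite lee_fin.
  by apply: le_trans (L1norm_trunc_mildB _ _) _; exact: Hd1.
rewrite -EFinD lee_fin [leRHS](splitr e) lerD2r mulrCA ger_pMr//.
by rewrite ler_pdivrMr// mul1r lerDl.
Qed.

(** [Q] commutes with mass-preserving dilations, so the two formulas agree where
    [e^(tau - s) y >= 2]. Where [T1] cuts off, [x = e^tau y] is below [2 e^s] and the source
    vanishes too. *)
Lemma trace_mul_kernel (tau s y : R) : (1 < y)%R ->
  (beta s * kernel tau s y = expR tau * source N p f s (expR tau * y))%R.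
Proof.
move=> y1; rewrite /kernel /S_ (ltW y1) /T1 trunc_mildE.
have mc : measurable_fun [set: R] (cutoff (expR s) (f s)).
  by apply: measurable_cutoff; exact: measurable_profile_section.
have ets : (expR (tau - s) * expR s = expR tau)%R by rewrite -expRD subrK.
case: leP => [z2|z2]; last first.
  rewrite source_eq0 ?mulr0// -ets mulrAC ler_pM2r ?expR_gt0//; exact: ltW.
rewrite Q_scale ?expR_gt0//.
have -> : (expR s * (expR (tau - s) * y - 1) = expR tau * y - expR s)%R by rewrite -ets; ring.
by rewrite /source /trace -ets; ring.
Qed.

Lemma mild_integral_equation (eta0 : R -> R) :
  {ae mu, forall y, (1 < y)%R -> f0 y = eta0 y} ->
  integral_equation N p eta0 eta beta.
Proof.
move=> f0E tau tau0.
pose b s := if (0 <= s <= tau)%R then beta s else 0%R.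
have mb : measurable_fun [set: R] b.
  apply: measurable_fun_ifT => //; last exact: measurable_profile_trace.
  by apply: measurable_and; exact: measurable_fun_ler.
have [W W0 HW] := trace_integrable p0 p1 mf0 f00 f01 tau.
exists (fun y => \int[mu]_s (b s * kernel tau s y))%R.
  apply: (eq_bochner (F := fun s y => b s * kernel tau s y)%R).
    by move=> s; rewrite /= in_itv/= => sA; apply/funext => y; rewrite /b sA.
  apply: bochner_product => //.
  - by move=> t tA; rewrite /b; case: ifP.
  - apply: (@le_lt_trans _ _ W%:E); last exact: ltry.
    apply: le_trans HW; apply: ge0_le_integralT => s; first by rewrite lee_fin.
    by rewrite /b; case: ifP => _; [exact: lexx|rewrite normr0].
  - exact: measurable_kernel2.
  - by move=> t /andP[t0 _]; exact: L1norm_kernel.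
  - by move=> t e; exact: kernel_continuous.
have f0S := ae_scale (expR_gt0 tau) f0E.
apply: aeS f0S => y H y1.
have ey1 : (1 < expR tau * y)%R.
  by rewrite (lt_le_trans y1)// ler_peMl ?(ltW (lt_trans ltr01 y1))// -expR0 ler_expR.
rewrite /mild /dil (profileE N p f00) /duhamel H// mulrDr /= /S_ (ltW y1).
congr (_ + _)%R; rewrite -RintegralZl_gt0 ?expR_gt0//; last first.
  by apply: measurable_timeslice; apply: measurable_source2; exact: measurable_profile.
apply: eq_Rintegral => s _; rewrite /b; case: ifP => _; last by rewrite mulr0 mul0r.
by rewrite trace_mul_kernel.
Qed.

(** In the variable [x] the relation reads [f tau0 (e^tau) = f tau (e^tau)], and
    [tau - tau0 <= log 2] means [e^tau <= 2 e^tau0], the range where [f] is frozen. *)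
Lemma mild_trace_relation : trace_relation eta beta.
Proof.
move=> tau0 t0; apply: aeW => tau /andP[h1 h2].
rewrite /mild /dil mulrA -expRD subrK /trace; congr (_ * _)%R.
rewrite -expRD addrC subrK (profileE N p f00) [RHS](profileE N p f00).
apply: duhamel_time => //; first by rewrite -subr_ge0.
by rewrite -[X in (X * _)%R](@lnK R) ?posrE// -expRD ler_expR addrC -lerBlDl.
Qed.

Lemma trace_L1loc : inL1loc [set` `[0%R, +oo[] beta.
Proof.
move=> K cK K0; have [T HT] : exists T : R, forall s, K s -> (s <= T)%R.
  have [M [Mr HM]] := compact_bounded cK; exists (M + 1)%R => s Ks.
  by apply: le_trans (ler_norm _) _; apply: HM => //; rewrite ltrDl.
have [W W0 HW] := trace_integrable p0 p1 mf0 f00 f01 T.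
have mbeta : measurable_fun [set: R] beta by exact: measurable_profile_trace.
apply: (compact_integrable (D := [set` `[0%R, T]])) => //.
  move=> s Ks; have := K0 s Ks; rewrite /= !in_itv/= andbT => ->; exact: HT.
apply: integrable_ge0 => //; first exact: measurable_funS mbeta.
apply: (@le_lt_trans _ _ W%:E); last exact: ltry.
apply: le_trans HW; rewrite integral_mkcond; apply: ge0_le_integralT => s; rewrite patchE.
  by case: ifP => // _; rewrite lee_fin.
case: ifPn => [|_]; first by rewrite inE/= in_itv/= => ->.
by case: ifP => // _; rewrite lee_fin.
Qed.

End integral_equation.

(** * Mass conservation *)

Lemma balance_le (R : realType) (X Y : \bar R) (m : R) : (0 <= X)%E -> (0 <= Y)%E ->
  (X + Y < +oo)%E -> (X + Y + m%:E = 1 + X)%E -> ((1 - m)%:E <= Y)%E.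
Proof.
by case: X => [x| |]//; case: Y => [y| |]// x0 y0 _; rewrite -!EFinD => -[E]; rewrite lee_fin; lra.
Qed.

Section mass_conservation.
Local Open Scope ereal_scope.
Context {R : realType}.
Local Notation mu := (@lebesgue_measure R).
Variables (N : nat) (p : nat -> R) (f0 : R -> R).
Hypothesis p1 : (\sum_(1 <= j < N.+1) p j = 1)%R.
Hypothesis mf0 : measurable_fun [set: R] f0.
Hypothesis f00 : (forall x, x <= 1 -> f0 x = 0)%R.
Hypothesis p0 : (forall j, (1 <= j <= N)%N -> 0 <= p j)%R.
Hypothesis f0P : (forall x, 0 <= f0 x)%R /\ L1norm f0 = 1.
Local Notation f0_ge0 := (proj1 f0P).
Local Notation f01 := (proj2 f0P).
Local Notation f01' := (eq_ind_r (fun z => z <= 1) (lexx 1) f01).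
Local Notation f := (profile N p f0).
Local Notation beta := (trace N p f0).
Local Notation eta := (mild N p f0).

Lemma one_minus_exp_le (x : R) k : (0 <= x <= 1)%R -> (1 - x ^+ k <= k%:R * (1 - x))%R.
Proof.
move=> /andP[x0 x1]; elim: k => [|k IH]; first by rewrite expr0 subrr mul0r.
have -> : (1 - x ^+ k.+1 = (1 - x ^+ k) + x ^+ k * (1 - x))%R by rewrite exprSr; ring.
rewrite -natr1 mulrDl mul1r lerD//.
by rewrite ler_piMl ?subr_ge0// exprn_ile1.
Qed.

Lemma profile_ge0 T x : (0 <= f T x)%R.
Proof.
rewrite /profile /causal_fix; move: (Num.truncn x).+1 => n; elim: n T x => [|n IH] T x //=.
rewrite /duhamel addr_ge0 ?f0_ge0//; apply: Rintegral_ge0 => s _; case: ifP => // _.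
rewrite /source !mulr_ge0 ?expR_ge0//; apply: Q_ge0 => // y; by rewrite /cutoff; case: ifP.
Qed.

Lemma trace_ge0 s : (0 <= beta s)%R.
Proof. by rewrite mulr_ge0 ?expR_ge0// profile_ge0. Qed.

Definition mass (T : R) : R := fine (L1norm (cutoff (expR T) (f T))).

Lemma massE T : (0 <= T)%R -> L1norm (cutoff (expR T) (f T)) = (mass T)%:E.
Proof.
move=> T0; rewrite /mass fineK// ge0_fin_numE ?L1norm_ge0//.
exact: le_lt_trans (L1norm_cutoff_profile p0 p1 mf0 f00 f01' T0) (ltry _).
Qed.

Lemma mass_itv T : (0 <= T)%R -> (0 <= mass T <= 1)%R.
Proof.
move=> T0; rewrite fine_ge0 ?L1norm_ge0//= -lee_fin -massE//.
exact: (L1norm_cutoff_profile p0 p1 mf0 f00 f01').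
Qed.

Lemma measurable_mass : measurable_fun [set: R] mass.
Proof.
apply: measurableT_comp => //.
apply: (measurable_ge0_integral (f := fun T x => (`|cutoff (expR T) (f T) x|%R)%:E)) => [|t x]; last by rewrite lee_fin.
apply/measurable_EFinP; apply: measurableT_comp => //.
apply: measurable_cutoff2 => //; exact: measurable_profile.
Qed.

(** This is [q(F)] of the overview at time [s]. *)
Definition gain_mass (s : R) : R := (\sum_(i < N) p i.+1 * mass s ^+ i.+1)%R.

Lemma gain_mass_itv s : (0 <= s)%R -> (0 <= gain_mass s <= 1)%R.
Proof.
move=> s0; have /andP[m0 m1] := mass_itv s0; apply/andP; split.
  by rewrite sumr_ge0// => i _; rewrite mulr_ge0 ?(pS_ge0 p0) ?exprn_ge0.
rewrite -(sum_pS p1); apply: ler_sum => i _.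
by rewrite ler_piMr ?(pS_ge0 p0)// exprn_ile1.
Qed.

Lemma one_minus_gain_le s : (0 <= s)%R -> (1 - gain_mass s <= N%:R * (1 - mass s))%R.
Proof.
move=> s0; have m01 := mass_itv s0; have /andP[m0 m1] := m01.
rewrite -(sum_pS p1) /gain_mass -sumrB.
apply: (@le_trans _ _ (\sum_(i < N) p i.+1 * (N%:R * (1 - mass s)))%R); last first.
  by rewrite -mulr_suml (sum_pS p1) mul1r.
apply: ler_sum => i _; rewrite -[X in (X - _)%R]mulr1 -mulrBr ler_wpM2l ?(pS_ge0 p0)//.
apply: le_trans (one_minus_exp_le _ m01) _; rewrite ler_wpM2r ?subr_ge0// ler_nat.
exact: ltn_ord.
Qed.

Lemma trace_window_lty T : \int[mu]_s (if (0 <= s <= T)%R then (beta s)%:E else 0) < +oo.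
Proof.
have [W _ HW] := trace_integrable p0 p1 mf0 f00 f01' T.
apply: le_lt_trans (le_trans _ HW) (ltry W); apply: ge0_le_integralT => s; case: (_ <= _ <= _)%R.
- by rewrite lee_fin; exact: trace_ge0.
- exact: lexx.
- by rewrite lee_fin; exact: ler_norm.
- exact: lexx.
Qed.

(** An equality, unlike its counterpart for the iterated majorants: the solution itself is frozen at
    [x = e^s] from time [s] on, so its values there at times [s] and [T] coincide. *)
Lemma integral_profile_split T : (0 <= T)%R ->
  \int[mu]_s (if (0 <= s <= T)%R then (beta s)%:E else 0) + (mass T)%:E =
  \int[mu]_x (f T x)%:E.
Proof.
move=> T0.
have mbE : measurable_fun [set: R] (fun s => (beta s)%:E).
  by apply/measurable_EFinP; exact: measurable_profile_trace.
have b0 s : 0 <= (beta s)%:E by rewrite lee_fin; exact: trace_ge0.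
rewrite (@integral_window_open R (fun s => (beta s)%:E) T mbE b0) -(massE T0).
rewrite -(@integral_expR_split R (fun x => (f T x)%:E) T); first last.
- exact: T0.
- by move=> x x1; rewrite profile_eq0.
- by move=> x; rewrite lee_fin; exact: profile_ge0.
- by apply/measurable_EFinP; exact: measurable_profile_section.
apply: f_equal2; apply: eq_integral => s _.
  case: ifP => // /andP[s0 sT].
  rewrite -EFinM /trace (profileE N p f00 T) (profileE N p f00 s).
  rewrite (duhamel_time N p f0 f (ltW s0) sT)//.
  by rewrite ler_peMl ?expR_ge0// ler1n.
rewrite /cutoff /ecutoff; case: ifP => _; last by rewrite normr0.
by rewrite ger0_norm//; exact: profile_ge0.
Qed.

Lemma source_profile_ge0 s x : (0 <= source N p f s x)%R.
Proof.
rewrite /source !mulr_ge0 ?expR_ge0 ?profile_ge0//; apply: (Q_ge0 p0) => y.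
by rewrite /cutoff; case: ifP => // _; exact: profile_ge0.
Qed.

Lemma integral_source s : (0 <= s)%R ->
  \int[mu]_x (source N p f s x)%:E = (beta s * gain_mass s)%:E.
Proof.
move=> s0; set u := cutoff (expR s) (f s).
have mc : measurable_fun [set: R] u.
  by apply: measurable_cutoff; exact: measurable_profile_section.
have c0 x : (0 <= u x)%R by rewrite /u /cutoff; case: ifP => // _; exact: profile_ge0.
have mQ : measurable_fun [set: R] (Q N p u) by exact: measurable_Q.
have Q0 x : (0 <= Q N p u x)%R by exact: Q_ge0.
transitivity ((beta s)%:E * \int[mu]_x (Q N p u (x - expR s))%:E).
  rewrite -ge0_integralZl//.
  - by apply/measurable_EFinP; apply: (measurableT_comp mQ); exact: measurable_funB.
  - by move=> x _; rewrite lee_fin.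
  - by rewrite lee_fin trace_ge0.
rewrite [RHS]EFinM (@ge0_integral_shift _ (fun x => (Q N p u x)%:E)); first last.
- by move=> x; rewrite lee_fin.
- exact/measurable_EFinP.
apply: f_equal; rewrite -(ge0_L1norm_Q p0 mc c0 (massE s0)).
by apply: eq_integral => x _; rewrite ger0_norm.
Qed.

Lemma integral_profile_duhamel T : (0 <= T)%R ->
  \int[mu]_x (f T x)%:E =
  1 + \int[mu]_s (if (0 <= s <= T)%R then (beta s * gain_mass s)%:E else 0).
Proof.
move=> T0; pose k s x := (if (0 <= s <= T)%R then source N p f s x else 0%R)%:E.
have k0 s x : 0 <= k s x by rewrite lee_fin; case: (_ <= _ <= _)%R => //; exact: source_profile_ge0.
have mk : measurable_fun setT (fun q : R * R => k q.1 q.2).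
  apply/measurable_EFinP; apply: measurable_fun_ifT => //.
    by apply: measurable_and; apply: measurable_fun_ler => //; exact: measurable_fst.
  by apply: measurable_source2; exact: measurable_profile.
have mk' : measurable_fun setT (fun q : R * R => k q.2 q.1).
  exact: (measurableT_comp mk (g := fun q : R * R => (q.2, q.1)) (measurable_fun_pair _ _)).
have I0 x : 0 <= \int[mu]_s k s x by exact: integral_ge0.
have mI : measurable_fun [set: R] (fun x => \int[mu]_s k s x).
  exact: (measurable_ge0_integral (f := fun x s => k s x)).
have Ioo : \int[mu]_x \int[mu]_s k s x =
    \int[mu]_s (if (0 <= s <= T)%R then (beta s * gain_mass s)%:E else 0).
  rewrite (tonelli (f := fun x s => k s x) mk' (fun x s => k0 s x)).
  apply: eq_integral => s _; rewrite /k; case: ifPn => [/andP[s0 _]|_]; last by rewrite integral0.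
  exact: integral_source.
have Ilty : \int[mu]_x \int[mu]_s k s x < +oo.
  rewrite Ioo; apply: le_lt_trans (trace_window_lty T); apply: ge0_le_integralT => s.
    case: ifP => [/andP[s0 _]|_]; last exact: lexx.
    by rewrite lee_fin mulr_ge0 ?trace_ge0//; have /andP[] := gain_mass_itv s0.
  case: ifP => [/andP[s0 _]|_]; last exact: lexx.
  rewrite lee_fin ler_piMr ?trace_ge0//.
  by have /andP[] := gain_mass_itv s0.
rewrite -Ioo -(@ge0_integral_fine _ setT _ measurableT mI (fun x _ => I0 x) Ilty).
rewrite -f01 /L1norm; clear Ioo Ilty.
rewrite -ge0_integralD.
- apply: eq_integral => x _; rewrite (profileE N p f00) /duhamel EFinD ger0_norm//.
  exact: f0_ge0.
- exact: measurableT.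
- by move=> x _; rewrite lee_fin.
- by apply/measurable_EFinP; apply: measurableT_comp.
- by move=> x _; rewrite lee_fin fine_ge0.
- by apply/measurable_EFinP; apply: measurableT_comp.
Qed.

(** The total mass is computed by splitting at [e^T] and by Duhamel. Cancelling the finite integral
    of [beta q(F)] leaves [1 - F] equal to the integral of [beta (1 - q(F))], and
    [1 - q(F) <= N (1 - F)] by Bernoulli's inequality. *)
Lemma one_minus_mass_le T : (0 <= T)%R ->
  (1 - mass T)%:E <= N%:R%:E * \int[mu]_s (if (0 <= s <= T)%R then (beta s * (1 - mass s))%:E else 0).
Proof.
move=> T0.
have mb : measurable_fun [set: R] beta by exact: measurable_profile_trace.
have md : measurable_fun [set: R] (fun s => 1 - mass s)%R.
  by apply: measurable_funB => //; exact: measurable_mass.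
have mq : measurable_fun [set: R] gain_mass.
  apply: measurable_sum => i; apply: measurable_funM => //.
  by apply: measurable_funX; exact: measurable_mass.
have win (h : R -> R) : measurable_fun [set: R] h ->
    measurable_fun [set: R] (fun s => if (0 <= s <= T)%R then (h s)%:E else 0).
  by move=> mh; apply: (measurable_window (T := EFin \o h)); exact/measurable_EFinP.
have pos (h : R -> R) : (forall s, 0 <= s -> 0 <= h s)%R -> forall s,
    0 <= (if (0 <= s <= T)%R then (h s)%:E else 0).
  by move=> h0 s; case: ifP => // /andP[s0 _]; rewrite lee_fin h0.
have q0 s : (0 <= s -> 0 <= beta s * gain_mass s)%R.
  by move=> /gain_mass_itv/andP[? _]; rewrite mulr_ge0 ?trace_ge0.
have q1 s : (0 <= s -> 0 <= beta s * (1 - gain_mass s))%R.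
  by move=> /gain_mass_itv/andP[_ ?]; rewrite mulr_ge0 ?trace_ge0 ?subr_ge0.
have d0 s : (0 <= s -> 0 <= beta s * (1 - mass s))%R.
  by move=> /mass_itv/andP[_ ?]; rewrite mulr_ge0 ?trace_ge0 ?subr_ge0.
rewrite -ge0_integralZl//; first last.
- by move=> s _; exact: (pos _ d0).
- by apply: win; exact: measurable_funM.
apply: (@le_trans _ _ (\int[mu]_s (if (0 <= s <= T)%R then (beta s * (1 - gain_mass s))%:E else 0))); last first.
  apply: ge0_le_integralT => s; first exact: (pos _ q1).
  case: ifP => [/andP[s0 _]|_]; last by rewrite mule0.
  by rewrite -EFinM lee_fin mulrCA ler_wpM2l ?trace_ge0//; exact: one_minus_gain_le.
have D : \int[mu]_s (if (0 <= s <= T)%R then (beta s)%:E else 0) =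
   \int[mu]_s (if (0 <= s <= T)%R then (beta s * gain_mass s)%:E else 0) +
   \int[mu]_s (if (0 <= s <= T)%R then (beta s * (1 - gain_mass s))%:E else 0).
  rewrite -ge0_integralD.
  - apply: eq_integral => s _; case: ifP => _; last by rewrite adde0.
    by rewrite -EFinD mulrBr mulr1 addrC subrK.
  - exact: measurableT.
  - by move=> s _; exact: (pos _ q0).
  - by apply: win; exact: measurable_funM.
  - by move=> s _; exact: (pos _ q1).
  - by apply: win; apply: measurable_funM => //; exact: measurable_funB.
have XY := trace_window_lty T; rewrite D in XY.
have E := integral_profile_split T0; rewrite (integral_profile_duhamel T0) D in E; clear D.
have X0 : 0 <= \int[mu]_s (if (0 <= s <= T)%R then (beta s * gain_mass s)%:E else 0).
  by apply: integral_ge0 => s _; exact: (pos _ q0).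
have Y0 : 0 <= \int[mu]_s (if (0 <= s <= T)%R then (beta s * (1 - gain_mass s))%:E else 0).
  by apply: integral_ge0 => s _; exact: (pos _ q1).
exact: balance_le X0 Y0 XY E.
Qed.

(** The inequality for [d = 1 - mass] is homogeneous, so [2^n d] satisfies the hypotheses of
    [gronwall] with [C = 2 N], the factor 2 paying for the passage from [n] to [n + 1]. A bound
    uniform in [n] forces [d = 0]. *)
Lemma mass_conserved T : (0 <= T)%R -> mass T = 1%R.
Proof.
move=> T0; pose d t := (1 - mass t)%R.
have mb : measurable_fun [set: R] beta by exact: measurable_profile_trace.
have md : measurable_fun [set: R] d by apply: measurable_funB => //; exact: measurable_mass.
have d01 t : (0 <= t)%R -> (0 <= d t <= 1)%R.
  by move=> /mass_itv/andP[m0 m1]; rewrite subr_ge0 m1 gerBl.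
have [M M0 HM] : exists2 M : R, (0 <= M)%R & forall n t, (0 <= t <= T)%R -> (2 ^+ n * `|d t|)%:E <= M%:E.
  apply: (gronwall (b := beta) (T := T) (A := 1) (C := (2 * N%:R)%R)
    mb trace_ge0 ler01 _ (trace_window_lty T) (u := fun n t => (2 ^+ n * `|d t|)%:E)).
  - by rewrite mulr_ge0.
  - by move=> n; apply/measurable_EFinP; apply: measurable_funM => //; exact: measurableT_comp.
  - by move=> n s; rewrite lee_fin mulr_ge0.
  - by move=> s /andP[/d01/andP[d0 d1] _]; rewrite expr0 mul1r ger0_norm.
  - move=> n t /andP[t0 tT].
    have d0 s : (0 <= s)%R -> (0 <= d s)%R by move=> /d01/andP[].
    have mw : measurable_fun [set: R] (fun s => if (0 <= s <= t)%R then (beta s * d s)%:E else 0).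
      by apply: (measurable_window (T := fun s => (beta s * d s)%:E)); apply/measurable_EFinP; exact: measurable_funM.
    have w0 s : 0 <= (if (0 <= s <= t)%R then (beta s * d s)%:E else 0).
      by case: ifP => // /andP[s0 _]; rewrite lee_fin mulr_ge0 ?trace_ge0 ?d0.
    have -> : \int[mu]_s (if (0 <= s <= t)%R then (beta s)%:E * (2 ^+ n * `|d s|)%:E else 0) =
        (2 ^+ n)%:E * \int[mu]_s (if (0 <= s <= t)%R then (beta s * d s)%:E else 0).
      rewrite -ge0_integralZl; [|exact: measurableT|exact: mw|by move=> s _|by rewrite lee_fin exprn_ge0].
      apply: eq_integral => s _; case: ifP => [/andP[s0 _]|_]; last by rewrite mule0.
      by rewrite -!EFinM (ger0_norm (d0 _ s0)) mulrCA.
    apply: (@le_trans _ _ ((2 ^+ n.+1)%:E * (N%:R%:E * \int[mu]_s (if (0 <= s <= t)%R then (beta s * d s)%:E else 0)))).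
      rewrite (_ : (_ * `|d t|)%:E = (2 ^+ n.+1)%:E * (d t)%:E); last by rewrite -EFinM (ger0_norm (d0 _ t0)).
      by apply: lee_wpmul2l; [rewrite lee_fin exprn_ge0|exact: one_minus_mass_le t0].
    rewrite !muleA -!EFinM (_ : (2 ^+ n.+1 * N%:R = 2 * N%:R * 2 ^+ n)%R); last by rewrite exprS mulrAC.
    by rewrite [leRHS]addeC; apply: leeDl.
apply/eqP; rewrite eq_sym -subr_eq0 -/(d T); apply: contraT => dT0.
have d0 : (0 < `|d T|)%R by rewrite normr_gt0.
have := HM (Num.truncn (M / `|d T|)%R).+1 T; rewrite T0 lexx => /(_ isT).
rewrite lee_fin leNgt -ltr_pdivrMr// => /negP[].
apply: lt_le_trans (truncnS_gt _) _; rewrite -natrX ler_nat.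
exact: ltnW (ltn_expl _ _).
Qed.

Lemma inP_mild tau : (0 <= tau)%R -> inP (eta tau).
Proof.
move=> t0.
have eta0 y : (0 <= eta tau y)%R by rewrite mulr_ge0 ?expR_ge0 ?profile_ge0.
have [iX _] := mild_C0_L1 p0 p1 mf0 f00 f01'.
split; [exact: iX|exact: aeW|].
transitivity (norm1 (eta tau)).
  by apply: eq_integral => y _; rewrite ger0_norm.
rewrite norm1_dil; last exact: measurable_profile_section.
by rewrite (massE t0) (mass_conserved t0).
Qed.

End mass_conservation.

(** * Uniqueness *)

Section bochner_local.
Local Open Scope ereal_scope.
Context {R : realType}.
Local Notation mu := (@lebesgue_measure R).
Implicit Types u v w : R -> R.

Lemma norm1E w : norm1 w = L1norm (ext0 w).
Proof.
rewrite /norm1 integral_mkcond; apply: eq_integral => x _; rewrite patchE mem_itv1y /ext0.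
by case: ifP => //; rewrite normr0.
Qed.

Lemma norm1_ge0 w : 0 <= norm1 w. Proof. by rewrite norm1E L1norm_ge0. Qed.

Lemma measurable_ext0 w : inL1 w -> measurable_fun [set: R] (ext0 w).
Proof.
move=> /integrableP[/measurable_EFinP mw _].
have -> : ext0 w = w \_ [set` `]1%R, +oo[].
  by apply/funext => x; rewrite patchE mem_itv1y.
by apply/(measurable_restrictT _ _).1.
Qed.

Lemma ext0B u v : ext0 (u \- v)%R = (ext0 u \- ext0 v)%R.
Proof. by apply/funext => x; rewrite /ext0/=; case: ifP => //; rewrite subrr. Qed.

Lemma norm1C u v : norm1 (u \- v)%R = norm1 (v \- u)%R.
Proof. by apply: eq_integral => x _ /=; rewrite distrC. Qed.

Lemma norm1_triangle u v w : inL1 u -> inL1 v -> inL1 w ->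
  norm1 (u \- w)%R <= norm1 (u \- v)%R + norm1 (v \- w)%R.
Proof.
move=> /measurable_ext0 iu /measurable_ext0 iv /measurable_ext0 iw; rewrite !norm1E !ext0B.
apply: le_trans (L1normD _ _); [|exact: measurable_funB|exact: measurable_funB].
rewrite (_ : (_ \+ _)%R = (ext0 u \- ext0 w)%R); first exact: lexx.
by apply/funext => x /=; rewrite addrA subrK.
Qed.

Lemma inL1_sum (m : nat) (c : nat -> R) (v : nat -> R -> R) :
  (forall i, (i < m)%N -> inL1 (v i)) -> inL1 (fun y => \sum_(i < m) c i * v i y)%R.
Proof.
move=> iv; rewrite /inL1.
have -> : EFin \o (fun y => \sum_(i < m) c i * v i y)%R =
    (fun y => \sum_(i < m) (c i)%:E * (v i y)%:E).
  by apply/funext => y /=; rewrite -sumEFin.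
apply: integrable_sum => [//|i _].
exact: (@integrableZl _ _ _ mu _ (measurable_itv _) (c i) _ (iv i (ltn_ord i))).
Qed.

Lemma inL1_step (m : nat) (E : nat -> set R) (v : nat -> R -> R) (t : R) :
  (forall i, (i < m)%N -> inL1 (v i)) -> inL1 (step m E v t).
Proof. exact: (inL1_sum (fun i => \1_(E i) t)). Qed.

Lemma inL1_step_integral (m : nat) (E : nat -> set R) (v : nat -> R -> R) :
  (forall i, (i < m)%N -> inL1 (v i)) -> inL1 (step_integral m E v).
Proof. exact: (inL1_sum (fun i => fine (mu (E i)))). Qed.

Lemma L1norm_eq0 w : measurable_fun [set: R] w ->
  L1norm w = 0 <-> {ae mu, forall x, w x = 0%R}.
Proof.
move=> mw; have mwE : measurable_fun [set: R] (EFin \o w) by exact/measurable_EFinP.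
have := ae_eq_integral_abs mu measurableT mwE; rewrite /L1norm.
under eq_integral do rewrite abse_EFin.
move=> ->; split; apply: aeS => x H.
  by have /= [] := H I.
by move=> _ /=; rewrite H.
Qed.

Lemma inL1B u v : inL1 u -> inL1 v -> inL1 (u \- v)%R.
Proof. by move=> iu iv; exact: (@integrableB _ _ _ mu _ _ (EFin \o u) (EFin \o v)). Qed.

Lemma norm1_lty w : inL1 w -> norm1 w < +oo.
Proof. by move=> /integrableP[]. Qed.

Lemma ext0_step m (E : nat -> set R) (v : nat -> R -> R) (t : R) :
  ext0 (step m E v t) = step m E (fun i => ext0 (v i)) t.
Proof.
apply/funext => y; rewrite /ext0 /step; case: ifP => // y1.
by rewrite big1// => i _; rewrite mulr0.
Qed.

Lemma ext0_step_integral m (E : nat -> set R) (v : nat -> R -> R) :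
  ext0 (step_integral m E v) = step_integral m E (fun i => ext0 (v i)).
Proof.
apply/funext => y; rewrite /ext0 /step_integral; case: ifP => // y1.
by rewrite big1// => i _; rewrite mulr0.
Qed.

Lemma measurable_step2 m (E : nat -> set R) (v : nat -> R -> R) :
  (forall i, (i < m)%N -> measurable (E i) /\ measurable_fun [set: R] (v i)) ->
  measurable_fun setT (fun q : R * R => step m E v q.1 q.2).
Proof.
move=> H; apply: measurable_sum => i; have [mE mv] := H i (ltn_ord i).
apply: measurable_funM.
  by apply: (measurableT_comp (measurable_indic mE)); exact: measurable_fst.
by apply: (measurableT_comp mv); exact: measurable_snd.
Qed.

(** [F] need not be jointly measurable, but on [D] the norm is the limit in [k] of the distances
    between the step functions [k] and [n], which are measurable in [t] by Tonelli; the triangle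
    inequality squeezes it. *)
Lemma measurable_norm1_step (D : set R) (F : R -> R -> R) (m : nat -> nat)
    (E : nat -> nat -> set R) (v : nat -> nat -> R -> R) (n : nat) : measurable D ->
  (forall n i, (i < m n)%N -> measurable (E n i) /\ inL1 (v n i)) ->
  (forall t, D t -> inL1 (F t) /\ norm1 (F t \- step (m n) (E n) (v n) t)%R @[n --> \oo] --> 0) ->
  measurable_fun D (fun t => norm1 (F t \- step (m n) (E n) (v n) t)%R).
Proof.
move=> mD HE HF.
apply: (emeasurable_fun_cvg
  (fun k t => norm1 (step (m k) (E k) (v k) t \- step (m n) (E n) (v n) t)%R)).
  move=> k; apply: measurable_funTS.
  under eq_fun do rewrite norm1E ext0B !ext0_step.
  apply: (measurable_ge0_integral (f := fun t y => (`|step (m k) (E k) (fun i => ext0 (v k i)) t y -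
     step (m n) (E n) (fun i => ext0 (v n i)) t y|%R)%:E)) => [|t y]; last by rewrite lee_fin.
  apply/measurable_EFinP; apply: measurableT_comp => //; apply: measurable_funB.
    by apply: measurable_step2 => i /HE[mE /measurable_ext0].
  by apply: measurable_step2 => i /HE[mE /measurable_ext0].
move=> t Dt; have [iF cF] := HF t Dt.
have iS k : inL1 (step (m k) (E k) (v k) t) by apply: inL1_step => i /HE[].
have fx k : norm1 (F t \- step (m k) (E k) (v k) t)%R \is a fin_num.
  rewrite ge0_fin_numE ?norm1_ge0//; exact: norm1_lty (inL1B iF (iS k)).
set x := norm1 (F t \- step (m n) (E n) (v n) t)%R.
have cu : x + norm1 (F t \- step (m k) (E k) (v k) t)%R @[k --> \oo] --> x.
  rewrite -[X in _ --> X]adde0; apply: cvgeD => //; [exact: fin_num_adde_defl|exact: cvg_cst].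
have cl : x - norm1 (F t \- step (m k) (E k) (v k) t)%R @[k --> \oo] --> x.
  rewrite -[X in _ --> X]sube0; apply: cvgeB => //; [exact: fin_num_adde_defl|exact: cvg_cst].
apply: (squeeze_cvge _ cl cu); apply: nearW => k; apply/andP; split.
  rewrite leeBlDr//; apply: le_trans (norm1_triangle iF (iS k) (iS n)) _.
  by rewrite addeC.
by rewrite addeC; apply: le_trans (norm1_triangle (iS k) iF (iS n)) _; rewrite norm1C.
Qed.

Lemma norm1_step_integralB (m m' : nat) (E E' : nat -> set R) (v v' : nat -> R -> R) (c : R) :
  (forall i, (i < m)%N -> [/\ measurable (E i), mu (E i) < +oo & inL1 (v i)]) ->
  (forall i, (i < m')%N -> [/\ measurable (E' i), mu (E' i) < +oo & inL1 (v' i)]) ->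
  let cutc w (y : R) := if (y < c)%R then ext0 w y else 0%R in
  measurable_fun [set: R] (fun t => L1norm (cutc (step m E v t \- step m' E' v' t)%R)) /\
  L1norm (cutc (step_integral m E v \- step_integral m' E' v')%R) <=
  \int[mu]_t L1norm (cutc (step m E v t \- step m' E' v' t)%R).
Proof.
move=> H H' cutc.
pose V i := ext0 (v i); pose V' i := ext0 (v' i).
have ms : measurable_fun setT (fun q : R * R => step m E V q.1 q.2).
  by apply: measurable_step2 => i /H[? _ /measurable_ext0].
have ms' : measurable_fun setT (fun q : R * R => step m' E' V' q.1 q.2).
  by apply: measurable_step2 => i /H'[? _ /measurable_ext0].
have cE t y : cutc (step m E v t \- step m' E' v' t)%R y =
    (if (y < c)%R then step m E V t y - step m' E' V' t y else 0)%R.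
  by rewrite /cutc ext0B !ext0_step.
have mc : measurable_fun setT (fun q : R * R => (`|cutc (step m E v q.1 \- step m' E' v' q.1)%R q.2|%R)%:E).
  under eq_fun do rewrite cE.
  apply/measurable_EFinP; apply: measurableT_comp => //; apply: measurable_fun_ifT => //.
    by apply: measurable_fun_ltr => //; exact: measurable_snd.
  exact: measurable_funB.
have mc' : measurable_fun setT (fun q : R * R => (`|cutc (step m E v q.2 \- step m' E' v' q.2)%R q.1|%R)%:E).
  exact: (measurableT_comp mc (g := fun q : R * R => (q.2, q.1)) (measurable_fun_pair _ _)).
split; first exact: (measurable_ge0_integral (f := fun t y => (`|cutc (step m E v t \- step m' E' v' t)%R y|%R)%:E) mc).
rewrite /L1norm (tonelli (f := fun t y => (`|cutc (step m E v t \- step m' E' v' t)%R y|%R)%:E) mc); last first.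
  by move=> t y; rewrite lee_fin.
apply: ge0_le_integralT => y; first by rewrite lee_fin.
have [iS sE] := Rintegral_step V y (fun i im => let: And3 a b _ := H i im in conj a b).
have [iS' sE'] := Rintegral_step V' y (fun i im => let: And3 a b _ := H' i im in conj a b).
rewrite /cutc ext0B !ext0_step_integral -/V -/V' /= -sE -sE' -RintegralB//.
case: ifP => yc; last by rewrite normr0 integral_ge0.
apply: le_trans (normr_Rintegral_le measurableT _) _.
  have /integrableP[/measurable_EFinP mS _] := iS; have /integrableP[/measurable_EFinP mS' _] := iS'.
  exact: measurable_funB.
apply: ge0_le_integralT => t; rewrite lee_fin//.
by rewrite ext0B !ext0_step.
Qed.

Lemma L1norm_le_cutc (c : R) w :
  L1norm (fun y => if (y < c)%R then ext0 w y else 0%R) <= norm1 w.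
Proof.
rewrite norm1E; apply: ge0_le_integralT => y; rewrite lee_fin//.
by case: ifP => // _; rewrite normr0.
Qed.

(* [t |-> norm1 (F t - step n t)] is not known to be measurable, so its integral is
   only a lower integral, which need not be subadditive; it is replaced by a
   measurable function equal to it off a null set. *)
Lemma norm1_step_minorant (A D : set R) (F : R -> R -> R) (m : nat -> nat)
    (E : nat -> nat -> set R) (v : nat -> nat -> R -> R) : measurable D -> D `<=` A ->
  (forall n i, (i < m n)%N -> measurable (E n i) /\ inL1 (v n i)) ->
  (forall t, D t -> inL1 (F t) /\ norm1 (F t \- step (m n) (E n) (v n) t)%R @[n --> \oo] --> 0) ->
  exists a : nat -> R -> \bar R, [/\ forall n, measurable_fun [set: R] (a n),
    forall n t, 0 <= a n t,
    forall n t, D t -> a n t = norm1 (F t \- step (m n) (E n) (v n) t)%R &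
    forall n, \int[mu]_t a n t <= \int[mu]_(t in A) norm1 (F t \- step (m n) (E n) (v n) t)%R].
Proof.
move=> mD DA HE HF.
pose a n t := if t \in D then norm1 (F t \- step (m n) (E n) (v n) t)%R else 0.
have a0 n t : 0 <= a n t by rewrite /a; case: ifP => // _; exact: norm1_ge0.
exists a; split => // [n|n t Dt|n]; last 2 first.
- by rewrite /a mem_set.
- rewrite [leRHS]integral_mkcond; apply: ge0_le_integralT => // t.
  rewrite /a patchE; case: ifPn => [|_]; first by rewrite inE => /DA At; rewrite mem_set.
  by case: ifP => // _; exact: norm1_ge0.
have H := measurable_norm1_step n mD HE HF.
have -> : a n = (fun t => norm1 (F t \- step (m n) (E n) (v n) t)%R) \_ D.
  by apply/funext => t; rewrite patchE.
exact: (measurable_restrictT _ mD).1 H.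
Qed.

(** The two integrals come with unrelated approximations. The norm of [g - g'] below [c] is bounded
    by their errors alone: the step functions are compared through [F] and [F'], whose difference
    contributes nothing below [c]. *)
Lemma bochner_local (A : set R) (F F' : R -> R -> R) (g g' : R -> R) (c : R) : measurable A ->
  bochner A F g -> bochner A F' g' ->
  {ae mu, forall t, A t -> {ae mu, forall y, (1 < y)%R -> (y < c)%R -> F t y = F' t y}} ->
  {ae mu, forall y, (1 < y)%R -> (y < c)%R -> g y = g' y}.
Proof.
move=> mA [ig [m [E [v [H1 H2 H3 H4]]]]] [ig' [m' [E' [v' [H1' H2' H3' H4']]]]] FF.
pose cutc w (y : R) := if (y < c)%R then ext0 w y else 0%R.
have [Z [mZ Z0 ZP]] := aeI (aeI H2 H2') FF.
pose D := A `\` Z; have mD : measurable D by exact: measurableD.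
have DP t : D t -> [/\ inL1 (F t), norm1 (F t \- step (m n) (E n) (v n) t)%R @[n --> \oo] --> 0,
    inL1 (F' t), norm1 (F' t \- step (m' n) (E' n) (v' n) t)%R @[n --> \oo] --> 0 &
    {ae mu, forall y, (1 < y)%R -> (y < c)%R -> F t y = F' t y}].
  move=> [At nZ]; have : (((A t -> inL1 (F t) /\ norm1 (F t \- step (m n) (E n) (v n) t)%R @[n --> \oo] --> 0) /\
     (A t -> inL1 (F' t) /\ norm1 (F' t \- step (m' n) (E' n) (v' n) t)%R @[n --> \oo] --> 0)) /\
     (A t -> {ae mu, forall y, (1 < y)%R -> (y < c)%R -> F t y = F' t y})).
    by apply: contrapT => X; apply: nZ; exact: ZP.
  by move=> [[/(_ At)[? ?] /(_ At)[? ?]] /(_ At)].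
have HE n i : (i < m n)%N -> measurable (E n i) /\ inL1 (v n i) by move=> /H1[].
have HE' n i : (i < m' n)%N -> measurable (E' n i) /\ inL1 (v' n i) by move=> /H1'[].
have DA : D `<=` A by move=> t [].
have [a [ma a0 aD aI]] := norm1_step_minorant mD DA HE (fun t Dt => let: And5 x y _ _ _ := DP t Dt in conj x y).
have [a' [ma' a'0 aD' aI']] := norm1_step_minorant mD DA HE' (fun t Dt => let: And5 _ _ x y _ := DP t Dt in conj x y).
have cut_tri (u w z : R -> R) : inL1 u -> inL1 w -> inL1 z ->
    L1norm (cutc (u \- z)%R) <= L1norm (cutc (u \- w)%R) + L1norm (cutc (w \- z)%R).
  move=> /measurable_ext0 mu_ /measurable_ext0 mw /measurable_ext0 mz.
  have mcut (h : R -> R) : measurable_fun [set: R] h ->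
      measurable_fun [set: R] (fun y => if (y < c)%R then h y else 0%R).
    by move=> mh; apply: measurable_fun_ifT => //; exact: measurable_fun_ltr.
  apply: le_trans (L1normD _ _); first last.
  - by rewrite /cutc ext0B; apply: mcut; exact: measurable_funB.
  - by rewrite /cutc ext0B; apply: mcut; exact: measurable_funB.
  rewrite (_ : (_ \+ _)%R = cutc (u \- z)%R); first exact: lexx.
  apply/funext => y; rewrite /cutc !ext0B /=; case: ifP => _; last by rewrite addr0.
  by rewrite addrA subrK.
have iS n t : inL1 (step (m n) (E n) (v n) t) by apply: inL1_step => i /HE[].
have iS' n t : inL1 (step (m' n) (E' n) (v' n) t) by apply: inL1_step => i /HE'[].
pose err n : \bar R :=
    norm1 (g \- step_integral (m n) (E n) (v n))%R +
    (\int[mu]_(t in A) norm1 (F t \- step (m n) (E n) (v n) t)%R +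
     \int[mu]_(t in A) norm1 (F' t \- step (m' n) (E' n) (v' n) t)%R) +
    norm1 (g' \- step_integral (m' n) (E' n) (v' n))%R.
have bound n : L1norm (cutc (g \- g')%R) <= err n.
  have iI : inL1 (step_integral (m n) (E n) (v n)) by apply: inL1_step_integral => i /HE[].
  have iI' : inL1 (step_integral (m' n) (E' n) (v' n)) by apply: inL1_step_integral => i /HE'[].
  apply: le_trans (cut_tri _ _ _ ig iI ig') _; rewrite -[leRHS]addeA; apply: leeD; first exact: L1norm_le_cutc.
  apply: le_trans (cut_tri _ _ _ iI iI' ig') _; apply: leeD; last first.
    by rewrite [leRHS]norm1C; exact: L1norm_le_cutc.
  have Hn i : (i < m n)%N -> [/\ measurable (E n i), mu (E n i) < +oo & inL1 (v n i)] by move=> /H1[].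
  have Hn' i : (i < m' n)%N -> [/\ measurable (E' n i), mu (E' n i) < +oo & inL1 (v' n i)] by move=> /H1'[].
  have [mst] := norm1_step_integralB c Hn Hn'; move=> /le_trans; apply.
  apply: (@le_trans _ _ (\int[mu]_t (a n t + a' n t))); last first.
    rewrite (@ge0_integralD _ _ _ mu _ measurableT _ _ (fun t _ => a0 n t) (ma n) (fun t _ => a'0 n t) (ma' n)).
    exact: leeD (aI n) (aI' n).
  apply: ae_ge0_le_integral => //.
  - by move=> t _; exact: L1norm_ge0.
  - by move=> t _; rewrite adde_ge0.
  - exact: (emeasurable_funD (ma n) (ma' n)).
  exists Z; split => // t /= X; apply: contrapT => nZ; apply: X => _.
  (* The integrals of the step functions run over the whole line; outside [A] both step functions
     vanish because their cells lie in [A]. *)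
  have [At|nAt] := pselect (A t); last first.
    have st0 k (B : nat -> set R) (w : nat -> R -> R) :
        (forall i, (i < k)%N -> B i `<=` A) -> step k B w t = cst 0%R.
      move=> BA; apply/funext => y; rewrite /step big1// => i _.
      by rewrite indicE memNset ?mul0r// => /BA-/(_ (ltn_ord i)).
    rewrite st0; last by move=> i /H1[].
    rewrite st0; last by move=> i /H1'[].
    rewrite [leLHS](_ : _ = 0) ?adde_ge0//; apply: integral0_eq => y _.
    by rewrite /ext0/= subrr !if_same normr0.
  have Dt : D t by [].
  have [iF cF iF' cF' FFt] := DP t Dt.
  rewrite aD// aD'//.
  apply: le_trans (cut_tri _ _ _ (iS n t) iF (iS' n t)) _; apply: leeD.
    by rewrite [leRHS]norm1C; exact: L1norm_le_cutc.
  apply: le_trans (cut_tri _ _ _ iF iF' (iS' n t)) _.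
  rewrite (_ : L1norm (cutc (F t \- F' t)%R) = 0) ?add0e; first exact: L1norm_le_cutc.
  rewrite L1norm_eq0; last first.
    rewrite /cutc ext0B; apply: measurable_fun_ifT => //; first exact: measurable_fun_ltr.
    by apply: measurable_funB; exact: measurable_ext0.
  apply: aeS FFt => y Hy; rewrite /cutc /ext0; case: ltP => // yc; case: ltP => // y1.
  by rewrite /= Hy// subrr.
have : L1norm (cutc (g \- g')%R) = 0.
  apply/eqP; rewrite eq_le L1norm_ge0 andbT; apply/lee_addgt0Pr => e e0; rewrite add0e.
  have err0 n : 0 <= err n.
    have I0 (h : R -> R -> R) : 0 <= \int[mu]_(t in A) norm1 (h t).
      by apply: integral_ge0 => t _; exact: norm1_ge0.
    by apply: adde_ge0; [apply: adde_ge0; [|apply: adde_ge0]|]; rewrite ?norm1_ge0 ?I0.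
  have cv : err n @[n --> \oo] --> 0.
    rewrite -(adde0 0); apply: cvgeD; [by []| |exact: H4'].
    rewrite -(adde0 0); apply: cvgeD; [by []|exact: H4|].
    rewrite -(adde0 0); apply: cvgeD; [by []|exact: H3|exact: H3'].
  have [n /(_ n (leqnn _))] := (cvge0_seqP err0).1 cv e e0.
  exact: le_trans (bound n).
rewrite L1norm_eq0; last first.
  rewrite /cutc ext0B; apply: measurable_fun_ifT => //; first exact: measurable_fun_ltr.
  by apply: measurable_funB; exact: measurable_ext0.
apply: aeS => y; rewrite /cutc /ext0 => + y1 yc; rewrite yc y1 /= => /eqP.
by rewrite subr_eq0 => /eqP.
Qed.

End bochner_local.

Section uniqueness.
Local Open Scope ereal_scope.
Context {R : realType}.
Local Notation mu := (@lebesgue_measure R).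

Lemma ae_translate (P : R -> Prop) (z : R) : {ae mu, forall x, P x} ->
  {ae mu, forall x, P (x - z)%R}.
Proof.
move=> /(ae_reflect (- z)%R)/(ae_reflect 0%R); apply: aeS => x.
by rewrite sub0r opprK addrC.
Qed.

(** Null sets pull back to null sets under [expR], by the substitution [x = e^s] applied to an
    indicator. *)
Lemma ae_expR (P : R -> Prop) : {ae mu, forall y, (1 < y)%R -> P y} ->
  {ae mu, forall s, (0 < s)%R -> P (expR s)}.
Proof.
move=> [A [mA A0 PA]].
have m1 : measurable_fun [set: R] (fun x : R => (\1_A x)%:E : \bar R).
  by apply/measurable_EFinP; exact: measurable_indic.
have := ge0_integral_expR m1 (fun x => ltac:(by rewrite lee_fin)).
rewrite integral_mkcond [in X in _ = X -> _]integral_mkcond.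
pose w s : R := if (0 < s)%R then (expR s * \1_A (expR s))%R else 0%R.
have mw : measurable_fun [set: R] w.
  apply: measurable_fun_ifT => //; first exact: measurable_fun_ltr.
  apply: measurable_funM => //; apply: (measurableT_comp (measurable_indic mA)).
  exact: measurable_expR.
have itvP (a x : R) : (x \in [set` `]a, +oo[]) = (a < x)%R.
  by apply/idP/idP; rewrite inE/= in_itv/= andbT.
move=> H; have : L1norm w = 0.
  transitivity (\int[mu]_x ((fun x : R => (\1_A x)%:E) \_ `]1%R, +oo[) x).
    rewrite -H; apply: eq_integral => s _; rewrite patchE itvP /w; case: ifP => _; last by rewrite normr0.
    by rewrite ger0_norm ?EFinM// mulr_ge0// expR_ge0.
  rewrite -integral_mkcond integral_indic//; apply/eqP; rewrite eq_le measure_ge0 andbT -A0.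
  by apply: le_measure; rewrite ?inE//; exact: measurableI.
rewrite L1norm_eq0//; apply: aeS => s; rewrite /w => + s0; rewrite s0 => /eqP.
rewrite mulf_eq0 gt_eqF ?expR_gt0//= indicE pnatr_eq0 eqb0 => nA.
apply: contrapT => nP; move/negP: nA; apply; rewrite inE; apply: PA => /= X; apply: nP; apply: X.
by rewrite -expR0 ltr_expR.
Qed.

Variables (N : nat) (p : nat -> R) (eta0 : R -> R) (eta eta' : R -> R -> R) (beta beta' : R -> R).
Hypothesis sol : is_solution N p eta0 eta beta.
Hypothesis sol' : is_solution N p eta0 eta' beta'.

(** In the variable [x = e^tau y] the region is [x < c], the same for every [tau]. *)
Definition agree_below (c : R) := forall tau, (0 <= tau)%R ->
  {ae mu, forall y, (1 < y)%R -> (y < c * expR (- tau))%R -> eta tau y = eta' tau y}.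

(** The exceptional null set of the trace relation depends on the base time, so only the countably
    many base times [k log 2] are used; their windows cover [[0, +oo[]. The points [s = k log 2] are
    removed, since there the trace would be read at [y = 1], outside the region where the solutions
    are compared. *)
Lemma trace_agree (c : R) : agree_below c ->
  {ae mu, forall s, (0 <= s)%R -> (expR s < c)%R -> beta s = beta' s}.
Proof.
move=> agr; have [_ _ _ tr] := sol; have [_ _ _ tr'] := sol'.
have ln20 : (0 < ln 2 :> R)%R by rewrite ln_gt0// ltr1n.
have : {ae mu, forall s, forall k : nat, [/\ (s != k%:R * ln 2)%R,
   (0 <= s - k%:R * ln 2 <= ln 2)%R ->
      beta s = (expR (s - k%:R * ln 2) * eta (k%:R * ln 2) (expR (s - k%:R * ln 2)))%R,
   (0 <= s - k%:R * ln 2 <= ln 2)%R ->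
      beta' s = (expR (s - k%:R * ln 2) * eta' (k%:R * ln 2) (expR (s - k%:R * ln 2)))%R &
   (0 < s - k%:R * ln 2)%R -> (expR (s - k%:R * ln 2) < c * expR (- (k%:R * ln 2)))%R ->
      eta (k%:R * ln 2) (expR (s - k%:R * ln 2)) = eta' (k%:R * ln 2) (expR (s - k%:R * ln 2))]}.
  apply/ae_foralln => k; have t0 : (0 <= k%:R * ln 2 :> R)%R by rewrite mulr_ge0// ltW.
  have A1 : {ae mu, forall s, (s != k%:R * ln 2)%R}.
    exists [set (k%:R * ln 2)%R]; split; [exact: measurable_set1|exact: lebesgue_measure_set1|].
    by move=> s /= /negP; rewrite negbK => /eqP.
  have A2 := ae_translate (k%:R * ln 2)%R (ae_expR (agr _ t0)).
  apply: aeS (aeI A1 (aeI (tr _ t0) (aeI (tr' _ t0) A2))) => s [H1 [H2 [H3 H4]]].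
  by split.
apply: aeS => s H s0 sc; pose k := Num.truncn (s / ln 2)%R.
have s20 : (0 <= s / ln 2)%R by rewrite divr_ge0// ltW.
have /andP[k1 k2] := truncn_itv s20.
rewrite ler_pdivlMr// in k1; rewrite ltr_pdivrMr// -natr1 mulrDl mul1r in k2.
have [n1 H2 H3 H4] := H k.
have sk : (0 <= s - k%:R * ln 2 <= ln 2)%R by rewrite subr_ge0 k1 lerBlDl ltW.
rewrite H2// H3// H4//; first by rewrite subr_gt0 lt_neqAle eq_sym n1.
by rewrite expRD ltr_pM2r ?expR_gt0.
Qed.

(** For [e^tau y < c + 1], the shift by one unit brings the argument of [Q] below [c e^(-s)], where
    the two states agree. If [e^s >= c] then [e^(tau - s) y < 2] and [T1] gives 0; at such times the
    traces are not yet known to agree. *)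
Lemma kernel_agree (c tau s : R) : (1 <= c)%R -> agree_below c -> (0 <= s)%R -> (s <= tau)%R ->
  {ae mu, forall y, (1 < y)%R -> (y < (c + 1) * expR (- tau))%R ->
    S_ (tau - s) (T1 (Q N p (ext0 (eta s)))) y = S_ (tau - s) (T1 (Q N p (ext0 (eta' s)))) y /\
    ((c <= expR s)%R -> S_ (tau - s) (T1 (Q N p (ext0 (eta s)))) y = 0%R)}.
Proof.
move=> c1 agr s0 st.
have [[iL _] _ _ _] := sol; have [[iL' _] _ _ _] := sol'.
have ext00 (w : R -> R) x : (x <= 0)%R -> ext0 w x = 0%R.
  by move=> x0; rewrite /ext0 ltNge (le_trans x0).
have ext_ae : {ae mu, forall x, (x < c * expR (- s))%R -> ext0 (eta s) x = ext0 (eta' s) x}.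
  by apply: aeS (agr s s0) => x H xc; rewrite /ext0; case: ifP => // x1; exact: H.
have Qae := Q_local_ae N p (measurable_ext0 (iL s s0)) (measurable_ext0 (iL' s s0))
  (ext00 _) (ext00 _) ext_ae.
have := ae_scale (expR_gt0 (tau - s)) (ae_translate 1 Qae).
apply: aeS => y H y1 yc.
have es1 : (expR (- s) <= 1)%R by rewrite -[leRHS]expR0 ler_expR oppr_le0.
have zc : (expR (tau - s) * y < (c + 1) * expR (- s))%R.
  rewrite (_ : expR (- s) = expR (tau - s) * expR (- tau))%R; last by rewrite -expRD; congr expR; ring.
  by rewrite mulrCA ltr_pM2l ?expR_gt0.
rewrite /S_ /T1 (ltW y1); split.
  case: leP => // z2; rewrite H//.
  rewrite ltrBlDr (lt_le_trans zc)// mulrDl mul1r lerD2l//.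
move=> cs; rewrite ifF ?mulr0//; apply/negbTE; rewrite -ltNge (lt_le_trans zc)//.
have cE : (c * expR (- s) <= 1)%R by rewrite expRN ler_pdivrMr ?expR_gt0// mul1r.
by rewrite mulrDl mul1r (le_trans (lerD cE es1)).
Qed.

(* [T1] translates by one unit, which is [e^s] in the variable [e^s y]: this is the
   gain from [c] to [c + 1]. *)
Lemma agree_step (c : R) : (1 <= c)%R -> agree_below c -> agree_below (c + 1).
Proof.
move=> c1 agr tau tau0; have [_ _ ie _] := sol; have [_ _ ie' _] := sol'.
have [g bg eg] := ie tau tau0; have [g' bg' eg'] := ie' tau tau0.
have gg : {ae mu, forall y, (1 < y)%R -> (y < (c + 1) * expR (- tau))%R -> g y = g' y}.
  apply: bochner_local bg bg' _ => //.
  apply: aeS (trace_agree agr) => s bs; rewrite /= in_itv/= => /andP[s0 st].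
  have [sc|cs] := ltP (expR s) c.
    apply: aeS (kernel_agree c1 agr s0 st) => y H y1 yc.
    by have [-> _] := H y1 yc; rewrite bs.
  apply: aeS (kernel_agree c1 agr s0 st) => y H y1 yc.
  by have [<- /(_ cs) ->] := H y1 yc; rewrite !mulr0.
apply: aeS (aeI gg (aeI eg eg')) => y [H1 [H2 H3]] y1 yc.
by rewrite H2// H3//= H1.
Qed.

Lemma agree_all (n : nat) : agree_below n.+1%:R.
Proof.
elim: n => [|n IH]; last by rewrite -natr1; apply: agree_step => //; rewrite ler1n.
(* The induction starts at [c = 1], where the region [1 < y < e^(-tau)] is empty. *)
move=> tau tau0; apply: aeW => y y1; rewrite mul1r => yt.
have := lt_trans y1 yt; rewrite ltNge -[X in (_ <= X)%R]expR0 ler_expR oppr_le0.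
by rewrite tau0.
Qed.

Lemma solution_unique :
  (forall tau, (0 <= tau)%R -> ae_eq1 (eta' tau) (eta tau)) /\
  {ae mu, forall tau, (0 <= tau)%R -> beta' tau = beta tau}.
Proof.
split=> [tau tau0|].
  have : {ae mu, forall y, forall n : nat, (1 < y)%R -> (y < n.+1%:R * expR (- tau))%R -> eta tau y = eta' tau y}.
    by apply/ae_foralln => n; exact: agree_all.
  apply: aeS => y H y1; rewrite (H (Num.truncn (y * expR tau)%R))//.
  by rewrite expRN ltr_pdivlMr ?expR_gt0// truncnS_gt.
have : {ae mu, forall s, forall n : nat, (0 <= s)%R -> (expR s < n.+1%:R)%R -> beta s = beta' s}.
  by apply/ae_foralln => n; apply: trace_agree; exact: agree_all.
by apply: aeS => s H s0; rewrite (H (Num.truncn (expR s)))// truncnS_gt.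
Qed.

End uniqueness.

(** * Choice of a representative of the initial datum, and conclusion *)

Section representative.
Local Open Scope ereal_scope.
Context {R : realType}.
Local Notation mu := (@lebesgue_measure R).

(* Positivity of [w] only holds almost everywhere, that of [f0] is needed pointwise. *)
Lemma nonneg_representative (w : R -> R) : inL1 w -> exists f0 : R -> R,
  [/\ measurable_fun [set: R] f0, forall x, `|f0 x|%R = `|ext0 w x|%R,
      {ae mu, forall y, (1 < y)%R -> f0 y = w y} & inP w -> forall x, (0 <= f0 x)%R].
Proof.
move=> iw; have mw := measurable_ext0 iw.
have [[_ w0 _]|nP] := pselect (inP w).
  exists (fun x => `|ext0 w x|%R); split => //.
  - by apply: measurableT_comp.
  - by move=> x; rewrite normr_id.
  - by apply: aeS w0 => y H y1; rewrite /ext0 y1 ger0_norm// H.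
by exists (ext0 w); split => //; apply: aeW => y y1; rewrite /ext0 y1.
Qed.

Lemma inP_norm1 (w : R -> R) : inP w -> norm1 w = 1.
Proof.
move=> [iw w0 <-]; have /integrableP[mw _] := iw.
apply: ae_eq_integral => //.
  by apply/measurable_EFinP; apply: measurableT_comp => //; exact/measurable_EFinP.
apply: aeS w0 => y H; rewrite /= in_itv/= andbT => y1.
by rewrite ger0_norm// H.
Qed.

Lemma inLp_wnorm_lty (r gamma : R) (w u : R -> R) : (0 < r)%R -> inLp r gamma w ->
  (forall x, `|u x|%R = `|ext0 w x|%R) -> wnorm r gamma u < +oo.
Proof.
move=> r0 [_ wr] uw.
rewrite (_ : wnorm r gamma u = \int[mu]_(y in `]1%R, +oo[) (((y `^ gamma * `|w y|) `^ r)%R)%:E).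
  exact: lty_poweRy (invr_neq0 (lt0r_neq0 r0)) wr.
rewrite [RHS]integral_mkcond; apply: eq_integral => x _; rewrite patchE mem_itv1y uw /ext0.
case: ifP => x1; first by rewrite (ger0_norm (ltW (lt_trans ltr01 x1))).
by rewrite normr0 mulr0 powR0// gt_eqF.
Qed.

End representative.

Theorem theorem3p3 (R : realType) (N : nat) (hN : (1 <= N)%N) (p : nat -> R)
    (hp : forall j, (1 <= j <= N)%N -> 0 <= p j)
    (hp1 : \sum_(1 <= j < N.+1) p j = 1)
    (eta0 : R -> R) (heta0 : inL1 eta0) (heta01 : (norm1 eta0 <= 1)%E) :
  exists (eta : R -> R -> R) (beta : R -> R),
    [/\ is_solution N p eta0 eta beta,
        forall (eta' : R -> R -> R) (beta' : R -> R),
          is_solution N p eta0 eta' beta' ->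
          (forall tau, 0 <= tau -> ae_eq1 (eta' tau) (eta tau)) /\
          {ae @lebesgue_measure R, forall tau, 0 <= tau -> beta' tau = beta tau},
        forall tau, 0 <= tau -> (norm1 (eta tau) <= 1)%E,
        inP eta0 -> forall tau, 0 <= tau -> inP (eta tau) &
        forall r gamma : R, 1 <= r -> 1 - r^-1 < gamma -> inLp r gamma eta0 ->
          inC0 (inLp r gamma) (normLp r gamma) eta].
Proof.
have [f0 [mf0 f0E f0ae f0P]] := nonneg_representative heta0.
have f00 x : x <= 1 -> f0 x = 0.
  by move=> x1; apply/eqP; rewrite -normr_eq0 f0E /ext0 ltNge x1 normr0.
have f0N : L1norm f0 = norm1 eta0.
  by rewrite norm1E; apply: eq_integral => x _; rewrite f0E.
have f01 : (L1norm f0 <= 1)%E by rewrite f0N.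
have sol : is_solution N p eta0 (mild N p f0) (trace N p f0).
  split.
  - exact: (mild_C0_L1 hp hp1 mf0 f00 f01).
  - exact: (trace_L1loc hp hp1 mf0 f00 f01).
  - exact: (mild_integral_equation hp hp1 mf0 f00 f01 f0ae).
  - exact: (mild_trace_relation N p f00).
exists (mild N p f0), (trace N p f0); split => //.
- by move=> eta' beta' sol'; exact: solution_unique sol sol'.
- by move=> tau tau0; exact: (norm1_mild hp hp1 mf0 f00 f01).
- move=> P0 tau tau0; apply: (inP_mild hp1 mf0 f00 hp _ tau0).
  by split; [exact: f0P|rewrite f0N inP_norm1].
- move=> r gamma r1 g1 Lp0; have r0 : 0 < r := lt_le_trans ltr01 r1.
  apply: (mild_C0_Lp hp hp1 mf0 f00 f01 r1); last exact: inLp_wnorm_lty r0 Lp0 f0E.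
  by apply: le_trans (ltW g1); rewrite subr_ge0 invf_le1.
Qed.
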